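(* Let $P$ be a TRAP and let $\sim$ be the equivalence relation on $\mathrm{CGr}(P)$ defined in the context. The quotient $\mathrm{uPGr}(P):=\mathrm{CGr}(P)/\sim$ (with the structure induced from $\mathrm{CGr}(P)$) is a unitary TRAP, containing a sub-TRAP isomorphic to $P$.
   Context: Notation: $\mathbb{N}_0=\{0,1,2,\dots\}$, $[k]=\{1,\dots,k\}$, $\mathfrak S_k$ is the symmetric group on $[k]$. TRAP. A TRAP is a family $P=(P(k,l))_{k,l\ge 0}$ of sets with: (1) for all $k,l\in\mathbb N_0$, a left action of $\mathfrak S_l$ and a right action of $\mathfrak S_k$ on $P(k,l)$ which commute (this is called an $\mathfrak S\times\mathfrak S^{op}$-module). (2) For all $k,l,k',l'\in\mathbb N_0$, maps $*:P(k,l)\times P(k',l')\to P(k+k',l+l')$ (horizontal concatenation) such that: $*$ is associative; there is $I_0\in P(0,0)$ with $I_0*p=p*I_0=p$; $(\sigma\cdot p\cdot\tau)*(\sigma'\cdot p'\cdot\tau')=(\sigma\otimes\sigma')\cdot(p*p')\cdot(\tau\otimes\tau')$, where for $\alpha\in\mathfrak S_m,\beta\in\mathfrak S_n$, $(\alpha\otimes\beta)(i)=\alpha(i)$ if $i\le m$ and $\beta(i-m)+m$ if $i>m$; and $c_{l,l'}\cdot(p*p')=(p'*p)\cdot c_{k,k'}$ for $p\in P(k,l)$, $p'\in P(k',l')$, where $c_{m,n}\in\mathfrak S_{m+n}$, $c_{m,n}(i)=i+n$ if $i\le m$ and $i-m$ if $i>m$. (3) For $k,l\ge1$, $i\in[k]$,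 $j\in[l]$, maps $t_{i,j}:P(k,l)\to P(k-1,l-1)$ (partial trace maps) such that: (a) for $k,l\ge2$, $i\in[k]$, $j\in[l]$, $i'\in[k-1]$, $j'\in[l-1]$: $t_{i',j'}\circ t_{i,j}$ equals $t_{i-1,j-1}\circ t_{i',j'}$ if $i'<i,j'<j$; $t_{i,j-1}\circ t_{i'+1,j'}$ if $i'\ge i,j'<j$; $t_{i-1,j}\circ t_{i',j'+1}$ if $i'<i,j'\ge j$; $t_{i,j}\circ t_{i'+1,j'+1}$ if $i'\ge i,j'\ge j$. (b) for $k,l\ge1$, $i\in[k]$, $j\in[l]$, $\sigma\in\mathfrak S_l$, $\tau\in\mathfrak S_k$, $p\in P(k,l)$: $t_{i,j}(\sigma\cdot p\cdot\tau)=\sigma_j\cdot t_{\tau(i),\sigma^{-1}(j)}(p)\cdot\tau_{\tau(i)}$, where for $\alpha\in\mathfrak S_n$ and $q\in[n]$, $\alpha_q\in\mathfrak S_{n-1}$ is the permutation whose word is obtained from the word $\alpha(1)\dots\alpha(n)$ by deleting the letter $q$ and subtracting $1$ from all letters $>q$. (c) for $k,l,k',l'\ge1$, $p\in P(k,l)$, $p'\in P(k',l')$, $i\in[k+k']$, $j\in[l+l']$: $t_{i,j}(p*p')=t_{i,j}(p)*p'$ if $i\le k,j\le l$, and $t_{i,j}(p*p')=p*t_{i-k,j-l}(p')$ if $i>k,j>l$. The TRAP is unitary if moreover there is $I\in P(1,1)$ such that for all $k,l\ge1$, $i\in[k+1]$, $j\in[l+1]$ and $p\in P(k,l)$: $t_{1,j}(I*p)=(1,2,\dots,j-1)\cdot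 p$ if $j\ge2$; $t_{i,1}(I*p)=p\cdot(1,2,\dots,i-1)^{-1}$ if $i\ge2$; $t_{k+1,j}(p*I)=(j,j+1,\dots,l)^{-1}\cdot p$ if $j\le l$; $t_{i,l+1}(p*I)=p\cdot(i,i+1,\dots,k)$ if $i\le k$ (here $(a,\dots,b)$ denotes a cycle). A sub-TRAP is a sub-$\mathfrak S\times\mathfrak S^{op}$-module containing $I_0$ and stable under $*$ and the partial traces. A morphism of TRAPs $\phi:P\to Q$ is a family of maps $P(k,l)\to Q(k,l)$ commuting with the symmetric group actions, with $\phi(I_0)=I_0$, $\phi(p*q)=\phi(p)*\phi(q)$ and $\phi\circ t_{i,j}=t_{i,j}\circ\phi$. Graphs. A graph $G$ consists of finite (possibly empty) sets $V(G)$ (vertices), $E(G)$ (internal edges), $I(G)$ (input edges), $O(G)$ (output edges), $IO(G)$ (input-output edges), $L(G)$ (loops, i.e. edges with no endpoints), a source map $s:E(G)\sqcup O(G)\to V(G)$, a target map $t:E(G)\sqcup I(G)\to V(G)$, and bijections $\alpha:I(G)\sqcup IO(G)\to[i(G)]$, $\beta:O(G)\sqcup IO(G)\to[o(G)]$, where $i(G)=|I(G)|+|IO(G)|$, $o(G)=|O(G)|+|IO(G)|$. The incoming (outgoing) edges of a vertex $v$ are the elements of $t^{-1}(v)$ (of $s^{-1}(v)$), their number is $i(v)$ (resp. $o(v)$). The graph is corolla ordered if for each vertex $v$ the incoming edges and the outgoing edges are each totally ordered. For a family of sets $X=(X(k,l))_{k,l\ge0}$, it is $X$-decorated if it has a map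 $d_G$ on $V(G)$ with $d_G(v)\in X(i(v),o(v))$. It is solar if $IO(G)=L(G)=\emptyset$. Isomorphisms are families of bijections between the six sets respecting $s,t,\alpha,\beta$, orders and decorations. $\mathrm{CGr}(X)(k,l)$ is the set of isomorphism classes of $X$-decorated corolla ordered graphs with $i(G)=k$, $o(G)=l$, and $\mathrm{solCGr}(X)(k,l)$ the subset of solar ones. TRAP structure on graphs. For $\tau\in\mathfrak S_l$, $\sigma\in\mathfrak S_k$, $\tau\cdot G\cdot\sigma$ is $G$ with $\alpha,\beta$ replaced by $\sigma^{-1}\circ\alpha$, $\tau\circ\beta$. $G*G'$ is the disjoint union, the input (output) labels of $G'$ being shifted by $i(G)$ (by $o(G)$); $I_0$ is the empty graph. For $t_{i,j}(G)$: let $e=\alpha^{-1}(i)$, $f=\beta^{-1}(j)$; remove $e$ and $f$ and add one new edge $g$: if $e\in I(G),f\in O(G)$, $g$ is internal with source $s(f)$ and target $t(e)$; if $e\in IO(G),f\in O(G)$, $g$ is an output edge with source $s(f)$ and output label $\beta(e)$; if $e\in I(G),f\in IO(G)$, $g$ is an input edge with target $t(e)$ and input label $\alpha(f)$; if $e\ne f$ are both in $IO(G)$, $g$ is an input-output edge with input label $\alpha(f)$ and output label $\beta(e)$; if $e=f\in IO(G)$, $g$ is a loop. Then all input labels $>i$ and output labels $>j$ are decreased by $1$; $g$ takes the position of $f$ among outgoing edges of $s(f)$ and of $e$ among incoming edges of $t(e)$. With this, $\mathrm{CGr}(X)$ is a unitary TRAP with unit the vertexless graph $I$ with a single input-output edge,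 and $\mathrm{solCGr}(X)$ is a sub-TRAP. Let $\mathcal O=t_{1,1}(I)$ be the graph with no vertex and a single loop. Powers $\mathcal O^{p}$, $I^{n}$ below are powers for $*$. Solar part, shuffles and valuation. Let $G\in\mathrm{CGr}(P)(k,l)$. One uses the following decomposition: there exist a unique $(p,k',l')\in\mathbb N_0^3$ with $k'\le k$, $l'\le l$, a unique solar graph $G'\in\mathrm{solCGr}(P)(k',l')$ and a unique pair of permutations $(\sigma,\tau)\in\mathfrak S_k\times\mathfrak S_l$ such that $\sigma(1)<\dots<\sigma(k')$ and $\sigma(k'+1)<\dots<\sigma(k)$ (i.e. $\sigma$ is a $(k',k-k')$-shuffle), $\tau(1)<\dots<\tau(l')$ and $\tau(l'+1)<\dots<\tau(l)$ (i.e. $\tau$ is an $(l',l-l')$-shuffle), and $G=\mathcal O^{p}*\tau^{-1}\cdot(G'*I^{k-k'})\cdot\sigma$. The graph $G'$ is called the solar part of $G$ and denoted $\mathrm{sol}(G)$; one sets $\mathrm{sh}_{in}(G):=\sigma$, $\mathrm{sh}_{out}(G):=\tau$, $\mathrm{val}_{\mathcal O}(G):=p$. The relation. For a TRAP $P$, $\Phi:\mathrm{solCGr}(P)\to P$ is the unique TRAP morphism extending the identity of $P$, i.e. sending, for each $p\in P(k,l)$, the graph with one vertex decorated by $p$, with $k$ input edges and $l$ output edges totally ordered at the vertex according to their indices, to $p$. For $G,G'\in\mathrm{CGr}(P)$, $G\sim G'$ if and only if $\Phi(\mathrm{sol}(G))=\Phi(\mathrm{sol}(G'))$, $\mathrm{sh}_{in}(G)=\mathrm{sh}_{in}(G')$,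 $\mathrm{sh}_{out}(G)=\mathrm{sh}_{out}(G')$ and $\mathrm{val}_{\mathcal O}(G)=\mathrm{val}_{\mathcal O}(G')$.
   Formalization: Axiom (3)(c) is required also when the untraced factor has no inputs or outputs (else Φ may not exist); the decomposition is G = O^p * τ·(G'*I^n)·σ^{-1}, σ a shuffle, τ increasing only on its first l' letters (the stated form fails, e.g. for crossing input-output edges). *)

(* Defs.v *)
From HB Require Import structures.
From mathcomp Require Import all_boot all_fingroup.
From mathcomp Require Import boolp.
From Stdlib Require Import RelationClasses.

Set Implicit Arguments.
Unset Strict Implicit.
Unset Printing Implicit Defensive.

(* Conventions.
   - [n] = {1, .., n} is rendered by 'I_n = {0, .., n-1}: every index is shifted
     by one.
   - In MathComp (s * t)%g x = t (s x), so that the composite "s o t" of the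
     usual conventions is (t * s)%g. *)

(** * Permutations *)

(* The value is x if x < i and x - 1 if x > i. *)
Lemma lower_subproof n (i x : 'I_n.+1) : x != i -> unbump i x < n.
Proof.
move=> ne; have /= := ltn_ord x; have := ltn_ord i; rewrite /unbump.
have : (x : nat) != i by []; case: (ltngtP i x) => // [lt_ix|gt_ix] _ hi hx.
  by rewrite subn1 -ltnS (ltn_predK lt_ix).
by rewrite subn0 (leq_trans gt_ix).
Qed.

Definition lower n (i x : 'I_n.+1) (ne : x != i) : 'I_n :=
  Ordinal (lower_subproof ne).

Lemma lift_lower n (i x : 'I_n.+1) (ne : x != i) : lift i (lower ne) = x.
Proof.
apply: val_inj; rewrite /= unbumpKcond.
by rewrite (negbTE (_ : (x : nat) != i)) // add0n.
Qed.

Lemma perm_del_neq n (s : 'S_n.+1) (q : 'I_n.+1) (x : 'I_n) :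
  s (lift (s^-1%g q) x) != q.
Proof.
by apply/eqP => /(canRL (permK s)) /esym/eqP; apply/negP; rewrite neq_lift.
Qed.

Lemma perm_del_inj n (s : 'S_n.+1) (q : 'I_n.+1) :
  injective (fun x => lower (perm_del_neq s q x)).
Proof.
move=> x y /(congr1 (lift q)); rewrite !lift_lower.
by move=> /perm_inj /lift_inj.
Qed.

(* In the word s(1) .. s(n+1), delete the letter q (which sits at position
   s^-1(q)) and subtract 1 from all larger letters. *)
Definition perm_del n (s : 'S_n.+1) (q : 'I_n.+1) : 'S_n :=
  perm (@perm_del_inj n s q).

Definition tens_perm_fun m n (s : 'S_m) (t : 'S_n) (i : 'I_(m + n)) :
    'I_(m + n) :=
  match split i with inl a => lshift n (s a) | inr b => rshift m (t b) end.

Lemma tens_perm_inj m n (s : 'S_m) (t : 'S_n) : injective (tens_perm_fun s t).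
Proof.
move=> i j; rewrite /tens_perm_fun.
case: (split_ordP i) => a ->; case: (split_ordP j) => b -> /eqP;
  rewrite ?eq_lshift ?eq_rshift ?eq_lrshift ?eq_rlshift //.
- by move=> /eqP/perm_inj->.
- by move=> /eqP/perm_inj->.
Qed.

Definition tens_perm m n (s : 'S_m) (t : 'S_n) : 'S_(m + n) :=
  perm (@tens_perm_inj m n s t).

Definition block_perm_fun m n (i : 'I_(m + n)) : 'I_(m + n) :=
  cast_ord (addnC n m)
    (match split i with inl a => rshift n a | inr b => lshift m b end).

Lemma block_perm_inj m n : injective (@block_perm_fun m n).
Proof.
move=> i j; rewrite /block_perm_fun => /cast_ord_inj.
case: (split_ordP i) => a ->; case: (split_ordP j) => b -> /eqP;
  by rewrite ?eq_lshift ?eq_rshift ?eq_lrshift ?eq_rlshift // => /eqP->.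
Qed.

(* c_{m,n} : the first m letters move up by n, the last n ones down by m. *)
Definition block_perm m n : 'S_(m + n) := perm (@block_perm_inj m n).

(* The cycle (a, a+1, .., b), for a <= b: lift_perm b a 1 sends b to a and is
   increasing on the complement of b. *)
Definition icycle n (a b : 'I_n.+1) : 'S_n.+1 := lift_perm b a 1%g.

Lemma icycleE n (a b : 'I_n.+1) (x : 'I_n.+1) : a <= b ->
  icycle a b x = (if a <= x < b then x.+1 else if x == b then val a else x)
    :> nat.
Proof.
move=> ab; rewrite /icycle permE /lift_perm_fun.
case: unliftP => [y ->|->]; last by rewrite eqxx ltnn andbF.
rewrite perm1 eq_sym (negbTE (neq_lift _ _)) /= /bump.
case: (leqP b y) => by_; case: (leqP a y) => ay; rewrite ?add1n ?add0n.
- by rewrite [_ < b]ltnNge (leqW by_) andbF.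
- by move: ay; rewrite ltnNge (leq_trans ab by_).
- by rewrite by_.
- done.
Qed.

(* (p, q)-shuffles are the permutations that are increasing both on the first p
   and on the remaining letters. *)
Definition incr_first n (p : nat) (s : 'S_n) : Prop :=
  forall a b : 'I_n, a < b -> b < p -> s a < s b.

Definition incr_last n (p : nat) (s : 'S_n) : Prop :=
  forall a b : 'I_n, p <= a -> a < b -> s a < s b.

Definition shuffle n (p : nat) (s : 'S_n) : Prop :=
  incr_first p s /\ incr_last p s.

(** * TRAPs *)

Definition acast (X : nat -> nat -> Type) k k' l l' (ek : k = k') (el : l = l')
    (x : X k l) : X k' l' :=
  match ek in _ = a, el in _ = b return X a b with erefl, erefl => x end.

Record trapData := TrapData {
  tcar :> nat -> nat -> Type;
  lact : forall k l, 'S_l -> tcar k l -> tcar k l;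
  ract : forall k l, tcar k l -> 'S_k -> tcar k l;
  hone : tcar 0 0;
  hcat : forall k l k' l', tcar k l -> tcar k' l' -> tcar (k + k') (l + l');
  ptr : forall k l, 'I_k.+1 -> 'I_l.+1 -> tcar k.+1 l.+1 -> tcar k l
}.
Arguments lact {t k l} _ _.
Arguments ract {t k l} _ _.
Arguments hone {t}.
Arguments hcat {t k l k' l'} _ _.
Arguments ptr {t k l} _ _ _.

(* In ptrA, for given i and i', the strand i' of t_{i,j}(p) is the strand
   lift i i' of p (i' if i' < i, and i' + 1 if i' >= i), and i is renumbered
   as i - (i' < i); likewise for j and j'. This covers the four cases
   i' < i or i' >= i, j' < j or j' >= j.
   In ptr_hcatl and ptr_hcatr the factor that is not traced may have no input or
   no output: the equations are required whenever both sides are defined. These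
   boundary cases hold for graphs and do not follow from the others; without
   them the identity of P need not extend to a morphism solCGr(P) -> P. *)
Record is_trap (P : trapData) : Prop := IsTrap {
  lact1 : forall k l (p : P k l), lact 1%g p = p;
  lactM : forall k l (s s' : 'S_l) (p : P k l),
    lact s (lact s' p) = lact (s' * s)%g p;
  ract1 : forall k l (p : P k l), ract p 1%g = p;
  ractM : forall k l (t t' : 'S_k) (p : P k l),
    ract (ract p t) t' = ract p (t' * t)%g;
  lractA : forall k l (s : 'S_l) (t : 'S_k) (p : P k l),
    lact s (ract p t) = ract (lact s p) t;
  hcatA : forall k l k' l' k'' l'' (p : P k l) (q : P k' l') (r : P k'' l''),
    acast (addnA k k' k'') (addnA l l' l'') (hcat p (hcat q r)) =
    hcat (hcat p q) r;
  hcat1p : forall k l (p : P k l), hcat hone p = p;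
  hcatp1 : forall k l (p : P k l),
    acast (addn0 k) (addn0 l) (hcat p hone) = p;
  hcat_act : forall k l k' l' (s : 'S_l) (t : 'S_k) (s' : 'S_l') (t' : 'S_k')
      (p : P k l) (p' : P k' l'),
    hcat (ract (lact s p) t) (ract (lact s' p') t') =
    ract (lact (tens_perm s s') (hcat p p')) (tens_perm t t');
  hcatC : forall k l k' l' (p : P k l) (p' : P k' l'),
    lact (block_perm l l') (hcat p p') =
    ract (acast (addnC k' k) (addnC l' l) (hcat p' p)) (block_perm k k');
  ptrA : forall k l (i : 'I_k.+2) (j : 'I_l.+2) (i' : 'I_k.+1) (j' : 'I_l.+1)
      (p : P k.+2 l.+2),
    ptr i' j' (ptr i j p) =
    ptr (inord (i - (i' < i))) (inord (j - (j' < j)))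
      (ptr (lift i i') (lift j j') p);
  ptr_act : forall k l (i : 'I_k.+1) (j : 'I_l.+1) (s : 'S_l.+1) (t : 'S_k.+1)
      (p : P k.+1 l.+1),
    ptr i j (ract (lact s p) t) =
    ract (lact (perm_del s j) (ptr (t i) (s^-1%g j) p)) (perm_del t (t i));
  ptr_hcatl : forall k l k' l' (p : P k.+1 l.+1) (p' : P k' l')
      (i : 'I_k.+1) (j : 'I_l.+1),
    ptr (lshift k' i : 'I_(k + k').+1) (lshift l' j : 'I_(l + l').+1)
      (hcat p p' : P (k + k').+1 (l + l').+1) =
    hcat (ptr i j p) p';
  ptr_hcatr : forall k l k' l' (p : P k l) (p' : P k'.+1 l'.+1)
      (i : 'I_k'.+1) (j : 'I_l'.+1),
    ptr (cast_ord (addnS k k') (rshift k i))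
        (cast_ord (addnS l l') (rshift l j))
        (acast (addnS k k') (addnS l l') (hcat p p')) =
    hcat p (ptr i j p')
}.

Record trap := Trap { trap_data :> trapData; trapP : is_trap trap_data }.

(* The unit laws. The conditions j >= 2, i >= 2, j <= l and i <= k on an index
   are expressed by the indices lift ord0 j, lift ord0 i, lshift 1 j and
   lshift 1 i, respectively; k and l are the k.+1 and l.+1 below. *)
Record is_unit (P : trapData) (I : P 1 1) : Prop := IsUnit {
  ptr_unit_out : forall k l (j : 'I_l.+1) (p : P k.+1 l.+1),
    ptr ord0 (lift ord0 j) (hcat I p : P k.+2 l.+2) = lact (icycle ord0 j) p;
  ptr_unit_in : forall k l (i : 'I_k.+1) (p : P k.+1 l.+1),
    ptr (lift ord0 i) ord0 (hcat I p : P k.+2 l.+2) =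
    ract p (icycle ord0 i)^-1%g;
  ptr_out_unit : forall k l (j : 'I_l.+1) (p : P k.+1 l.+1),
    acast (addn1 k) (addn1 l)
      (ptr ord_max (lshift 1 j : 'I_(l + 1).+1)
        (hcat p I : P (k + 1).+1 (l + 1).+1)) =
    lact (icycle j ord_max)^-1%g p;
  ptr_in_unit : forall k l (i : 'I_k.+1) (p : P k.+1 l.+1),
    acast (addn1 k) (addn1 l)
      (ptr (lshift 1 i : 'I_(k + 1).+1) ord_max
        (hcat p I : P (k + 1).+1 (l + 1).+1)) =
    ract p (icycle i ord_max)
}.

Arguments is_unit P I : clear implicits.

Record trap_morphism (P Q : trapData) (phi : forall k l, P k l -> Q k l) :
    Prop := TrapMorphism {
  morph_lact : forall k l (s : 'S_l) (p : P k l),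
    phi k l (lact s p) = lact s (phi k l p);
  morph_ract : forall k l (t : 'S_k) (p : P k l),
    phi k l (ract p t) = ract (phi k l p) t;
  morph_hone : phi 0 0 hone = hone;
  morph_hcat : forall k l k' l' (p : P k l) (q : P k' l'),
    phi _ _ (hcat p q) = hcat (phi k l p) (phi k' l' q);
  morph_ptr : forall k l (i : 'I_k.+1) (j : 'I_l.+1) (p : P k.+1 l.+1),
    phi k l (ptr i j p) = ptr i j (phi k.+1 l.+1 p)
}.

Definition trap_isomorphic (P Q : trapData) : Prop :=
  exists phi : forall k l, P k l -> Q k l,
    trap_morphism phi /\ forall k l, bijective (phi k l).

Record is_subtrap (P : trapData) (S : forall k l, P k l -> Prop) : Prop :=
  IsSubtrap {
  sub_lact : forall k l (s : 'S_l) (p : P k l), S k l p -> S k l (lact s p);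
  sub_ract : forall k l (t : 'S_k) (p : P k l), S k l p -> S k l (ract p t);
  sub_hone : S 0 0 hone;
  sub_hcat : forall k l k' l' (p : P k l) (q : P k' l'),
    S k l p -> S k' l' q -> S _ _ (hcat p q);
  sub_ptr : forall k l (i : 'I_k.+1) (j : 'I_l.+1) (p : P k.+1 l.+1),
    S k.+1 l.+1 p -> S k l (ptr i j p)
}.

Definition subTrap (P : trapData) (S : forall k l, P k l -> Prop)
    (closedS : is_subtrap S) : trapData :=
  @TrapData (fun k l => {p : P k l | S k l p})
    (fun k l s p => exist _ _ (sub_lact closedS s (svalP p)))
    (fun k l p t => exist _ _ (sub_ract closedS t (svalP p)))
    (exist _ _ (sub_hone closedS))
    (fun k l k' l' p q =>
       exist _ _ (sub_hcat closedS (svalP p) (svalP q)))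
    (fun k l i j p => exist _ _ (sub_ptr closedS i j (svalP p))).

(** * Quotients *)

(* The set of all classes {y | R x y}. *)
Definition quot (T : Type) (R : T -> T -> Prop) : Type :=
  {A : T -> Prop | exists x, A = R x}.

Definition cls (T : Type) (R : T -> T -> Prop) (x : T) : quot R :=
  exist _ (R x) (ex_intro _ x erefl).

Definition rep (T : Type) (R : T -> T -> Prop) (c : quot R) : T :=
  sval (cid (svalP c)).

Lemma repK (T : Type) (R : T -> T -> Prop) : cancel (@rep T R) (@cls T R).
Proof.
move=> c; rewrite /rep; case: cid => x /= def_c.
by case: c def_c => A hA /= def_c; apply: eq_exist; rewrite -def_c.
Qed.

Lemma cls_eq (T : Type) (R : T -> T -> Prop) (x y : T) :
  Equivalence R -> cls R x = cls R y <-> R x y.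
Proof.
move=> [Rr Rs Rt]; split=> [/(congr1 sval) /= ->|Rxy]; first exact: Rr.
apply: eq_exist => /=; apply/funext => z; apply/propext.
by split; apply: Rt => //; apply: Rs.
Qed.

(* The structure induced on the quotient by R, computed on representatives. *)
Definition quotTrap (P : trapData) (R : forall k l, P k l -> P k l -> Prop) :
    trapData :=
  @TrapData (fun k l => quot (R k l))
    (fun k l s p => cls (R k l) (lact s (rep p)))
    (fun k l p t => cls (R k l) (ract (rep p) t))
    (cls (R 0 0) hone)
    (fun k l k' l' p q => cls (R _ _) (hcat (rep p) (rep q)))
    (fun k l i j p => cls (R k l) (ptr i j (rep p))).

(** * Graphs *)

Lemma inj_surj_bij (A B : Type) (f : A -> B) :
  injective f -> (forall y, exists x, f x = y) -> bijective f.
Proof.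
move=> inj_f surj_f; exists (fun y => sval (cid (surj_f y))) => [x|y].
  by apply: inj_f; case: cid.
by case: cid.
Qed.

Definition sum_map (A B C D : Type) (f : A -> C) (g : B -> D) (x : A + B) :
    C + D :=
  match x with inl a => inl (f a) | inr b => inr (g b) end.

(* X-decorated corolla ordered graphs with k inputs and l outputs. The total
   order on the outgoing (incoming) edges of a vertex is encoded by their
   increasing enumeration: gsrc e (gtgt e) is the source (target) of e together
   with the position of e among the outgoing (incoming) edges of that vertex, so
   that every position is taken exactly once; gin v and gout v are then the
   numbers of incoming and outgoing edges of v (see card_incoming,
   card_outgoing). *)
Record graph (X : nat -> nat -> Type) (k l : nat) := Graph {
  gV : finType;
  gE : finType;
  gI : finType;
  gO : finType;
  gIO : finType;
  gL : finType;
  gin : gV -> nat;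
  gout : gV -> nat;
  gsrc : gE + gO -> {v : gV & 'I_(gout v)};
  gtgt : gE + gI -> {v : gV & 'I_(gin v)};
  galpha : gI + gIO -> 'I_k;
  gbeta : gO + gIO -> 'I_l;
  gdec : forall v : gV, X (gin v) (gout v);
  gsrc_bij : bijective gsrc;
  gtgt_bij : bijective gtgt;
  galpha_bij : bijective galpha;
  gbeta_bij : bijective gbeta
}.
Arguments gsrc {X k l g} _.
Arguments gtgt {X k l g} _.
Arguments galpha {X k l g} _.
Arguments gbeta {X k l g} _.
Arguments gdec {X k l g} _.

Lemma card_fiber (E V : finType) (n : V -> nat) (f : E -> {v : V & 'I_(n v)})
    (v : V) : bijective f -> #|[pred e | tag (f e) == v]| = n v.
Proof.
move=> [g fK gK]; rewrite -[RHS]card_ord.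
pose h (x : 'I_(n v)) := g (Tagged (fun v => 'I_(n v)) x).
have inj_h : injective h.
  by move=> x y /(can_inj gK)/eqP; rewrite eq_Tagged /= => /eqP.
rewrite -(card_codom inj_h); apply: eq_card => e; rewrite inE.
apply/eqP/codomP => [|[x ->]]; last by rewrite /h gK.
case def_e: (f e) => [w x] /= ew; subst w.
by exists x; rewrite /h -[e]fK def_e.
Qed.

Lemma card_incoming X k l (G : graph X k l) (v : gV G) :
  #|[pred e : gE G + gI G | tag (gtgt e) == v]| = gin v.
Proof. exact: card_fiber (gtgt_bij G). Qed.

Lemma card_outgoing X k l (G : graph X k l) (v : gV G) :
  #|[pred e : gE G + gO G | tag (gsrc e) == v]| = gout v.
Proof. exact: card_fiber (gsrc_bij G). Qed.

Definition solar X k l (G : graph X k l) : Prop :=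
  #|gIO G| = 0 /\ #|gL G| = 0.

Record giso X k l (G H : graph X k l) := Giso {
  isoV : gV G -> gV H;
  isoE : gE G -> gE H;
  isoI : gI G -> gI H;
  isoO : gO G -> gO H;
  isoIO : gIO G -> gIO H;
  isoL : gL G -> gL H;
  isoV_bij : bijective isoV;
  isoE_bij : bijective isoE;
  isoI_bij : bijective isoI;
  isoO_bij : bijective isoO;
  isoIO_bij : bijective isoIO;
  isoL_bij : bijective isoL;
  iso_src : forall e, let f := sum_map isoE isoO e in
    tag (gsrc f) = isoV (tag (gsrc e)) /\
    tagged (gsrc f) = tagged (gsrc e) :> nat;
  iso_tgt : forall e, let f := sum_map isoE isoI e in
    tag (gtgt f) = isoV (tag (gtgt e)) /\
    tagged (gtgt f) = tagged (gtgt e) :> nat;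
  iso_alpha : forall e, galpha (sum_map isoI isoIO e) = galpha e;
  iso_beta : forall e, gbeta (sum_map isoO isoIO e) = gbeta e;
  iso_dec : forall v,
    exists (ei : gin v = gin (isoV v)) (eo : gout v = gout (isoV v)),
      acast ei eo (gdec v) = gdec (isoV v)
}.

Definition isomorphic X k l (G H : graph X k l) : Prop := inhabited (giso G H).

Lemma sum_map_id (A B : Type) (x : A + B) : sum_map id id x = x.
Proof. by case: x. Qed.

Lemma sum_mapK (A B C D : Type) (f : A -> C) (g : B -> D) f' g' :
  cancel f f' -> cancel g g' -> cancel (sum_map f g) (sum_map f' g').
Proof. by move=> fK gK [] x /=; rewrite ?fK ?gK. Qed.

Lemma sum_map_comp (A B C A' B' C' : Type) (f : A -> B) (g : B -> C)
    (f' : A' -> B') (g' : B' -> C') (x : A + A') :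
  sum_map g g' (sum_map f f' x) = sum_map (g \o f) (g' \o f') x.
Proof. by case: x. Qed.

Lemma isomorphic_refl X k l (G : graph X k l) : isomorphic G G.
Proof.
split; exists id id id id id id; try exact: (Bijective (g := id)).
- by move=> e; rewrite sum_map_id.
- by move=> e; rewrite sum_map_id.
- by move=> e; rewrite sum_map_id.
- by move=> e; rewrite sum_map_id.
- by move=> v; exists erefl, erefl.
Qed.

Lemma isomorphic_sym X k l (G H : graph X k l) :
  isomorphic G H -> isomorphic H G.
Proof.
case=> -[fV fE fI fO fIO fL [gV fVK gVK] [gE fEK gEK] [gI fIK gIK]
  [gO fOK gOK] [gIO fIOK gIOK] [gL fLK gLK] eS eT eA eB eD].
split; exists gV gE gI gO gIO gL;
  try (by eexists; eassumption).
- move=> e; have := eS (sum_map gE gO e); rewrite sum_mapK // => -[t p].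
  by split; [rewrite t fVK|rewrite p].
- move=> e; have := eT (sum_map gE gI e); rewrite sum_mapK // => -[t p].
  by split; [rewrite t fVK|rewrite p].
- by move=> e; rewrite -eA; case: e => e /=; rewrite ?gIK ?gIOK.
- by move=> e; rewrite -eB; case: e => e /=; rewrite ?gOK ?gIOK.
- move=> v; have [] := eD (gV v); rewrite gVK => ei [eo <-].
  exists (esym ei), (esym eo).
  by case: _ / ei; case: _ / eo.
Qed.

Lemma isomorphic_trans X k l (G H K : graph X k l) :
  isomorphic G H -> isomorphic H K -> isomorphic G K.
Proof.
case=> -[fV fE fI fO fIO fL bV bE bI bO bIO bL eS eT eA eB eD].
case=> -[gV gE gI gO gIO gL cV cE cI cO cIO cL hS hT hA hB hD].
split; exists (gV \o fV) (gE \o fE) (gI \o fI) (gO \o fO) (gIO \o fIO)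
  (gL \o fL); try exact: bij_comp.
- move=> e; have [t p] := eS e; have [t' p'] := hS (sum_map fE fO e).
  by rewrite /= -sum_map_comp; split; [rewrite t' t|rewrite p' p].
- move=> e; have [t p] := eT e; have [t' p'] := hT (sum_map fE fI e).
  by rewrite /= -sum_map_comp; split; [rewrite t' t|rewrite p' p].
- by move=> e; rewrite -eA -hA; case: e.
- by move=> e; rewrite -eB -hB; case: e.
- move=> v /=; have [ei [eo]] := eD v; have [ei' [eo']] := hD (fV v).
  move=> <- <-; exists (etrans ei ei'), (etrans eo eo').
  by case: _ / ei'; case: _ / eo'.
Qed.

Lemma isomorphic_equiv X k l : Equivalence (@isomorphic X k l).
Proof.
split; [exact: isomorphic_refl|exact: isomorphic_sym|exact: isomorphic_trans].
Qed.

(** ** Symmetric group actions, disjoint union *)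

Lemma perm_bij n (s : 'S_n) : bijective s.
Proof. exact: injF_bij perm_inj. Qed.

Definition graph_lact X k l (s : 'S_l) (G : graph X k l) : graph X k l :=
  @Graph X k l _ _ _ _ _ (gL G) _ _ gsrc gtgt galpha
    (s \o gbeta) gdec (gsrc_bij G) (gtgt_bij G) (galpha_bij G)
    (bij_comp (perm_bij s) (gbeta_bij G)).

Definition graph_ract X k l (G : graph X k l) (t : 'S_k) : graph X k l :=
  @Graph X k l _ _ _ _ _ (gL G) _ _ gsrc gtgt (t^-1%g \o galpha)
    gbeta gdec (gsrc_bij G) (gtgt_bij G)
    (bij_comp (perm_bij t^-1%g) (galpha_bij G)) (gbeta_bij G).

Definition sum_swap (A B C D : Type) (x : (A + B) + (C + D)) :
    (A + C) + (B + D) :=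
  match x with
  | inl (inl a) => inl (inl a)
  | inl (inr b) => inr (inl b)
  | inr (inl c) => inl (inr c)
  | inr (inr d) => inr (inr d)
  end.

Lemma sum_swap_bij (A B C D : Type) : bijective (@sum_swap A B C D).
Proof. by exists (@sum_swap A C B D) => [] [] []. Qed.

Definition sum_fun (A B : Type) (C : A + B -> Type) (f : forall a, C (inl a))
    (g : forall b, C (inr b)) (x : A + B) : C x :=
  match x with inl a => f a | inr b => g b end.

Definition sum_ends (V V' : Type) (n : V -> nat) (n' : V' -> nat) (A A' : Type)
    (f : A -> {v : V & 'I_(n v)}) (f' : A' -> {v : V' & 'I_(n' v)})
    (x : A + A') : {v : V + V' & 'I_(sum_fun n n' v)} :=
  match x with
  | inl a => existT (fun v => 'I_(sum_fun n n' v)) (inl (tag (f a)))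
               (tagged (f a))
  | inr a => existT (fun v => 'I_(sum_fun n n' v)) (inr (tag (f' a)))
               (tagged (f' a))
  end.

Lemma sum_ends_bij (V V' : Type) (n : V -> nat) (n' : V' -> nat) (A A' : Type)
    (f : A -> {v : V & 'I_(n v)}) (f' : A' -> {v : V' & 'I_(n' v)}) :
  bijective f -> bijective f' -> bijective (sum_ends f f').
Proof.
move=> [g fK gK] [g' fK' gK'].
exists (fun y =>
  match tag y as v return 'I_(sum_fun n n' v) -> A + A' with
  | inl v => fun i => inl (g (existT _ v i))
  | inr v => fun i => inr (g' (existT _ v i))
  end (tagged y)).
- by move=> [a|a] /=; congr (_ _); rewrite -[RHS](fK, fK'); congr (_ _);
    [case: (f a)|case: (f' a)].
- by move=> [[v|v] i] /=; rewrite ?gK ?gK'.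
Qed.

Definition sum_labels k k' (A A' : Type) (f : A -> 'I_k) (f' : A' -> 'I_k')
    (x : A + A') : 'I_(k + k') :=
  unsplit (sum_map f f' x).

Lemma sum_labels_bij k k' (A A' : Type) (f : A -> 'I_k) (f' : A' -> 'I_k') :
  bijective f -> bijective f' -> bijective (sum_labels f f').
Proof.
move=> [g fK gK] [g' fK' gK']; exists (sum_map g g' \o @split k k').
- by move=> x; rewrite /sum_labels /= unsplitK sum_mapK.
- by move=> x; rewrite /sum_labels /= sum_mapK // splitK.
Qed.

Definition graph_hcat X k l k' l' (G : graph X k l) (G' : graph X k' l') :
    graph X (k + k') (l + l') :=
  @Graph X (k + k') (l + l')
    (gV G + gV G')%type (gE G + gE G')%type (gI G + gI G')%type
    (gO G + gO G')%type (gIO G + gIO G')%type (gL G + gL G')%type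
    (sum_fun (@gin _ _ _ G) (@gin _ _ _ G'))
    (sum_fun (@gout _ _ _ G) (@gout _ _ _ G'))
    (sum_ends gsrc gsrc \o @sum_swap _ _ _ _)
    (sum_ends gtgt gtgt \o @sum_swap _ _ _ _)
    (sum_labels galpha galpha \o @sum_swap _ _ _ _)
    (sum_labels gbeta gbeta \o @sum_swap _ _ _ _)
    (@sum_fun (gV G) (gV G')
       (fun v => X (sum_fun (@gin _ _ _ G) (@gin _ _ _ G') v)
                   (sum_fun (@gout _ _ _ G) (@gout _ _ _ G') v))
       (@gdec _ _ _ G) (@gdec _ _ _ G'))
    (bij_comp (sum_ends_bij (gsrc_bij G) (gsrc_bij G')) (@sum_swap_bij _ _ _ _))
    (bij_comp (sum_ends_bij (gtgt_bij G) (gtgt_bij G')) (@sum_swap_bij _ _ _ _))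
    (bij_comp (sum_labels_bij (galpha_bij G) (galpha_bij G'))
       (@sum_swap_bij _ _ _ _))
    (bij_comp (sum_labels_bij (gbeta_bij G) (gbeta_bij G'))
       (@sum_swap_bij _ _ _ _)).

(** ** Partial traces *)

(* h is a bijection of its source onto the complement of e. *)
Record onto_compl (A B : Type) (e : A) (h : B -> A) : Prop := OntoCompl {
  onto_inj : injective h;
  onto_neq : forall b, h b <> e;
  onto_surj : forall a, a <> e -> exists b, h b = a
}.

Lemma relabel_neq (A B : Type) n (f : A -> 'I_n.+1) (e : A) (h : B -> A) :
  bijective f -> onto_compl e h -> forall b, f (h b) != f e.
Proof. by move=> bij_f hP b; apply/eqP => /(bij_inj bij_f)/(onto_neq hP). Qed.

Definition relabel (A B : Type) n (f : A -> 'I_n.+1) (e : A) (h : B -> A)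
    (bij_f : bijective f) (hP : onto_compl e h) (b : B) : 'I_n :=
  lower (relabel_neq bij_f hP b).

Lemma relabel_bij (A B : Type) n (f : A -> 'I_n.+1) (e : A) (h : B -> A)
    (bij_f : bijective f) (hP : onto_compl e h) : bijective (relabel bij_f hP).
Proof.
apply: inj_surj_bij => [b b'|x].
  move=> /(congr1 (lift (f e))); rewrite !lift_lower => /(bij_inj bij_f).
  by move/(onto_inj hP).
have [g fK gK] := bij_f.
have /(onto_surj hP)[b def_b] : g (lift (f e) x) <> e.
  by move/(congr1 f)/eqP; rewrite gK eq_sym (negbTE (neq_lift _ _)).
by exists b; apply: (@lift_inj _ (f e)); rewrite lift_lower def_b gK.
Qed.

(* The edges of the new graph are described by those of G: an edge x has the
   source (and the position there) of hs x, the target (and the position there)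
   of ht x, the input label of hi x and the output label of ho x. The input
   label of e and the output label of f disappear, and the greater ones are
   decreased by 1. *)
Definition rewire X k l (G : graph X k.+1 l.+1)
    (e : gI G + gIO G) (f : gO G + gIO G) (E' I' O' IO' L' : finType)
    (hs : E' + O' -> gE G + gO G) (ht : E' + I' -> gE G + gI G)
    (hi : I' + IO' -> gI G + gIO G) (ho : O' + IO' -> gO G + gIO G)
    (hs_bij : bijective hs) (ht_bij : bijective ht)
    (hiP : onto_compl e hi) (hoP : onto_compl f ho) : graph X k l :=
  @Graph X k l (gV G) E' I' O' IO' L' _ _ (gsrc \o hs) (gtgt \o ht)
    (relabel (galpha_bij G) hiP) (relabel (gbeta_bij G) hoP) gdec
    (bij_comp (gsrc_bij G) hs_bij) (bij_comp (gtgt_bij G) ht_bij)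
    (relabel_bij (galpha_bij G) hiP) (relabel_bij (gbeta_bij G) hoP).

Section RewiringMaps.
Variables A B : finType.

(* In each of the following maps, None is the edge created by the trace. *)

Definition none_to_r (b : B) (x : option A + {x : B | x != b}) : A + B :=
  match x with
  | inl (Some a) => inl a
  | inl None => inr b
  | inr y => inr (val y)
  end.

Definition none_in_r (b : B) (x : A + option {x : B | x != b}) : A + B :=
  match x with
  | inl a => inl a
  | inr (Some y) => inr (val y)
  | inr None => inr b
  end.

Definition del_l (a : A) (x : {x : A | x != a} + B) : A + B :=
  sum_map val id x.

Definition del_r (b : B) (x : A + {x : B | x != b}) : A + B :=
  sum_map id val x.

Definition del_l_none_to_r (a : A) (b : B)
    (x : option {x : A | x != a} + {x : B | x != b}) : A + B :=
  match x with
  | inl (Some y) => inl (val y)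
  | inl None => inr b
  | inr y => inr (val y)
  end.

Definition del_r_none_in_r (b b' c : B)
    (x : A + option {x : B | (x != b) && (x != b')}) : A + B :=
  match x with
  | inl a => inl a
  | inr (Some y) => inr (val y)
  | inr None => inr c
  end.

Lemma none_to_r_bij b : bijective (@none_to_r b).
Proof.
apply: inj_surj_bij.
  move=> [[x|]|[x hx]] [[y|]|[y hy]] //= [] e; subst => //.
  - by exfalso; move: hy; rewrite eqxx.
  - by exfalso; move: hx; rewrite eqxx.
  - by congr inr; apply: val_inj.
move=> [a|c]; first by exists (inl (Some a)).
case: (eqVneq c b) => [->|cb]; first by exists (inl None).
by exists (inr (exist _ c cb)).
Qed.

Lemma none_in_r_bij b : bijective (@none_in_r b).
Proof.
apply: inj_surj_bij.
  move=> [x|[[x hx]|]] [y|[[y hy]|]] //= [] e; subst => //.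
  - by congr (inr (Some _)); apply: val_inj.
  - by exfalso; move: hx; rewrite eqxx.
  - by exfalso; move: hy; rewrite eqxx.
move=> [a|c]; first by exists (inl a).
case: (eqVneq c b) => [->|cb]; first by exists (inr None).
by exists (inr (Some (exist _ c cb))).
Qed.

Lemma del_lP a : onto_compl (inl a) (@del_l a).
Proof.
split.
- move=> [[x hx]|x] [[y hy]|y] //= [] e; subst => //.
  by congr inl; apply: val_inj.
- by move=> [[x hx]|x] //= [] e; rewrite e eqxx in hx.
- move=> [c|b] ne; last by exists (inr b).
  have ca : c != a by apply/eqP => ca; rewrite ca in ne.
  by exists (inl (exist _ c ca)).
Qed.

Lemma del_rP b : onto_compl (inr b) (@del_r b).
Proof.
split.
- move=> [x|[x hx]] [y|[y hy]] //= [] e; subst => //.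
  by congr inr; apply: val_inj.
- by move=> [x|[x hx]] //= [] e; rewrite e eqxx in hx.
- move=> [a|c] ne; first by exists (inl a).
  have cb : c != b by apply/eqP => cb; rewrite cb in ne.
  by exists (inr (exist _ c cb)).
Qed.

Lemma del_l_none_to_rP a b : onto_compl (inl a) (@del_l_none_to_r a b).
Proof.
split.
- move=> [[[x hx]|]|[x hx]] [[[y hy]|]|[y hy]] //= [] e; subst => //.
  + by congr (inl (Some _)); apply: val_inj.
  + by exfalso; move: hy; rewrite eqxx.
  + by exfalso; move: hx; rewrite eqxx.
  + by congr inr; apply: val_inj.
- by move=> [[[x hx]|]|[x hx]] //= [] e; rewrite e eqxx in hx.
- move=> [c|c] ne.
    have ca : c != a by apply/eqP => ca; rewrite ca in ne.
    by exists (inl (Some (exist _ c ca))).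
  case: (eqVneq c b) => [->|cb]; first by exists (inl None).
  by exists (inr (exist _ c cb)).
Qed.

Lemma del_r_none_in_rPl (b b' : B) :
  b != b' -> onto_compl (inr b) (@del_r_none_in_r b b' b').
Proof.
move=> bb'; split.
- move=> [x|[[x hx]|]] [y|[[y hy]|]] //= [] e; subst => //.
  + by congr (inr (Some _)); apply: val_inj.
  + by exfalso; move: hx; rewrite eqxx andbF.
  + by exfalso; move: hy; rewrite eqxx andbF.
- move=> [x|[[x hx]|]] //= [] e.
    by exfalso; move: hx; rewrite e eqxx.
  by rewrite e eqxx in bb'.
- move=> [a|c] ne; first by exists (inl a).
  case: (eqVneq c b') => [->|cb']; first by exists (inr None).
  have cb : (c != b) && (c != b').
    by rewrite cb' andbT; apply/eqP => cb; rewrite cb in ne.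
  by exists (inr (Some (exist _ c cb))).
Qed.

Lemma del_r_none_in_rPr (b b' : B) :
  b != b' -> onto_compl (inr b') (@del_r_none_in_r b b' b).
Proof.
move=> bb'; split.
- move=> [x|[[x hx]|]] [y|[[y hy]|]] //= [] e; subst => //.
  + by congr (inr (Some _)); apply: val_inj.
  + by exfalso; move: hx; rewrite eqxx.
  + by exfalso; move: hy; rewrite eqxx.
- move=> [x|[[x hx]|]] //= [] e.
    by exfalso; move: hx; rewrite e eqxx andbF.
  by rewrite e eqxx in bb'.
- move=> [a|c] ne; first by exists (inl a).
  case: (eqVneq c b) => [->|cb]; first by exists (inr None).
  have cb' : (c != b) && (c != b').
    by rewrite cb; apply/eqP => cb'; rewrite cb' in ne.
  by exists (inr (Some (exist _ c cb'))).
Qed.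

End RewiringMaps.

Section Trace.
Variables (X : nat -> nat -> Type) (k l : nat) (G : graph X k.+1 l.+1).

Lemma id_bij (T : Type) : bijective (@id T).
Proof. by exists id. Qed.

Definition trace_internal (e : gI G) (f : gO G) : graph X k l :=
  @rewire X k l G (inl e) (inl f)
    (option (gE G)) {x : gI G | x != e} {x : gO G | x != f} (gIO G) (gL G)
    _ _ _ _ (none_to_r_bij (gE G) f) (none_to_r_bij (gE G) e)
    (del_lP (gIO G) e) (del_lP (gIO G) f).

Definition trace_output (e : gIO G) (f : gO G) : graph X k l :=
  @rewire X k l G (inr e) (inl f)
    (gE G) (gI G) (option {x : gO G | x != f}) {x : gIO G | x != e} (gL G)
    _ _ _ _ (none_in_r_bij (gE G) f) (id_bij _)
    (del_rP (gI G) e) (del_l_none_to_rP f e).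

Definition trace_input (e : gI G) (f : gIO G) : graph X k l :=
  @rewire X k l G (inl e) (inr f)
    (gE G) (option {x : gI G | x != e}) (gO G) {x : gIO G | x != f} (gL G)
    _ _ _ _ (id_bij _) (none_in_r_bij (gE G) e)
    (del_l_none_to_rP e f) (del_rP (gO G) f).

Definition trace_input_output (e f : gIO G) (ef : e != f) : graph X k l :=
  @rewire X k l G (inr e) (inr f)
    (gE G) (gI G) (gO G) (option {x : gIO G | (x != e) && (x != f)}) (gL G)
    _ _ _ _ (id_bij _) (id_bij _)
    (del_r_none_in_rPl (gI G) ef) (del_r_none_in_rPr (gO G) ef).

Definition trace_loop (e : gIO G) : graph X k l :=
  @rewire X k l G (inr e) (inr e)
    (gE G) (gI G) (gO G) {x : gIO G | x != e} (option (gL G))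
    _ _ _ _ (id_bij _) (id_bij _) (del_rP (gI G) e) (del_rP (gO G) e).

Definition trace_edges (e : gI G + gIO G) (f : gO G + gIO G) : graph X k l :=
  match e, f with
  | inl e, inl f => trace_internal e f
  | inr e, inl f => trace_output e f
  | inl e, inr f => trace_input e f
  | inr e, inr f =>
      match eq_comparable e f with
      | left _ => trace_loop e
      | right ef => trace_input_output (introN eqP ef)
      end
  end.

End Trace.

Lemma label_ex (A : finType) n (f : A -> 'I_n) (i : 'I_n) :
  bijective f -> exists x, f x == i.
Proof. by move=> [g _ gK]; exists (g i); rewrite gK. Qed.

Definition input_edge X k l (G : graph X k l) (i : 'I_k) : gI G + gIO G :=
  xchoose (label_ex i (galpha_bij G)).

Definition output_edge X k l (G : graph X k l) (j : 'I_l) : gO G + gIO G :=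
  xchoose (label_ex j (gbeta_bij G)).

Lemma input_edgeK X k l (G : graph X k l) i : galpha (input_edge G i) = i.
Proof. exact/eqP/(xchooseP (label_ex i (galpha_bij G))). Qed.

Lemma output_edgeK X k l (G : graph X k l) j : gbeta (output_edge G j) = j.
Proof. exact/eqP/(xchooseP (label_ex j (gbeta_bij G))). Qed.

Definition graph_ptr X k l (i : 'I_k.+1) (j : 'I_l.+1)
    (G : graph X k.+1 l.+1) : graph X k l :=
  trace_edges (input_edge G i) (output_edge G j).

(** ** The operations are compatible with isomorphisms *)

Lemma isomorphic_lact X k l (s : 'S_l) (G H : graph X k l) :
  isomorphic G H -> isomorphic (graph_lact s G) (graph_lact s H).
Proof.
case=> -[fV fE fI fO fIO fL bV bE bI bO bIO bL eS eT eA eB eD].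
split; apply: (@Giso _ _ _ (graph_lact s G) (graph_lact s H)
  fV fE fI fO fIO fL) => //.
by move=> e; congr (s _); apply: eB.
Qed.

Lemma isomorphic_ract X k l (t : 'S_k) (G H : graph X k l) :
  isomorphic G H -> isomorphic (graph_ract G t) (graph_ract H t).
Proof.
case=> -[fV fE fI fO fIO fL bV bE bI bO bIO bL eS eT eA eB eD].
split; apply: (@Giso _ _ _ (graph_ract G t) (graph_ract H t)
  fV fE fI fO fIO fL) => //.
by move=> e; congr (t^-1%g _); apply: eA.
Qed.

Lemma sum_map_bij (A B C D : Type) (f : A -> C) (g : B -> D) :
  bijective f -> bijective g -> bijective (sum_map f g).
Proof.
by move=> [f' fK f'K] [g' gK g'K]; exists (sum_map f' g'); apply: sum_mapK.
Qed.

Lemma isomorphic_hcat X k l k' l' (G H : graph X k l) (G' H' : graph X k' l') :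
  isomorphic G H -> isomorphic G' H' ->
  isomorphic (graph_hcat G G') (graph_hcat H H').
Proof.
case=> -[fV fE fI fO fIO fL bV bE bI bO bIO bL eS eT eA eB eD].
case=> -[gV gE gI gO gIO gL cV cE cI cO cIO cL hS hT hA hB hD].
split; apply: (@Giso _ _ _ (graph_hcat G G') (graph_hcat H H')
  (sum_map fV gV) (sum_map fE gE) (sum_map fI gI) (sum_map fO gO)
  (sum_map fIO gIO) (sum_map fL gL)); try exact: sum_map_bij.
- move=> [[e|e]|[e|e]] /=.
  + by have [/= t p] := eS (inl e); split; [rewrite t|rewrite p].
  + by have [/= t p] := hS (inl e); split; [rewrite t|rewrite p].
  + by have [/= t p] := eS (inr e); split; [rewrite t|rewrite p].
  + by have [/= t p] := hS (inr e); split; [rewrite t|rewrite p].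
- move=> [[e|e]|[e|e]] /=.
  + by have [/= t p] := eT (inl e); split; [rewrite t|rewrite p].
  + by have [/= t p] := hT (inl e); split; [rewrite t|rewrite p].
  + by have [/= t p] := eT (inr e); split; [rewrite t|rewrite p].
  + by have [/= t p] := hT (inr e); split; [rewrite t|rewrite p].
- by move=> [[e|e]|[e|e]] /=; rewrite /sum_labels /= -?(eA, hA).
- by move=> [[e|e]|[e|e]] /=; rewrite /sum_labels /= -?(eB, hB).
- by move=> [v|v] /=; [exact: eD|exact: hD].
Qed.

Lemma isomorphic_rewire X k l (G H : graph X k.+1 l.+1) (f : giso G H)
    e e' (E1 I1 O1 IO1 L1 E2 I2 O2 IO2 L2 : finType)
    hs1 ht1 hi1 ho1 bs1 bt1 iP1 oP1 hs2 ht2 hi2 ho2 bs2 bt2 iP2 oP2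
    (gE : E1 -> E2) (gI : I1 -> I2) (gO : O1 -> O2) (gIO : IO1 -> IO2)
    (gL : L1 -> L2) :
  bijective gE -> bijective gI -> bijective gO -> bijective gIO ->
  bijective gL ->
  (forall x, hs2 (sum_map gE gO x) = sum_map (isoE f) (isoO f) (hs1 x)) ->
  (forall x, ht2 (sum_map gE gI x) = sum_map (isoE f) (isoI f) (ht1 x)) ->
  (forall x, hi2 (sum_map gI gIO x) = sum_map (isoI f) (isoIO f) (hi1 x)) ->
  (forall x, ho2 (sum_map gO gIO x) = sum_map (isoO f) (isoIO f) (ho1 x)) ->
  isomorphic
    (@rewire X k l G e e' E1 I1 O1 IO1 L1 hs1 ht1 hi1 ho1 bs1 bt1 iP1 oP1)
    (@rewire X k l H (sum_map (isoI f) (isoIO f) e)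
       (sum_map (isoO f) (isoIO f) e') E2 I2 O2 IO2 L2
       hs2 ht2 hi2 ho2 bs2 bt2 iP2 oP2).
Proof.
move=> bE bI bO bIO bL eqs eqt eqi eqo; split.
apply: (@Giso _ _ _ (@rewire _ _ _ _ _ _ _ _ _ _ L1 _ _ _ _ _ _ _ _)
  (@rewire _ _ _ _ _ _ _ _ _ _ L2 _ _ _ _ _ _ _ _)
  (isoV f) gE gI gO gIO gL) => //; first exact: (isoV_bij f).
- by move=> x /=; rewrite eqs; apply: (iso_src f).
- by move=> x /=; rewrite eqt; apply: (iso_tgt f).
- move=> x /=; apply: (@lift_inj _ (galpha e)).
  by rewrite /relabel -{1}(iso_alpha f e) !lift_lower eqi iso_alpha.
- move=> x /=; apply: (@lift_inj _ (gbeta e')).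
  by rewrite /relabel -{1}(iso_beta f e') !lift_lower eqo iso_beta.
- exact: (iso_dec f).
Qed.

Definition sub_map (A B : Type) (p : pred A) (q : pred B) (f : A -> B)
    (pq : forall x, p x -> q (f x)) (x : {x : A | p x}) : {x : B | q x} :=
  exist _ (f (sval x)) (pq _ (svalP x)).

Lemma sub_map_bij (A B : eqType) (p : pred A) (q : pred B) (f : A -> B)
    (pq : forall x, p x -> q (f x)) :
  bijective f -> (forall x, q (f x) -> p x) -> bijective (sub_map pq).
Proof.
move=> [g fK gK] qp.
have qp' y : q y -> p (g y) by move=> qy; apply: qp; rewrite gK.
by exists (sub_map qp') => -[x px]; apply: val_inj; rewrite /= ?fK ?gK.
Qed.

Lemma omap_bij (A B : Type) (f : A -> B) : bijective f -> bijective (omap f).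
Proof.
by move=> [g fK gK]; exists (omap g) => [] [x|] //=; rewrite ?fK ?gK.
Qed.

Lemma isomorphic_trace X k l (G H : graph X k.+1 l.+1) (f : giso G H) e e' :
  isomorphic (trace_edges e e')
    (trace_edges (sum_map (isoI f) (isoIO f) e)
       (sum_map (isoO f) (isoIO f) e')).
Proof.
have neq (A B : eqType) (g : A -> B) (b : bijective g) (x y : A) :
  (g y != g x) = (y != x) by rewrite (inj_eq (bij_inj b)).
have sub1 (A B : eqType) (g : A -> B) (b : bijective g) (x y : A) :
  y != x -> g y != g x by rewrite (neq _ _ _ b).
have sub1' (A B : eqType) (g : A -> B) (b : bijective g) (x y : A) :
  g y != g x -> y != x by rewrite (neq _ _ _ b).
have bs (A B : eqType) (g : A -> B) (b : bijective g) (x : A) :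
  bijective (@sub_map A B (fun y => y != x) (fun z => z != g x) g
    (sub1 A B g b x)).
  by apply: (@sub_map_bij A B (fun y => y != x) (fun z => z != g x) g
    (sub1 A B g b x) b) => y; apply: (sub1' _ _ _ b).
have [bE bI bO bIO bL] := And5 (isoE_bij f) (isoI_bij f) (isoO_bij f)
  (isoIO_bij f) (isoL_bij f).
case: e e' => [e|e] [e'|e'] /=.
- apply: (@isomorphic_rewire _ _ _ _ _ f (inl e) (inl e')).
  + exact: omap_bij bE.
  + exact: (bs _ _ _ bI e).
  + exact: (bs _ _ _ bO e').
  + exact: bIO.
  + exact: bL.
  + by move=> [[x|]|x].
  + by move=> [[x|]|x].
  + by move=> [x|x].
  + by move=> [x|x].
- apply: (@isomorphic_rewire _ _ _ _ _ f (inl e) (inr e')).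
  + exact: bE.
  + exact: omap_bij (bs _ _ _ bI e).
  + exact: bO.
  + exact: (bs _ _ _ bIO e').
  + exact: bL.
  + by move=> [x|x].
  + by move=> [x|[x|]].
  + by move=> [[x|]|x].
  + by move=> [x|x].
- apply: (@isomorphic_rewire _ _ _ _ _ f (inr e) (inl e')).
  + exact: bE.
  + exact: bI.
  + exact: omap_bij (bs _ _ _ bO e').
  + exact: (bs _ _ _ bIO e).
  + exact: bL.
  + by move=> [x|[x|]].
  + by move=> [x|x].
  + by move=> [x|x].
  + by move=> [[x|]|x].
- case: eq_comparable => [ee'|ee']; case: eq_comparable => [fee'|fee'].
  + subst e'; apply: (@isomorphic_rewire _ _ _ _ _ f (inr e) (inr e)).
    * exact: bE.
    * exact: bI.
    * exact: bO.
    * exact: (bs _ _ _ bIO e).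
    * exact: omap_bij bL.
    * by move=> [x|x].
    * by move=> [x|x].
    * by move=> [x|x].
    * by move=> [x|x].
  + by case: fee'; rewrite ee'.
  + by case: ee'; apply: (bij_inj bIO).
  + have p2 x : (x != e) && (x != e') ->
      (isoIO f x != isoIO f e) && (isoIO f x != isoIO f e').
      by rewrite !(neq _ _ _ bIO).
    apply: (@isomorphic_rewire _ _ _ _ _ f (inr e) (inr e')).
    * exact: bE.
    * exact: bI.
    * exact: bO.
    * apply: (omap_bij (f := @sub_map _ _ (fun x => (x != e) && (x != e'))
        (fun x => (x != isoIO f e) && (x != isoIO f e')) (isoIO f) p2)).
      apply: (@sub_map_bij _ _ (fun x => (x != e) && (x != e'))
        (fun x => (x != isoIO f e) && (x != isoIO f e')) _ p2 bIO) => x.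
      by rewrite !(neq _ _ _ bIO).
    * exact: bL.
    * by move=> [x|x].
    * by move=> [x|x].
    * by move=> [x|[x|]].
    * by move=> [x|[x|]].
Qed.

Lemma isomorphic_ptr X k l i j (G H : graph X k.+1 l.+1) :
  isomorphic G H -> isomorphic (graph_ptr i j G) (graph_ptr i j H).
Proof.
move=> [f]; rewrite /graph_ptr.
have -> : input_edge H i = sum_map (isoI f) (isoIO f) (input_edge G i).
  apply: (bij_inj (galpha_bij H)); by rewrite iso_alpha !input_edgeK.
have -> : output_edge H j = sum_map (isoO f) (isoIO f) (output_edge G j).
  apply: (bij_inj (gbeta_bij H)); by rewrite iso_beta !output_edgeK.
exact: isomorphic_trace.
Qed.

(** ** The empty graph, the edge and the corollas *)

Lemma no_elt_bij (A B : Type) (f : A -> B) :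
  (A -> False) -> (B -> False) -> bijective f.
Proof.
by move=> noA noB; apply: inj_surj_bij => [a|b]; [case: (noA a)|case: (noB b)].
Qed.

Lemma void2 : void + void -> False. Proof. by case=> -[]. Qed.

Lemma no_end (V : Type) (n : V -> nat) :
  (V -> False) -> {v : V & 'I_(n v)} -> False.
Proof. by move=> noV [v _]. Qed.

Definition from_void2 (T : Type) (x : void + void) : T :=
  match x with inl x => of_void T x | inr x => of_void T x end.

Definition no_arity (v : void) : nat := of_void nat v.

Lemma void_ends_bij (f : void + void -> {v : void & 'I_(no_arity v)}) :
  bijective f.
Proof. exact: no_elt_bij void2 (@no_end void no_arity (of_void False)). Qed.

Lemma void_labels_bij (f : void + void -> 'I_0) : bijective f.
Proof. by apply: no_elt_bij => [|[]]; first exact: void2. Qed.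

Definition graph_one X : graph X 0 0 :=
  @Graph X 0 0 void void void void void void no_arity no_arity
    (@from_void2 _) (@from_void2 _) (@from_void2 _) (@from_void2 _)
    (fun v => of_void _ v) (void_ends_bij _) (void_ends_bij _)
    (void_labels_bij _) (void_labels_bij _).

Lemma edge_labels_bij : bijective (fun _ : void + unit => @ord0 0).
Proof.
exists (fun _ => inr tt) => [[[]|[]] //|i].
by rewrite ord1.
Qed.

(* No vertex, and a single edge, which is an input-output edge. *)
Definition graph_edge X : graph X 1 1 :=
  @Graph X 1 1 void void void void unit void no_arity no_arity
    (@from_void2 _) (@from_void2 _) (fun _ => ord0) (fun _ => ord0)
    (fun v => of_void _ v) (void_ends_bij _) (void_ends_bij _)
    edge_labels_bij edge_labels_bij.

Definition corolla_ends n (x : void + 'I_n) : {v : unit & 'I_n} :=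
  match x with inl x => of_void _ x | inr i => existT _ tt i end.

Lemma corolla_ends_bij n : bijective (@corolla_ends n).
Proof.
by exists (fun y : {v : unit & 'I_n} => inr (tagged y)) => [[[]|i]|[[] i]].
Qed.

Definition corolla_labels n (x : 'I_n + void) : 'I_n :=
  match x with inl i => i | inr x => of_void _ x end.

Lemma corolla_labels_bij n : bijective (@corolla_labels n).
Proof. by exists inl => [[i|[]]|i]. Qed.

(* One vertex, decorated by x. *)
Definition graph_corolla X k l (x : X k l) : graph X k l :=
  @Graph X k l unit void 'I_k 'I_l void void (fun _ => k) (fun _ => l)
    (@corolla_ends l) (@corolla_ends k) (@corolla_labels k) (@corolla_labels l)
    (fun _ => x) (corolla_ends_bij l) (corolla_ends_bij k)
    (corolla_labels_bij k) (corolla_labels_bij l).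

(** * TRAPs of graphs *)

(* The operations on graphs, before taking isomorphism classes. *)
Definition graphData (X : nat -> nat -> Type) : trapData :=
  @TrapData (graph X) (@graph_lact X) (@graph_ract X) (graph_one X)
    (@graph_hcat X) (@graph_ptr X).

Definition CGr (X : nat -> nat -> Type) : trapData :=
  @quotTrap (graphData X) (@isomorphic X).

Definition CGr_class X k l (G : graph X k l) : CGr X k l :=
  cls (@isomorphic X k l) G.

Lemma rep_class X k l (G : graph X k l) : isomorphic (rep (CGr_class G)) G.
Proof. by apply/(cls_eq _ _ (isomorphic_equiv X k l)); rewrite repK. Qed.

(* The operations of CGr X do not depend on the representatives. *)
Lemma CGr_class_morphism X :
  @trap_morphism (graphData X) (CGr X) (@CGr_class X).
Proof.
have eqc k l (G H : graph X k l) : isomorphic G H -> CGr_class G = CGr_class H.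
  by move/(cls_eq _ _ (isomorphic_equiv X k l)).
split=> //.
- move=> k l s G; apply/eqc/isomorphic_lact/isomorphic_sym; exact: rep_class.
- move=> k l t G; apply/eqc/isomorphic_ract/isomorphic_sym; exact: rep_class.
- move=> k l k' l' G H.
  by apply/eqc/isomorphic_hcat; apply/isomorphic_sym; exact: rep_class.
- move=> k l i j G; apply/eqc/isomorphic_ptr/isomorphic_sym; exact: rep_class.
Qed.

Definition CGr_edge X : CGr X 1 1 := CGr_class (graph_edge X).

Definition CGr_corolla X k l (x : X k l) : CGr X k l :=
  CGr_class (graph_corolla x).

Definition CGr_solar X k l (c : CGr X k l) : Prop :=
  exists2 G : graph X k l, solar G & CGr_class G = c.

Lemma iso_solar X k l (G H : graph X k l) :
  isomorphic G H -> solar G -> solar H.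
Proof.
move=> [f] [hIO hL]; split.
  by rewrite -hIO (bij_eq_card (isoIO_bij f)).
by rewrite -hL (bij_eq_card (isoL_bij f)).
Qed.

Lemma solar_rep X k l (c : CGr X k l) : CGr_solar c -> solar (rep c).
Proof.
move=> [G solG <-]; apply: iso_solar solG.
by apply/isomorphic_sym; exact: rep_class.
Qed.

Lemma graph_lact_solar X k l (s : 'S_l) (G : graph X k l) :
  solar G -> solar (graph_lact s G).
Proof. by []. Qed.

Lemma graph_ract_solar X k l (t : 'S_k) (G : graph X k l) :
  solar G -> solar (graph_ract G t).
Proof. by []. Qed.

Lemma graph_one_solar X : solar (graph_one X).
Proof. by split; rewrite card_void. Qed.

Lemma graph_hcat_solar X k l k' l' (G : graph X k l) (H : graph X k' l') :
  solar G -> solar H -> solar (graph_hcat G H).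
Proof.
by move=> [hIO hL] [hIO' hL']; split; rewrite card_sum ?hIO ?hIO' ?hL ?hL'.
Qed.

Lemma graph_ptr_solar X k l i j (G : graph X k.+1 l.+1) :
  solar G -> solar (graph_ptr i j G).
Proof.
move=> [hIO hL]; rewrite /graph_ptr; move: (input_edge _ _) (output_edge _ _).
have noIO (e : gIO G) : False by have := card0_eq hIO e; rewrite inE.
by move=> [e|e] [f|f] //; case: (noIO _).
Qed.

Lemma CGr_solar_closed X : is_subtrap (@CGr_solar X).
Proof.
split.
- move=> k l s p /solar_rep/(graph_lact_solar s) solG.
  by exists (graph_lact s (rep p)).
- move=> k l t p /solar_rep/(graph_ract_solar t) solG.
  by exists (graph_ract (rep p) t).
- by exists (graph_one X); first exact: graph_one_solar.
- move=> k l k' l' p q /solar_rep solp /solar_rep solq.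
  exists (graph_hcat (rep p) (rep q)) => //; exact: graph_hcat_solar.
- move=> k l i j p /solar_rep/(graph_ptr_solar i j) solG.
  by exists (graph_ptr i j (rep p)).
Qed.

Definition solCGr (X : nat -> nat -> Type) : trapData :=
  subTrap (@CGr_solar_closed X).

Lemma corolla_solar X k l (x : X k l) : CGr_solar (CGr_corolla x).
Proof.
by exists (graph_corolla x) => //; split; rewrite card_void.
Qed.

Definition solCGr_corolla X k l (x : X k l) : solCGr X k l :=
  exist _ (CGr_corolla x) (corolla_solar x).

Fixpoint hpow0 (P : trapData) (x : P 0 0) (n : nat) : P 0 0 :=
  if n is n'.+1 then hcat x (hpow0 x n') else hone.

Fixpoint hpow1 (P : trapData) (x : P 1 1) (n : nat) : P n n :=
  if n is n'.+1 return P n n then hcat x (hpow1 x n') else hone.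

Definition CGr_loop X : CGr X 0 0 :=
  ptr ord0 ord0 (CGr_edge X : CGr X 1 1).

(* G = O^p * t.(G' * I^n).s^-1, with O = t_{1,1}(I) and n = k - k' = l - l'.
   Here s is the (k', k - k')-shuffle whose first k' values are the labels of
   the inputs of G attached to vertices. The permutation t is increasing on the
   first l' letters only: its first l' values are the labels of the outputs of G
   attached to vertices, and its last l - l' values are the output labels of the
   input-output edges of G, listed in the order of their input labels (requiring
   t to be increasing there too would exclude graphs whose input-output edges
   cross). In this form (p, k', l', G', s, t) exists and is unique for every
   G. *)
Definition decomposition X k l (G : CGr X k l) (p k' l' : nat)
    (G' : solCGr X k' l') (s : 'S_k) (t : 'S_l) : Prop :=
  [/\ shuffle k' s, incr_first l' t &
      exists n (ek : k' + n = k) (el : l' + n = l),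
        G = hcat (hpow0 (CGr_loop X) p)
              (lact t (ract
                 (acast ek el (hcat (sval G') (hpow1 (CGr_edge X) n)))
                 s^-1%g))].

(** * The quotient *)

(* phi is a TRAP morphism extending the identity of P. *)
Definition extends_id (P : trap)
    (phi : forall k l, solCGr P k l -> P k l) : Prop :=
  trap_morphism phi /\ forall k l (x : P k l), phi k l (solCGr_corolla x) = x.

(* G and G' have the same val_O, sh_in and sh_out, and their solar parts have
   the same image in P by the morphism extending the identity. *)
Definition sim (P : trap) k l (G G' : CGr P k l) : Prop :=
  exists2 Phi : forall k l, solCGr P k l -> P k l,
    unique (@extends_id P) Phi &
    exists p k' l' (H H' : solCGr P k' l') s t,
      [/\ decomposition G p H s t, decomposition G' p H' s t &
          Phi k' l' H = Phi k' l' H'].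

Definition uPGr (P : trap) : trapData := @quotTrap (CGr P) (@sim P).

Definition uPGr_proj (P : trap) k l (G : CGr P k l) : uPGr P k l := cls _ G.

(* Main.v *)
From HB Require Import structures.
From mathcomp Require Import all_boot all_fingroup.
From mathcomp Require Import boolp zify.
From Stdlib Require Import RelationClasses.
Require Import Defs.

Set Implicit Arguments.
Unset Strict Implicit.
Unset Printing Implicit Defensive.

(** Three data can be read off a graph G decorated by P: its contraction, that
    is, the element of P obtained by concatenating the decorations of all
    vertices and tracing out all internal edges, with its inputs and outputs
    labelled by the labels of G (evl); the pairs formed by the input label and
    the output label of an input-output edge (io); and the number of loops. Each
    TRAP operation on graphs acts on these data: an action or a concatenation
    relabels, and a partial trace traces or relabels the contraction according
    to which of the two traced labels lie on input-output edges
    (evl_ptr_internal and the three lemmas after it). Hence equality of the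
    three data (same) is a congruence.

    It is the relation of the theorem (simP). The input-output pairs and the
    number of loops determine the integers and the permutations of a
    decomposition and can be recovered from them, and the contraction of G is,
    up to labels, the contraction of its solar part; for a solar graph, the
    contraction is an element of P, and this defines the morphism Phi that
    extends the identity. So the relation is an equivalence, the projection is a
    morphism, and the laws of unitary TRAPs, which hold for graphs up to
    isomorphism, pass to the quotient. The classes of solar graphs form a sub-
    TRAP. Two solar graphs are equivalent if and only if Phi takes the same
    value on them, so that sending an element of P to the class of its corolla
    is a bijection of P onto this sub-TRAP, with inverse induced by Phi; as Phi
    is a morphism, this is an isomorphism.

    Three constructions carry the details.

    The laws for graphs are checked on nets (den): an edge is replaced by the
    pair of its two ends, and a graph by the resulting partial bijection between
    source ends and target ends. A partial trace then composes this relation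
    with itself along the traced labels, in the same way in all the cases of its
    definition (den_ptr), isomorphism can be tested on nets (isomorphicP), and
    the laws reduce to propositional logic and the arithmetic of labels.

    Contractions live in a type labclass of elements of P with labelled inputs
    and outputs, without arities. Concatenation makes it a commutative monoid,
    so that the product over all vertices makes sense without an order, and
    traces at distinct labels commute (qtrC), so that the internal edges can be
    traced in any order. Elements of P embed in it (emb_inj).

    Phi is unique because corollas generate the solar graphs (solar_generated):
    cutting an internal edge exhibits a graph as a partial trace, and a graph
    without internal edges is a concatenation of corollas up to renumbering. *)

(** * Permutations and deletions of labels *)

(** A permutation of the labels 0 .. n-1 extended by the identity to all natural
    numbers: labels can then be compared across graphs whose numbers of inputs
    are only propositionally equal. *)
Definition pact n (s : 'S_n) (m : nat) : nat :=
  if insub m is Some i then val (s i) else m.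

Lemma pactE n (s : 'S_n) (i : 'I_n) : pact s i = s i.
Proof. by rewrite /pact valK. Qed.

Lemma pact_out n (s : 'S_n) m : n <= m -> pact s m = m.
Proof. by rewrite /pact; case: insubP => // i; rewrite ltnNge => /negP. Qed.

Lemma pactM n (s t : 'S_n) m : pact (s * t)%g m = pact t (pact s m).
Proof.
case: (ltnP m n) => [lt|ge]; last by rewrite !pact_out.
by rewrite -[m]/(val (Ordinal lt)) !pactE permM.
Qed.

Lemma pact1 n m : pact (1%g : 'S_n) m = m.
Proof. by rewrite /pact; case: insubP => // i _ <-; rewrite perm1. Qed.

Lemma pact_lt n (s : 'S_n) m : (pact s m < n) = (m < n).
Proof.
case: (ltnP m n) => [lt|ge]; last by rewrite pact_out // ltnNge ge.
by rewrite -[m]/(val (Ordinal lt)) pactE ltn_ord.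
Qed.

Lemma pactK n (s : 'S_n) : cancel (pact s) (pact s^-1%g).
Proof. by move=> m; rewrite -pactM mulgV pact1. Qed.

Lemma pactVK n (s : 'S_n) : cancel (pact s^-1%g) (pact s).
Proof. by move=> m; rewrite -pactM mulVg pact1. Qed.

Lemma pact_tens m n (s : 'S_m) (t : 'S_n) x :
  pact (tens_perm s t) x = if x < m then pact s x else m + pact t (x - m).
Proof.
case: (ltnP x (m + n)) => [lt|ge]; last first.
  by rewrite pact_out // ifF ?pact_out; lia.
rewrite -[x]/(val (Ordinal lt)) pactE permE /tens_perm_fun /=.
case: splitP => [i|i] /= ->; first by rewrite pactE ltn_ord.
by rewrite ltnNge leq_addr addKn /= pactE.
Qed.

Lemma pact_block m n x :
  pact (block_perm m n) x =
  if x < m then n + x else if x < m + n then x - m else x.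
Proof.
case: (ltnP x (m + n)) => [lt|ge]; last first.
  by rewrite pact_out // ifF; lia.
rewrite -[x]/(val (Ordinal lt)) pactE permE /block_perm_fun /=.
case: splitP => [i|i] /= ->; first by rewrite ltn_ord.
by rewrite ltnNge leq_addr addKn /=.
Qed.

Lemma pact_icycle n (a b : 'I_n.+1) x : a <= b ->
  pact (icycle a b) x =
  if a <= x < b then x.+1 else if x == b then val a else x.
Proof.
move=> ab; case: (ltnP x n.+1) => [lt|ge].
  by rewrite -[x]/(val (Ordinal lt)) pactE icycleE.
have lt_bx := leq_trans (ltn_ord b) ge.
by rewrite pact_out // gtn_eqF // [x < b]ltnNge (ltnW lt_bx) andbF.
Qed.

(** The defining property of perm_del, read on the labels that survive. *)
Lemma pact_del n (s : 'S_n.+1) (q : 'I_n.+1) x :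
  bump q (pact (perm_del s q) x) = pact s (bump (s^-1%g q) x).
Proof.
case: (ltnP x n) => [lt|ge].
  rewrite -[x]/(val (Ordinal lt)) pactE permE.
  rewrite -[bump (s^-1%g q) _]/(val (lift (s^-1%g q) (Ordinal lt))) pactE.
  by rewrite -[RHS](congr1 val (lift_lower (perm_del_neq s q (Ordinal lt)))).
have big (i : 'I_n.+1) : bump i x = x.+1.
  by rewrite /bump (leq_trans _ ge) ?leq_ord.
by rewrite pact_out // !big pact_out.
Qed.

Lemma pact_icycleV n (a b : 'I_n.+1) x : a <= b ->
  pact (icycle a b)^-1%g x =
  if a < x <= b then x.-1 else if x == a then val b else x.
Proof.
move=> ab; apply: (can_inj (pactK (icycle a b))); rewrite pactVK pact_icycle //.
case: (ltngtP x a) => [lt|gt|->] /=.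
- by rewrite (leqNgt a) lt /= ltn_eqF // (leq_trans lt ab).
- case: (leqP x b) => [le|gt'].
    by rewrite ifT; lia.
  by rewrite ltnNge (ltnW gt') andbF /= gtn_eqF.
- by rewrite ltnn andbF eqxx.
Qed.

(** Deleting label b, then label c, amounts to deleting the same two labels in
    the opposite order; this is the arithmetic behind the commutation of partial
    traces. *)
Lemma bump_swap a b (c := a - (b < a)) :
  bump (bump a b) c = a /\
  forall m, bump (bump a b) (bump c m) = bump a (bump b m).
Proof. by rewrite {}/c /bump; case: (ltnP b a) => ?; split=> [|m] /=; lia. Qed.

Lemma inord_swap n (i : 'I_n.+2) (i' : 'I_n.+1) :
  (inord (i - (i' < i)) : 'I_n.+1) = i - (i' < i) :> nat.
Proof.
have lti := ltn_ord i; have lti' := ltn_ord i'.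
by rewrite inordK //; case: (ltnP i' i) => ? /=; lia.
Qed.

Lemma lift_swap n (i : 'I_n.+2) (i' : 'I_n.+1)
    (i'' := inord (i - (i' < i)) : 'I_n.+1) :
  lift (lift i i') i'' = i /\
  forall x, lift (lift i i') (lift i'' x) = lift i (lift i' x).
Proof.
have [e1 e2] := bump_swap i i'.
by split=> [|x]; apply: val_inj; rewrite /= inord_swap ?e1 ?e2.
Qed.

(** * Nets: graphs seen as partial bijections between half-edges *)

(** The ends of edges: the n-th incoming (or outgoing) edge at a vertex v, or an
    external label. *)
Definition hend (V : Type) : Type := ((V * nat) + nat)%type.

Definition hmap (V W : Type) (f : V -> W) (g : nat -> nat) (x : hend V) :
    hend W :=
  match x with inl vn => inl (f vn.1, vn.2) | inr m => inr (g m) end.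

(** A graph without its edges. Each edge is only remembered as the pair, in the
    relation nflow, of its source end and its target end; loops have no ends and
    are counted. Nothing depends on the numbers of inputs and outputs, so that
    casts disappear (den_acast), and tracing becomes an operation on relations
    (den_ptr). *)
Record net (X : nat -> nat -> Type) := Net {
  nV : finType;
  nin : nV -> nat;
  nout : nV -> nat;
  ndec : forall v, X (nin v) (nout v);
  nflow : hend nV -> hend nV -> Prop;
  nloops : nat
}.
Arguments nflow {X n} _ _.
Arguments ndec {X n} _.

Definition net_iso X (N M : net X) : Prop :=
  exists f : nV N -> nV M, [/\ bijective f, nloops N = nloops M,
    forall x y, nflow x y <-> nflow (hmap f id x) (hmap f id y) &
    forall v, exists (ei : nin v = nin (f v)) (eo : nout v = nout (f v)),
      acast ei eo (ndec v) = ndec (f v)].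

Definition flat (V : Type) (n : V -> nat) (x : {v : V & 'I_(n v)}) : V * nat :=
  (tag x, val (tagged x)).

Lemma flat_inj V n : injective (@flat V n).
Proof.
move=> [v i] [w j] [] /= vw; subst w => ij.
by congr (existT _ _ _); apply: val_inj.
Qed.

Section Flow.
Variables (X : nat -> nat -> Type) (k l : nat).
Implicit Types G : graph X k l.

Definition gedge G : Type := ((gE G + gO G) + (gI G + gIO G))%type.

Definition esrc G (e : gedge G) : hend (gV G) :=
  match e with
  | inl x => inl (flat (gsrc x))
  | inr x => inr (val (galpha x))
  end.

Definition etgt G (e : gedge G) : hend (gV G) :=
  match e with
  | inl (inl x) => inl (flat (gtgt (inl x)))
  | inl (inr x) => inr (val (gbeta (inl x)))
  | inr (inl x) => inl (flat (gtgt (inr x)))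
  | inr (inr x) => inr (val (gbeta (inr x)))
  end.

Definition flow G (x y : hend (gV G)) : Prop :=
  exists2 e : gedge G, esrc e = x & etgt e = y.

Definition den G : net X := Net (@gdec _ _ _ G) (@flow G) #|gL G|.

(** By the next two lemmas the flow is a partial bijection: an edge is
    determined by either of its ends. *)
Lemma esrc_inj G : injective (@esrc G).
Proof.
move=> [x|x] [y|y] //= [].
  by move=> e1 e2; congr inl; apply/(bij_inj
    (gsrc_bij G))/flat_inj/pair_equal_spec.
by move=> /val_inj/(bij_inj (galpha_bij G))->.
Qed.

Lemma etgt_inj G : injective (@etgt G).
Proof.
have inj_b := bij_inj (gbeta_bij G); have inj_t := bij_inj (gtgt_bij G).
move=> [[x|x]|[x|x]] [[y|y]|[y|y]] //= []; try by move=> /val_inj/inj_b // [->].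
all: move=> e1 e2.
all: by have /flat_inj/inj_t // [->] :=
  (pair_equal_spec _ _ _ _).2 (conj e1 e2).
Qed.

Lemma flow_fun G x y y' : @flow G x y -> flow x y' -> y = y'.
Proof. by move=> [e <- <-] [e' /esrc_inj-> <-]. Qed.

Lemma flow_inj G x x' y : @flow G x y -> flow x' y -> x = x'.
Proof. by move=> [e <- <-] [e' <- /etgt_inj->]. Qed.

Lemma flow_ltl G m y : @flow G (inr m) y -> m < k.
Proof. by move=> [[x|x] //= [<-] _]. Qed.

Lemma flow_ltr G x m : @flow G x (inr m) -> m < l.
Proof. by move=> [[[e|e]|[e|e]] //= _ [<-]]. Qed.

End Flow.
Arguments flow {X k l} G x y.
Arguments gedge {X k l} G.

Lemma den_acast X k k' l l' (ek : k = k') (el : l = l') (G : graph X k l) :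
  den (acast ek el G) = den G.
Proof. by case: _ / ek; case: _ / el. Qed.

(** Used to match the edges of two graphs along their ends. *)
Lemma matching (A B S : Type) (u : A -> S) (v : B -> S) :
  injective u -> injective v ->
  (forall s, (exists a, u a = s) <-> (exists b, v b = s)) ->
  exists2 h : A -> B, bijective h & forall a, v (h a) = u a.
Proof.
move=> inj_u inj_v uv.
have hP a : exists b, v b = u a by apply/uv; exists a.
exists (fun a => sval (cid (hP a))); last by move=> a; case: cid.
apply: inj_surj_bij => [a a'|b].
  case: cid => b /= eb; case: cid => b' /= eb' bb'.
  by apply: inj_u; rewrite -eb -eb' bb'.
have /uv[a ua] : exists b', v b' = v b by exists b.
by exists a; case: cid => b' /=; rewrite ua => /inj_v.
Qed.

Lemma eq_card_bij (A B : finType) :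
  #|A| = #|B| -> exists h : A -> B, bijective h.
Proof.
move=> eAB; exists (fun x => enum_val (cast_ord eAB (enum_rank x))).
exists (fun y => enum_val (cast_ord (esym eAB) (enum_rank y))) => x.
  by rewrite enum_valK cast_ordK enum_rankK.
by rewrite enum_valK cast_ordKV enum_rankK.
Qed.

Lemma hmap_inj V W (f : V -> W) g :
  injective f -> injective g -> injective (hmap f g).
Proof.
by move=> fI gI [[v n]|m] [[w p]|q] //= [] => [/fI-> ->|/gI->].
Qed.

Lemma is_inl_hmap V W (f : V -> W) g x : is_inl (hmap f g x) = is_inl x.
Proof. by case: x. Qed.

Lemma gedge_shape X k l (G : graph X k l) (e : gedge G)
    (p := (is_inl (esrc e), is_inl (etgt e))) :
  [/\ (exists a, (inl \o inl) a = e) <-> p = (true, true),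
      (exists a, (inl \o inr) a = e) <-> p = (true, false),
      (exists a, (inr \o inl) a = e) <-> p = (false, true) &
      (exists a, (inr \o inr) a = e) <-> p = (false, false)].
Proof.
by rewrite /p; case: e {p} => [[e|e]|[e|e]] /=; do 2?split=> //;
  try (by case=> a); try (by exists e); split=> // -[].
Qed.

(** Nets determine graphs up to isomorphism: the kind of an edge (internal,
    input, output or input-output) is read off its ends, and edges of the same
    kind are matched along their ends. *)
Lemma isomorphicP X k l (G H : graph X k l) :
  net_iso (den G) (den H) -> isomorphic G H.
Proof.
move=> [f [bf eL fl dec]]; rewrite /= in f bf eL fl dec.
have inj_f := hmap_inj (bij_inj bf) (@inj_id nat).
(* One kind of edges at a time, given by the shape p of the two ends. *)
have main (A B : Type) (iA : A -> gedge G) (iB : B -> gedge H)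
    (p : bool * bool) :
    injective iA -> injective iB ->
    (forall e, (exists a, iA a = e) <->
       (is_inl (esrc e), is_inl (etgt e)) = p) ->
    (forall e, (exists b, iB b = e) <->
       (is_inl (esrc e), is_inl (etgt e)) = p) ->
    exists2 h : A -> B, bijective h &
      forall a, esrc (iB (h a)) = hmap f id (esrc (iA a)) /\
                etgt (iB (h a)) = hmap f id (etgt (iA a)).
  move=> injA injB spA spB.
  have [|||h bh hP] := @matching A B _
    (fun a => (hmap f id (esrc (iA a)), hmap f id (etgt (iA a))))
    (fun b => (esrc (iB b), etgt (iB b))).
  - by move=> a a' [/inj_f/esrc_inj/injA].
  - by move=> b b' [/esrc_inj/injB].
  - move=> [x y]; split=> [[a [<- <-]]|[b [<- <-]]].
      have /fl[e se te] : flow G (esrc (iA a)) (etgt (iA a)) by exists (iA a).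
      have /spB[b eb] : (is_inl (esrc e), is_inl (etgt e)) = p.
        have/spA <- : exists a', iA a' = iA a by exists a.
        by rewrite se te !is_inl_hmap.
      by exists b; rewrite eb se te.
    have [g fK gK] := bf.
    have hK : cancel (hmap g id) (hmap f id).
      by move=> [[v n]|m] //=; rewrite gK.
    have : flow H (esrc (iB b)) (etgt (iB b)) by exists (iB b).
    rewrite -[esrc _]hK -[etgt _]hK => /fl[e se te].
    have /spA[a ea] : (is_inl (esrc e), is_inl (etgt e)) = p.
      have/spB <- : exists b', iB b' = iB b by exists b.
      by rewrite se te !is_inl_hmap.
    by exists a; rewrite ea se te !hK.
  - by exists h => // a; have [-> ->] := hP a.
have [||e|e|fE bE hE] := @main (gE G) (gE H) (inl \o inl) (inl \o inl)
  (true, true);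
  [by move=> ? ? []|by move=> ? ? []
  |by case: (gedge_shape e)|by case: (gedge_shape e)|].
have [||e|e|fO bO hO] := @main (gO G) (gO H) (inl \o inr) (inl \o inr)
  (true, false);
  [by move=> ? ? []|by move=> ? ? []
  |by case: (gedge_shape e)|by case: (gedge_shape e)|].
have [||e|e|fI bI hI] := @main (gI G) (gI H) (inr \o inl) (inr \o inl)
  (false, true);
  [by move=> ? ? []|by move=> ? ? []
  |by case: (gedge_shape e)|by case: (gedge_shape e)|].
have [||e|e|fIO bIO hIO] := @main (gIO G) (gIO H) (inr \o inr) (inr \o inr)
  (false, false);
  [by move=> ? ? []|by move=> ? ? []
  |by case: (gedge_shape e)|by case: (gedge_shape e)|].
have [fL bL] := eq_card_bij eL.
split; exists f fE fI fO fIO fL => //.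
- by move=> [e|e]; [case: (hE e) => + _|case: (hO e) => + _]; case=> *; split.
- by move=> [e|e]; [case: (hE e) => _|case: (hI e) => _]; case=> *; split.
- by move=> [e|e]; apply: val_inj;
    [case: (hI e) => + _|case: (hIO e) => + _]; case.
- by move=> [e|e]; apply: val_inj; [case: (hO e) => _|case: (hIO e) => _]; case.
Qed.

Definition net_relabel X (u w : nat -> nat) (N : net X) : net X :=
  Net (@ndec _ N) (fun x y => nflow (hmap id u x) (hmap id w y)) (nloops N).

(** The ends of a concatenation are those of the two factors; the labels of the
    right one have been shifted by the number k of labels of the left one. *)
Definition side (V W : Type) (k : nat) (x : hend (V + W)) : hend V + hend W :=
  match x with
  | inl (inl v, n) => inl (inl (v, n))
  | inl (inr w, n) => inr (inl (w, n))
  | inr m => if m < k then inl (inr m) else inr (inr (m - k))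
  end.

Definition net_cat X (k l : nat) (N M : net X) : net X :=
  @Net X (nV N + nV M)%type
    (sum_fun (@nin _ N) (@nin _ M)) (sum_fun (@nout _ N) (@nout _ M))
    (@sum_fun (nV N) (nV M)
       (fun v => X (sum_fun (@nin _ N) (@nin _ M) v)
                   (sum_fun (@nout _ N) (@nout _ M) v))
       (@ndec _ N) (@ndec _ M))
    (fun x y => match side k x, side l y with
                | inl x, inl y => nflow x y
                | inr x, inr y => nflow x y
                | _, _ => False
                end)
    (nloops N + nloops M).

(** A path of the traced net is a path of the net, or a path that leaves through
    the output j and comes back through the input i; a loop appears when the
    input i is directly connected to the output j. *)
Definition net_trace X (i j : nat) (N : net X) : net X :=
  Net (@ndec _ N)
    (fun x y => let x := hmap id (bump i) x in let y := hmap id (bump j) y in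
       nflow x y \/ nflow x (inr j) /\ nflow (inr i) y)
    (nloops N + `[< nflow (n := N) (inr i) (inr j) >]).

Lemma net_ext X (V : finType) (i o : V -> nat) (d : forall v, X (i v) (o v))
    C C' L L' :
  (forall x y, C x y <-> C' x y) -> L = L' ->
  @Net X V i o d C L = @Net X V i o d C' L'.
Proof.
move=> CC' ->; congr (Net _ _ _).
by apply/funext => x; apply/funext => y; apply/propext.
Qed.

Lemma hmap_id V (x : hend V) : hmap id id x = x.
Proof. by case: x => [[]|]. Qed.

Lemma hmap_comp (U V W : Type) (f : V -> W) (f' : U -> V) g g' (x : hend U) :
  hmap f g (hmap f' g' x) = hmap (f \o f') (g \o g') x.
Proof. by case: x => [[]|]. Qed.

Lemma hmapK V (f : nat -> nat) g :
  cancel f g -> cancel (hmap (@id V) f) (hmap id g).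
Proof. by move=> fK [[v n]|m] //=; rewrite fK. Qed.

Lemma den_lact X k l (s : 'S_l) (G : graph X k l) :
  den (graph_lact s G) = net_relabel id (pact s^-1%g) (den G).
Proof.
have etE (e : gedge G) :
    etgt (e : gedge (graph_lact s G)) = hmap id (pact s) (etgt e).
  by case: e => [[e|e]|[e|e]] //=; rewrite -pactE.
apply: net_ext => // x y; rewrite hmap_id; split=> -[e <- ey]; exists e => //.
  by rewrite -{y}ey etE hmapK //; exact: pactK.
by rewrite etE ey hmapK //; exact: pactVK.
Qed.

Lemma den_ract X k l (t : 'S_k) (G : graph X k l) :
  den (graph_ract G t) = net_relabel (pact t) id (den G).
Proof.
have esE (e : gedge G) :
    esrc (e : gedge (graph_ract G t)) = hmap id (pact t^-1%g) (esrc e).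
  by case: e => [[e|e]|[e|e]] //=; rewrite -pactE.
have etE (e : gedge G) : etgt (e : gedge (graph_ract G t)) = etgt e.
  by case: e => [[e|e]|[e|e]].
apply: net_ext => // x y; rewrite hmap_id; split=> -[e ex ey].
  exists e; last by rewrite -etE.
  by rewrite -{x}ex esE hmapK //; exact: pactVK.
exists e; last by rewrite etE.
by rewrite esE ex hmapK //; exact: pactK.
Qed.

Lemma den_hcat X k l k' l' (G : graph X k l) (H : graph X k' l') :
  den (graph_hcat G H) = net_cat k l (den G) (den H).
Proof.
have unl (p q : nat) (i : 'I_p) : val (@unsplit p q (inl i)) = i by [].
have unr (p q : nat) (i : 'I_q) : val (@unsplit p q (inr i)) = p + i by [].
apply: net_ext => [x y|]; last by rewrite card_sum.
split=> [[e <- <-]|].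
  by move: e => [[[e|e]|[e|e]]|[[e|e]|[e|e]]];
    rewrite /= /sum_labels ?(unl, unr) ?ltn_ord //= ?ltnNge ?leq_addr ?addKn /=;
  [ exists (inl (inl e)) | exists (inl (inl e))
  | exists (inl (inr e)) | exists (inl (inr e))
  | exists (inr (inl e)) | exists (inr (inl e))
  | exists (inr (inr e)) | exists (inr (inr e)) ].
have sideL x0 z m : side m z = inl x0 -> z = hmap (@inl (gV G) (gV H)) id x0.
  case: z => [[[v|v] n]|p] //=; first by case=> <-.
  by case: ifP => // _ [<-].
have sideR x0 z m :
    side m z = inr x0 -> z = hmap (@inr (gV G) (gV H)) (addn m) x0.
  case: z => [[[v|v] n]|p] //=; first by case=> <-.
  by case: ltnP => // ? [<-] /=; rewrite subnKC.
case ex: (side k x) => [x0|x0]; case ey: (side l y) => [y0|y0] //=.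
  rewrite (sideL _ _ _ ex) (sideL _ _ _ ey) => -[e <- <-].
  case: e => [[e|e]|[e|e]].
  - by exists (inl (inl (inl e))).
  - by exists (inl (inr (inl e))).
  - by exists (inr (inl (inl e))).
  - by exists (inr (inr (inl e))).
rewrite (sideR _ _ _ ex) (sideR _ _ _ ey) => -[e <- <-].
case: e => [[e|e]|[e|e]].
- by exists (inl (inl (inr e))).
- by exists (inl (inr (inr e))).
- by exists (inr (inl (inr e))).
- by exists (inr (inr (inr e))).
Qed.

Lemma bump_relabel (A B : Type) n (f : A -> 'I_n.+1) (e : A) (h : B -> A)
    (bij_f : bijective f) (hP : onto_compl e h) b :
  bump (f e) (relabel bij_f hP b) = f (h b).
Proof. exact: (congr1 val (lift_lower (relabel_neq bij_f hP b))). Qed.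

Section Trace.
Variables (X : nat -> nat -> Type) (k l : nat) (G : graph X k.+1 l.+1).
Implicit Types (e : gI G + gIO G) (f : gO G + gIO G).

Definition in_gedge e : gedge G := inr e.

Definition out_gedge f : gedge G :=
  match f with inl f => inl (inr f) | inr f => inr (inr f) end.

Lemma etgt_out f : etgt (out_gedge f) = inr (val (gbeta f)).
Proof. by case: f. Qed.

(** The five kinds of partial traces follow a single pattern: old sends each
    edge of the traced graph H to the edge of G that it prolongs, the only new
    edge (sent to None) has the source of f and the target of e, and every edge
    of G other than e and f survives. *)
Lemma trace_flow e f (H : graph X k l) (cV : gV H -> gV G)
    (c := hmap cV) (old : gedge H -> option (gedge G)) :
  injective cV ->
  (forall d,
     c (bump (galpha e)) (esrc d) = esrc (odflt (out_gedge f) (old d)) /\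
     c (bump (gbeta f)) (etgt d) = etgt (odflt (in_gedge e) (old d))) ->
  (forall o, o <> in_gedge e -> o <> out_gedge f -> exists d, old d = Some o) ->
  (in_gedge e <> out_gedge f -> exists d, old d = None) ->
  forall x y, flow H x y <->
    let x := c (bump (galpha e)) x in let y := c (bump (gbeta f)) y in
    flow G x y \/
    flow G x (inr (val (gbeta f))) /\ flow G (inr (val (galpha e))) y.
Proof.
move=> inj_cV oldP oldS oldN x y; rewrite /=.
have inj_c m : injective (c (bump m)).
  by apply: hmap_inj => //; exact: can_inj (bumpK m).
have neq (z : hend (gV H)) m : c (bump m) z <> inr m.
  by case: z => // p [] /eqP; rewrite eq_sym (negbTE (neq_bump m p)).
have eE : esrc (in_gedge e) = inr (val (galpha e)) by [].
have fE := etgt_out f.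
split=> [[d <- <-]|].
  have [-> ->] := oldP d; case: (old d) => [o|] /=; first by left; exists o.
  by right; split; [exists (out_gedge f)|exists (in_gedge e)].
case=> [[o ox oy]|[[o ox oy] [o' ox' oy']]].
  have [||d od] := oldS o.
  - by move=> oe; move: ox; rewrite oe eE => /esym/neq.
  - by move=> of_; move: oy; rewrite of_ fE => /esym/neq.
  - have [sd td] := oldP d; rewrite od in sd td.
    exists d; [exact: inj_c (etrans sd ox)|exact: inj_c (etrans td oy)].
move: oy ox'; rewrite -fE -eE => /etgt_inj oy /esrc_inj ox'; subst o o'.
have [|d od] := oldN.
  by move=> ef; move: ox; rewrite -ef eE => /esym/neq.
have [sd td] := oldP d; rewrite od in sd td.
exists d; [exact: inj_c (etrans sd ox)|exact: inj_c (etrans td oy')].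
Qed.

Lemma flow_label e f :
  flow G (inr (val (galpha e))) (inr (val (gbeta f))) <->
  in_gedge e = out_gedge f.
Proof.
have fE := etgt_out f.
split; last by exists (in_gedge e) => //; rewrite H.
move=> [o]; rewrite -fE -[inr _]/(esrc (in_gedge e)).
by move=> /esrc_inj<- /etgt_inj.
Qed.

Definition old_internal (e : gI G) (f : gO G)
    (d : gedge (trace_internal e f)) : option (gedge G) :=
  match d with
  | inl (inl None) => None
  | inl (inl (Some x)) => Some (inl (inl x))
  | inl (inr x) => Some (inl (inr (val x)))
  | inr (inl x) => Some (inr (inl (val x)))
  | inr (inr x) => Some (inr (inr x))
  end.

Definition old_output (e : gIO G) (f : gO G)
    (d : gedge (trace_output e f)) : option (gedge G) :=
  match d with
  | inl (inr None) => None
  | inl (inl x) => Some (inl (inl x))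
  | inl (inr (Some x)) => Some (inl (inr (val x)))
  | inr (inl x) => Some (inr (inl x))
  | inr (inr x) => Some (inr (inr (val x)))
  end.

Definition old_input (e : gI G) (f : gIO G)
    (d : gedge (trace_input e f)) : option (gedge G) :=
  match d with
  | inr (inl None) => None
  | inl (inl x) => Some (inl (inl x))
  | inl (inr x) => Some (inl (inr x))
  | inr (inl (Some x)) => Some (inr (inl (val x)))
  | inr (inr x) => Some (inr (inr (val x)))
  end.

Definition old_input_output (e f : gIO G) (ef : e != f)
    (d : gedge (trace_input_output ef)) : option (gedge G) :=
  match d with
  | inr (inr None) => None
  | inl (inl x) => Some (inl (inl x))
  | inl (inr x) => Some (inl (inr x))
  | inr (inl x) => Some (inr (inl x))
  | inr (inr (Some x)) => Some (inr (inr (val x)))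
  end.

Definition old_loop (e : gIO G)
    (d : gedge (trace_loop e)) : option (gedge G) :=
  match d with
  | inl (inl x) => Some (inl (inl x))
  | inl (inr x) => Some (inl (inr x))
  | inr (inl x) => Some (inr (inl x))
  | inr (inr x) => Some (inr (inr (val x)))
  end.

(** The cases in the definition of the trace disappear on nets: a new edge of
    any kind is a path through e and f. *)
Lemma den_trace_edges e f :
  den (trace_edges e f) = net_trace (galpha e) (gbeta f) (den G).
Proof.
have noloop : in_gedge e <> out_gedge f ->
    `[< flow G (inr (val (galpha e))) (inr (val (gbeta f))) >] = 0 :> nat.
  by move=> ef; rewrite asboolF // flow_label.
case: e f noloop => [e|e] [f|f] noloop; rewrite /trace_edges.
- apply: net_ext; last by rewrite noloop ?addn0.
  apply: (@trace_flow (inl e) (inl f) (trace_internal e f) id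
    (@old_internal e f)) => //.
  + move=> [[[d|]|d]|[d|d]]; split; try exact: erefl.
    * exact: (congr1 inr (bump_relabel (gbeta_bij G) (del_lP _ f) (inl d))).
    * exact: (congr1 inr (bump_relabel (galpha_bij G) (del_lP _ e) (inl d))).
    * exact: (congr1 inr (bump_relabel (galpha_bij G) (del_lP _ e) (inr d))).
    * exact: (congr1 inr (bump_relabel (gbeta_bij G) (del_lP _ f) (inr d))).
  + move=> [[o|o]|[o|o]] oe of_ /=.
    * by exists (inl (inl (Some o))).
    * have h : o != f by apply/eqP => h; case: of_; rewrite h.
      by exists (inl (inr (exist _ o h))).
    * have h : o != e by apply/eqP => h; case: oe; rewrite h.
      by exists (inr (inl (exist _ o h))).
    * by exists (inr (inr o)).
  + by exists (inl (inl None)).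
- apply: net_ext; last by rewrite noloop ?addn0.
  apply: (@trace_flow (inl e) (inr f) (trace_input e f) id
    (@old_input e f)) => //.
  + move=> [[d|d]|[[d|]|d]]; split; try exact: erefl.
    * exact: (congr1 inr (bump_relabel (gbeta_bij G) (del_rP _ f) (inl d))).
    * exact: (congr1 inr (bump_relabel (galpha_bij G) (del_l_none_to_rP e f)
        (inl (Some d)))).
    * exact: (congr1 inr (bump_relabel (galpha_bij G) (del_l_none_to_rP e f)
        (inl None))).
    * exact: (congr1 inr (bump_relabel (galpha_bij G) (del_l_none_to_rP e f)
        (inr d))).
    * exact: (congr1 inr (bump_relabel (gbeta_bij G) (del_rP _ f) (inr d))).
  + move=> [[o|o]|[o|o]] oe of_ /=.
    * by exists (inl (inl o)).
    * by exists (inl (inr o)).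
    * have h : o != e by apply/eqP => h; case: oe; rewrite h.
      by exists (inr (inl (Some (exist _ o h)))).
    * have h : o != f by apply/eqP => h; case: of_; rewrite h.
      by exists (inr (inr (exist _ o h))).
  + by exists (inr (inl None)).
- apply: net_ext; last by rewrite noloop ?addn0.
  apply: (@trace_flow (inr e) (inl f) (trace_output e f) id
    (@old_output e f)) => //.
  + move=> [[d|[d|]]|[d|d]]; split; try exact: erefl.
    * exact: (congr1 inr (bump_relabel (gbeta_bij G) (del_l_none_to_rP f e)
        (inl (Some d)))).
    * exact: (congr1 inr (bump_relabel (gbeta_bij G) (del_l_none_to_rP f e)
        (inl None))).
    * exact: (congr1 inr (bump_relabel (galpha_bij G) (del_rP _ e) (inl d))).
    * exact: (congr1 inr (bump_relabel (galpha_bij G) (del_rP _ e) (inr d))).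
    * exact: (congr1 inr (bump_relabel (gbeta_bij G) (del_l_none_to_rP f e)
        (inr d))).
  + move=> [[o|o]|[o|o]] oe of_ /=.
    * by exists (inl (inl o)).
    * have h : o != f by apply/eqP => h; case: of_; rewrite h.
      by exists (inl (inr (Some (exist _ o h)))).
    * by exists (inr (inl o)).
    * have h : o != e by apply/eqP => h; case: oe; rewrite h.
      by exists (inr (inr (exist _ o h))).
  + by exists (inl (inr None)).
- case: eq_comparable => [ef|ef]; last move: (introN eqP ef) => {}ef.
  + subst f; apply: net_ext; last first.
      rewrite (_ : `[< _ >] = true); last by apply/asboolP/flow_label.
      by rewrite card_option addn1.
    apply: (@trace_flow (inr e) (inr e) (trace_loop e) id
      (@old_loop e)) => //.
    * move=> [[d|d]|[d|d]]; split; try exact: erefl.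
      - exact: (congr1 inr (bump_relabel (gbeta_bij G) (del_rP _ e) (inl d))).
      - exact: (congr1 inr (bump_relabel (galpha_bij G) (del_rP _ e) (inl d))).
      - exact: (congr1 inr (bump_relabel (galpha_bij G) (del_rP _ e) (inr d))).
      - exact: (congr1 inr (bump_relabel (gbeta_bij G) (del_rP _ e) (inr d))).
    * move=> [[o|o]|[o|o]] oe _ /=.
      - by exists (inl (inl o)).
      - by exists (inl (inr o)).
      - by exists (inr (inl o)).
      - have h : o != e by apply/eqP => h; case: oe; rewrite h.
        by exists (inr (inr (exist _ o h))).
  + apply: net_ext; last by rewrite noloop ?addn0 // => -[] /eqP; apply/negP.
    apply: (@trace_flow (inr e) (inr f) (trace_input_output ef) id
      (@old_input_output e f ef)) => //.
    * move=> [[d|d]|[d|[d|]]]; split; try exact: erefl.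
      - exact: (congr1 inr (bump_relabel (gbeta_bij G) (del_r_none_in_rPr _ ef)
          (inl d))).
      - exact: (congr1 inr (bump_relabel (galpha_bij G)
          (del_r_none_in_rPl _ ef) (inl d))).
      - exact: (congr1 inr (bump_relabel (galpha_bij G)
          (del_r_none_in_rPl _ ef) (inr (Some d)))).
      - exact: (congr1 inr (bump_relabel (gbeta_bij G) (del_r_none_in_rPr _ ef)
          (inr (Some d)))).
      - exact: (congr1 inr (bump_relabel (galpha_bij G)
          (del_r_none_in_rPl _ ef) (inr None))).
      - exact: (congr1 inr (bump_relabel (gbeta_bij G) (del_r_none_in_rPr _ ef)
          (inr None))).
    * move=> [[o|o]|[o|o]] oe of_ /=.
      - by exists (inl (inl o)).
      - by exists (inl (inr o)).
      - by exists (inr (inl o)).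
      - have h : (o != e) && (o != f).
          by apply/andP; split; apply/eqP => h; [case: oe|case: of_]; rewrite h.
        by exists (inr (inr (Some (exist _ o h)))).
    * by exists (inr (inr None)).
Qed.

End Trace.

Lemma den_ptr X k l i j (G : graph X k.+1 l.+1) :
  den (graph_ptr i j G) = net_trace i j (den G).
Proof. by rewrite den_trace_edges input_edgeK output_edgeK. Qed.

(** * The TRAP laws for graphs, up to isomorphism *)

(* The three tactics below settle equivalences between flows: both sides are
   false because a label is out of range, or both are the same flow up to
   arithmetic. *)
Ltac flow_out :=
  let h := fresh in
  split; intro h; exfalso; first
  [ exact h | move: (flow_ltl h); lia | move: (flow_ltr h); lia ].

Ltac flow_same :=
  match goal with
  | |- ?A <-> ?A => exact: iff_refl
  | |- flow ?G (inr ?a) (inr ?b) <-> flow ?G (inr ?c) (inr ?d) =>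
      replace c with a by lia; replace d with b by lia; exact: iff_refl
  | |- flow ?G ?x (inr ?b) <-> flow ?G ?x (inr ?d) =>
      replace d with b by lia; exact: iff_refl
  | |- flow ?G (inr ?a) ?y <-> flow ?G (inr ?c) ?y =>
      replace c with a by lia; exact: iff_refl
  end.

Ltac flow_cases :=
  do ?case: ltnP => ? /=; try solve [lia | flow_same | flow_out].

Definition drop_l (V : Type) (v : void + V) : V :=
  match v with inl v => of_void V v | inr v => v end.

Definition drop_r (V : Type) (v : V + void) : V :=
  match v with inl v => v | inr v => of_void V v end.

Lemma drop_l_bij V : bijective (@drop_l V).
Proof. by exists inr => [[[]|]|]. Qed.

Lemma drop_r_bij V : bijective (@drop_r V).
Proof. by exists inl => [[|[]]|]. Qed.

Section GraphLaws.
Variable X : nat -> nat -> Type.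

(** Most laws do not move the vertices and even hold as equalities of nets; the
    others rearrange, add or drop a factor of a concatenation. *)
Lemma isomorphic_den k l (G H : graph X k l) : den G = den H -> isomorphic G H.
Proof.
move=> e; apply: isomorphicP; rewrite e; exists id; split=> //.
- exact: Bijective (frefl id) (frefl id).
- by move=> x y; rewrite !hmap_id.
- by move=> v; exists erefl, erefl.
Qed.

Lemma iso_lact1 k l (G : graph X k l) : isomorphic (graph_lact 1%g G) G.
Proof.
apply: isomorphic_den; rewrite den_lact; apply: net_ext => //= x y.
rewrite hmap_id (_ : hmap id _ y = y) //.
by case: y => [[v n]|m] //=; rewrite invg1 pact1.
Qed.

Lemma iso_lactM k l (s s' : 'S_l) (G : graph X k l) :
  isomorphic (graph_lact s (graph_lact s' G)) (graph_lact (s' * s)%g G).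
Proof.
apply: isomorphic_den; rewrite !den_lact; apply: net_ext => //= x y.
rewrite !hmap_id hmap_comp (_ : hmap _ _ y = hmap id (pact (s' * s)^-1%g) y) //.
by case: y => [[v n]|m] //=; rewrite invMg pactM.
Qed.

Lemma iso_ract1 k l (G : graph X k l) : isomorphic (graph_ract G 1%g) G.
Proof.
apply: isomorphic_den; rewrite den_ract; apply: net_ext => //= x y.
rewrite hmap_id (_ : hmap id _ x = x) //.
by case: x => [[v n]|m] //=; rewrite pact1.
Qed.

Lemma iso_ractM k l (t t' : 'S_k) (G : graph X k l) :
  isomorphic (graph_ract (graph_ract G t) t') (graph_ract G (t' * t)%g).
Proof.
apply: isomorphic_den; rewrite !den_ract; apply: net_ext => //= x y.
rewrite !hmap_id hmap_comp (_ : hmap _ _ x = hmap id (pact (t' * t)%g) x) //.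
by case: x => [[v n]|m] //=; rewrite pactM.
Qed.

Lemma iso_lractA k l (s : 'S_l) (t : 'S_k) (G : graph X k l) :
  isomorphic (graph_lact s (graph_ract G t)) (graph_ract (graph_lact s G) t).
Proof.
apply: isomorphic_den; rewrite !(den_lact, den_ract).
by apply: net_ext => //= x y; rewrite !hmap_id.
Qed.

Lemma iso_hcatA k l k' l' k'' l'' (G : graph X k l) (G' : graph X k' l')
    (G'' : graph X k'' l'') :
  isomorphic (acast (addnA k k' k'') (addnA l l' l'')
    (graph_hcat G (graph_hcat G' G''))) (graph_hcat (graph_hcat G G') G'').
Proof.
apply: isomorphicP; rewrite den_acast !den_hcat.
pose f (v : gV G + (gV G' + gV G'')) : (gV G + gV G') + gV G'' :=
  match v with
  | inl v => inl (inl v)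
  | inr (inl v) => inl (inr v)
  | inr (inr v) => inr v
  end.
exists f; split; rewrite /= ?addnA //.
- exists (fun v => match v with
    | inl (inl v) => inl v
    | inl (inr v) => inr (inl v)
    | inr v => inr (inr v)
    end); first by move=> [|[]].
  by move=> [[]|].
- by move=> [[[v|[v|v]] n]|m] [[[w|[w|w]] p]|q] /=; flow_cases.
- by move=> [v|[v|v]]; exists erefl, erefl.
Qed.

Lemma iso_hcat1p k l (G : graph X k l) :
  isomorphic (graph_hcat (graph_one X) G) G.
Proof.
apply: isomorphicP; rewrite den_hcat.
exists (@drop_l _); split; rewrite /= ?card_void //; first exact: drop_l_bij.
- by move=> [[[[]|v] n]|m] [[[[]|w] p]|q] /=; rewrite ?subn0.
- by move=> [[]|v]; exists erefl, erefl.
Qed.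

Lemma iso_hcatp1 k l (G : graph X k l) :
  isomorphic (acast (addn0 k) (addn0 l) (graph_hcat G (graph_one X))) G.
Proof.
apply: isomorphicP; rewrite den_acast den_hcat.
exists (@drop_r _).
split; rewrite /= ?card_void ?addn0 //; first exact: drop_r_bij.
- move=> [[[v|[]] n]|m] [[[w|[]] p]|q] //=; do ?case: ltnP => ? //=;
    try flow_out.
- by move=> [v|[]]; exists erefl, erefl.
Qed.

Lemma side_tens (V W : Type) k k' (t : 'S_k) (t' : 'S_k') (x : hend (V + W)) :
  side k (hmap id (pact (tens_perm t t')) x) =
  sum_map (hmap id (pact t)) (hmap id (pact t')) (side k x).
Proof.
case: x => [[[v|v] n]|m] //=; rewrite pact_tens; case: (ltnP m k) => [lt|ge].
  by rewrite pact_lt lt.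
by rewrite ltnNge leq_addr addKn.
Qed.

Lemma iso_hcat_act k l k' l' (s : 'S_l) (t : 'S_k) (s' : 'S_l') (t' : 'S_k')
    (G : graph X k l) (G' : graph X k' l') :
  isomorphic
    (graph_hcat (graph_ract (graph_lact s G) t)
       (graph_ract (graph_lact s' G') t'))
    (graph_ract (graph_lact (tens_perm s s') (graph_hcat G G'))
       (tens_perm t t')).
Proof.
apply: isomorphic_den; rewrite !(den_lact, den_ract, den_hcat).
have tensV : (tens_perm s s')^-1%g = tens_perm s^-1%g s'^-1%g.
  apply/eqP; rewrite eq_invg_mul; apply/eqP/permP => i; apply: val_inj.
  rewrite perm1 /= -pactE pactM !pact_tens; case: (ltnP i l) => [lt|ge].
    by rewrite pact_lt lt pactK.
  by rewrite ltnNge leq_addr addKn /= pactK subnKC.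
apply: net_ext => //= x y; rewrite !hmap_id tensV.
rewrite !side_tens; case: (side k x) => x0; case: (side l y) => y0 //=.
  by rewrite !hmap_id.
by rewrite !hmap_id.
Qed.

Lemma iso_hcatC k l k' l' (G : graph X k l) (G' : graph X k' l') :
  isomorphic (graph_lact (block_perm l l') (graph_hcat G G'))
    (graph_ract (acast (addnC k' k) (addnC l' l) (graph_hcat G' G))
       (block_perm k k')).
Proof.
apply: isomorphicP; rewrite den_lact den_ract den_acast !den_hcat.
pose swap A B (v : A + B) := match v with inl a => inr a | inr b => inl b end.
exists (@swap _ _).
split; rewrite /= 1?addnC //.
- by exists (@swap _ _) => [] [].
- move=> x y; rewrite !hmap_id.
  have [z ->] : exists z, y = hmap id (pact (block_perm l l')) z.
    exists (hmap id (pact (block_perm l l')^-1%g) y).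
    by rewrite hmapK //; exact: pactVK.
  rewrite (hmapK (pactK _)); move: z => {}y.
  move: x y => [[[v|v] n]|m] [[[w|w] p]|q] /=; rewrite ?pact_block //;
    try case: (ltnP m k) => ?; try case: (ltnP m (k + k')) => ?;
    try case: (ltnP q l) => ?; try case: (ltnP q (l + l')) => ?; flow_cases.
- by move=> [v|v]; exists erefl, erefl.
Qed.

Lemma iso_ptrA k l (i : 'I_k.+2) (j : 'I_l.+2) (i' : 'I_k.+1) (j' : 'I_l.+1)
    (G : graph X k.+2 l.+2) :
  isomorphic (graph_ptr i' j' (graph_ptr i j G))
    (graph_ptr (inord (i - (i' < i))) (inord (j - (j' < j)))
      (graph_ptr (lift i i') (lift j j') G)).
Proof.
apply: isomorphic_den; rewrite !den_ptr.
have [ei ci] := bump_swap i i'; have [ej cj] := bump_swap j j'.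
have hswap (V : Type) a b (c := a - (b < a)) (z : hend V) :
    hmap (id \o id) (bump (bump a b) \o bump c) z =
    hmap (id \o id) (bump a \o bump b) z.
  by case: z => // m; congr inr; case: (bump_swap a b) => _ /(_ m).
apply: net_ext => [x y|] /=.
  by rewrite !hmap_comp /= !inord_swap ei ej !hswap; tauto.
(* Both sides count the loops created by the two traces: that the counts agree
   relies on the flow being a partial bijection. *)
rewrite -!addnA; congr addn.
have ne n (a : 'I_n.+2) (b : 'I_n.+1) : bump a b <> a.
  by rewrite /bump; lia.
have fun1 a b c : flow G (inr a) (inr b) -> flow G (inr a) (inr c) -> b = c.
  by move=> /flow_fun h /h [].
have inj1 a b c : flow G (inr a) (inr c) -> flow G (inr b) (inr c) -> a = b.
  by move=> /flow_inj h /h [].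
rewrite /= !inord_swap ei ej.
have := @fun1 i j (bump j j'); have := @inj1 i (bump i i') j.
have := @fun1 (bump i i') j (bump j j');
  have := @inj1 i (bump i i') (bump j j').
have := ne _ i i'; have := ne _ j j'.
move: (bump i i') (bump j j') => a b;
  move: (nat_of_ord i) (nat_of_ord j) => c d.
move=> ? ? ? ? ? ?.
case: (asboolP (flow G (inr c) (inr d))) => cd;
case: (asboolP (flow G (inr a) (inr b))) => ab;
case: asboolP => h1; case: asboolP => h2 //; exfalso; intuition congruence.
Qed.

Lemma iso_ptr_act k l (i : 'I_k.+1) (j : 'I_l.+1) (s : 'S_l.+1) (t : 'S_k.+1)
    (G : graph X k.+1 l.+1) :
  isomorphic (graph_ptr i j (graph_ract (graph_lact s G) t))
    (graph_ract (graph_lact (perm_del s j) (graph_ptr (t i) (s^-1%g j) G))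
       (perm_del t (t i))).
Proof.
apply: isomorphic_den; rewrite !(den_ptr, den_lact, den_ract).
have delV x :
    bump (s^-1%g j) (pact (perm_del s j)^-1%g x) = pact s^-1%g (bump j x).
  apply: (can_inj (pactK s)); rewrite -pact_del pactVK.
  by rewrite -[RHS]pactM mulVg pact1.
apply: net_ext => [x y|] /=; last by rewrite !pactE.
rewrite !hmap_id !pactE !hmap_comp.
rewrite (_ : hmap _ _ y =
  hmap id (bump (s^-1%g j) \o pact (perm_del s j)^-1%g) y).
  rewrite (_ : hmap _ _ x =
    hmap id (bump (t i) \o pact (perm_del t (t i))) x) //.
  by case: x => // m; congr inr; rewrite /= pact_del permK.
by case: y => // m; congr inr; rewrite /= delV.
Qed.

Lemma side_bumpl (V W : Type) k i (x : hend (V + W)) : i <= k ->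
  side k.+1 (hmap id (bump i) x) =
  sum_map (hmap id (bump i)) id (side k x).
Proof.
move=> ik; case: x => [[[v|w] n]|m] //=; rewrite /bump.
case: (ltnP m k) => [lt|ge].
  have -> : (i <= m) + m < k.+1 by case: (i <= m); rewrite ?add1n ?ltnS // ltnW.
  by [].
by rewrite (leq_trans ik ge) add1n ltnS ltnNge ge subSS.
Qed.

Lemma side_bumpr (V W : Type) k i (x : hend (V + W)) :
  side k (hmap id (bump (k + i)) x) =
  sum_map id (hmap id (bump i)) (side k x).
Proof.
case: x => [[[v|w] n]|m] //=; rewrite /bump.
case: (ltnP m k) => [lt|ge].
  by rewrite [k + i <= m]leqNgt (leq_trans lt (leq_addr _ _)) add0n lt.
by rewrite /= leq_subRL // ltnNge (leq_trans ge (leq_addl _ _)) addnBA.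
Qed.

Lemma iso_ptr_hcatl k l k' l' (G : graph X k.+1 l.+1) (H : graph X k' l')
    (i : 'I_k.+1) (j : 'I_l.+1) :
  isomorphic
    (graph_ptr (lshift k' i : 'I_(k + k').+1) (lshift l' j : 'I_(l + l').+1)
       (graph_hcat G H : graph X (k + k').+1 (l + l').+1))
    (graph_hcat (graph_ptr i j G) H).
Proof.
apply: isomorphic_den; rewrite den_hcat !den_ptr.
rewrite (_ : den _ = net_cat k.+1 l.+1 (den G) (den H)); last exact: den_hcat.
have := ltn_ord i; have := ltn_ord j => ltj lti.
apply: net_ext => [x y|] /=; last by rewrite lti ltj addnAC.
rewrite lti ltj !side_bumpl //.
by case: (side k x) => x0; case: (side l y) => y0 /=; rewrite ?hmap_id; tauto.
Qed.

Lemma iso_ptr_hcatr k l k' l' (G : graph X k l) (H : graph X k'.+1 l'.+1)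
    (i : 'I_k'.+1) (j : 'I_l'.+1) :
  isomorphic
    (graph_ptr (cast_ord (addnS k k') (rshift k i))
       (cast_ord (addnS l l') (rshift l j))
       (acast (addnS k k') (addnS l l') (graph_hcat G H)))
    (graph_hcat G (graph_ptr i j H)).
Proof.
apply: isomorphic_den; rewrite den_hcat !den_ptr den_acast den_hcat.
apply: net_ext => [x y|] /=; rewrite ![_ + _ < _]ltnNge !leq_addr !addKn /=.
  rewrite !side_bumpr.
  by case: (side k x) => x0; case: (side l y) => y0 /=; rewrite ?hmap_id; tauto.
by rewrite addnA.
Qed.

Lemma flow_edge x y : flow (graph_edge X) x y <-> x = inr 0 /\ y = inr 0.
Proof.
split=> [[[[[]|[]]|[[]|[]]] <- <-] //|[-> ->]].
by exists (inr (inr tt)).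
Qed.

Lemma hmap_map V W (f : V -> W) g (x : hend V) :
  hmap id g (hmap f id x) = hmap f g x.
Proof. by case: x. Qed.

Lemma side_unit_shift V (x : hend (void + V)) :
  side 1 (hmap id (bump 0) x) = inr (hmap (@drop_l V) id x).
Proof. by case: x => [[[[]|v] n]|m] //=; rewrite subn1. Qed.

(** For I * p traced along the input of I and an output of p: the edge of I
    prolongs the traced strand, which takes the output label 0 of I and so is
    moved along a cycle. The same holds with inputs and outputs exchanged. *)
Lemma side_unit_cycle V n (j : 'I_n.+1) (y : hend (void + V)) :
  (side 1 (hmap id (bump j.+1) y) = inl (inr 0) /\
     hmap (@drop_l V) (pact (icycle ord0 j)^-1%g) y = inr (val j)) \/
  side 1 (hmap id (bump j.+1) y) =
    inr (hmap (@drop_l V) (pact (icycle ord0 j)^-1%g) y).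
Proof.
case: y => [[[[]|v] p]|[|q]]; first by right.
  by left; rewrite /= pact_icycleV.
by right; rewrite /= pact_icycleV //= /bump addnS /= subn1 /=; case: leqP.
Qed.

Lemma iso_unit_out k l (j : 'I_l.+1) (G : graph X k.+1 l.+1) :
  isomorphic
    (graph_ptr ord0 (lift ord0 j)
      (graph_hcat (graph_edge X) G : graph X k.+2 l.+2))
    (graph_lact (icycle ord0 j) G).
Proof.
apply: isomorphicP; rewrite den_ptr den_lact.
rewrite (_ : den _ = net_cat 1 1 (den (graph_edge X)) (den G));
  last exact: den_hcat.
exists (@drop_l _); split; first exact: drop_l_bij.
- by rewrite /= card_void asboolF ?addn0.
- move=> x y; rewrite /= !hmap_map side_unit_shift.
  have [[-> ->]|->] := side_unit_cycle j y; last by rewrite /=; tauto.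
  by rewrite /= flow_edge subn1 /=; tauto.
- by move=> [[]|v]; exists erefl, erefl.
Qed.

Lemma iso_unit_in k l (i : 'I_k.+1) (G : graph X k.+1 l.+1) :
  isomorphic
    (graph_ptr (lift ord0 i) ord0
      (graph_hcat (graph_edge X) G : graph X k.+2 l.+2))
    (graph_ract G (icycle ord0 i)^-1%g).
Proof.
apply: isomorphicP; rewrite den_ptr den_ract.
rewrite (_ : den _ = net_cat 1 1 (den (graph_edge X)) (den G));
  last exact: den_hcat.
exists (@drop_l _); split; first exact: drop_l_bij.
- by rewrite /= card_void asboolF ?addn0.
- move=> x y; rewrite /= !hmap_map side_unit_shift.
  have [[-> ->]|->] := side_unit_cycle i x; last by rewrite /=; tauto.
  by rewrite /= flow_edge subn1 /=; tauto.
- by move=> [[]|v]; exists erefl, erefl.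
Qed.

Lemma side_shift_unit V k (x : hend (V + void)) :
  side k.+1 (hmap id (bump k.+1) x) = inl (hmap (@drop_r V) id x) \/
  exists m, [/\ side k.+1 (hmap id (bump k.+1) x) = inr (inr m.+1) ,
                hmap (@drop_r V) id x = inr (k.+1 + m) & k < k.+1 + m].
Proof.
case: x => [[[v|[]] n]|m]; first by left.
case: (ltnP m k.+1) => [lt|ge].
  have bumpE : bump k.+1 m = m by rewrite /bump leqNgt lt.
  by left; rewrite /= bumpE lt.
right; exists (m - k.+1); rewrite /= /bump ge; split.
- by rewrite ifF; [congr (inr (inr _)); lia|lia].
- by rewrite subnKC.
- by rewrite subnKC.
Qed.

(** The mirror image, for p * I. The last alternative covers the labels out of
    range, where there is no flow. *)
Lemma side_cycle_unit V n (j : 'I_n.+1) (y : hend (V + void)) :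
  [\/ side n.+1 (hmap id (bump j) y) = inr (inr 0) /\
       hmap (@drop_r V) (pact (icycle j ord_max)) y = inr (val j),
      side n.+1 (hmap id (bump j) y) =
        inl (hmap (@drop_r V) (pact (icycle j ord_max)) y) |
      exists m, [/\ side n.+1 (hmap id (bump j) y) = inr (inr m.+1),
                hmap (@drop_r V) (pact (icycle j ord_max)) y = inr (n.+1 + m) &
                n < n.+1 + m]].
Proof.
have ltj : j <= n by rewrite -ltnS.
case: y => [[[v|[]] p]|q] /=; first by constructor 2.
rewrite pact_icycle //= /bump; case: (ltngtP q n) => [lt|gt|->].
- constructor 2; rewrite andbT; case: (leqP j q) => _;
    rewrite ?add1n ?add0n ?ltnS ?lt //.
  by rewrite ltnW.
- constructor 3; exists (q - n.+1);
    rewrite andbF (leq_trans ltj (ltnW gt)) add1n ltnS.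
  rewrite ltnNge (ltnW gt) subSS /=; split;
    [congr (inr (inr _)); lia|congr inr; lia|lia].
- by constructor 1; rewrite andbF ltj add1n ltnn subnn.
Qed.

Lemma iso_out_unit k l (j : 'I_l.+1) (G : graph X k.+1 l.+1) :
  isomorphic
    (acast (addn1 k) (addn1 l)
      (graph_ptr ord_max (lshift 1 j : 'I_(l + 1).+1)
        (graph_hcat G (graph_edge X) : graph X (k + 1).+1 (l + 1).+1)))
    (graph_lact (icycle j ord_max)^-1%g G).
Proof.
apply: isomorphicP; rewrite den_acast den_ptr den_lact invgK.
rewrite (_ : den _ = net_cat k.+1 l.+1 (den G) (den (graph_edge X)));
  last exact: den_hcat.
exists (@drop_r _); split; first exact: drop_r_bij.
- rewrite /= card_void asboolF ?addn0 //.
  by rewrite addn1 ltnn (ltn_ord j).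
- move=> x y; rewrite /= !hmap_map addn1 ltnn (ltn_ord j) subnn.
  have [->|[m [-> -> gtm]]] := side_shift_unit k x;
  have [[-> ->]|->|[m' [-> -> gtm']]] := side_cycle_unit j y;
  rewrite /= ?flow_edge; split; try tauto; intuition; try discriminate.
  all: try match goal with
    | h : flow _ (inr _) _ |- _ => move: (flow_ltl h); lia
    | h : flow _ _ (inr _) |- _ => move: (flow_ltr h); lia
    end.
- by move=> [v|[]]; exists erefl, erefl.
Qed.

Lemma iso_in_unit k l (i : 'I_k.+1) (G : graph X k.+1 l.+1) :
  isomorphic
    (acast (addn1 k) (addn1 l)
      (graph_ptr (lshift 1 i : 'I_(k + 1).+1) ord_max
        (graph_hcat G (graph_edge X) : graph X (k + 1).+1 (l + 1).+1)))
    (graph_ract G (icycle i ord_max)).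
Proof.
apply: isomorphicP; rewrite den_acast den_ptr den_ract.
rewrite (_ : den _ = net_cat k.+1 l.+1 (den G) (den (graph_edge X)));
  last exact: den_hcat.
exists (@drop_r _); split; first exact: drop_r_bij.
- rewrite /= card_void asboolF ?addn0 //.
  by rewrite addn1 ltnn (ltn_ord i).
- move=> x y; rewrite /= !hmap_map addn1 ltnn (ltn_ord i) subnn.
  have [->|[m [-> -> gtm]]] := side_shift_unit l y;
  have [[-> ->]|->|[m' [-> -> gtm']]] := side_cycle_unit i x;
  rewrite /= ?flow_edge; split; try tauto; intuition; try discriminate.
  all: try match goal with
    | h : flow _ (inr _) _ |- _ => move: (flow_ltl h); lia
    | h : flow _ _ (inr _) |- _ => move: (flow_ltr h); lia
    end.
- by move=> [v|[]]; exists erefl, erefl.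
Qed.

End GraphLaws.

(** * Elements of P with labelled inputs and outputs *)

Section Labelled.
Variables (P : trap) (U W : Type).

Record labelled := Labelled {
  lk : nat;
  ll : nat;
  la : 'I_lk -> U;
  lb : 'I_ll -> W;
  lp : P lk ll
}.

Definition lab_act (x : labelled) (s : 'S_(ll x)) (t : 'S_(lk x)) : labelled :=
  Labelled (@la x \o t) (@lb x \o (s^-1)%g) (ract (lact s (lp x)) t).

Definition lab_eq (x y : labelled) : Prop := exists s t, y = @lab_act x s t.

Lemma lab_equiv : Equivalence lab_eq.
Proof.
have PP := trapP P.
split.
- move=> [k l a b p]; exists 1%g, 1%g; rewrite /lab_act /=.
  rewrite (lact1 PP) (ract1 PP).
  by congr Labelled; apply/funext => i; rewrite /= ?invg1 perm1.
- move=> [k l a b p] y [s [t ->]]; exists s^-1%g, t^-1%g.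
  rewrite /lab_act /= (lractA PP) (lactM PP) (ractM PP) mulgV mulVg.
  rewrite (lact1 PP) (ract1 PP).
  by congr Labelled; apply/funext => i; rewrite /= ?invgK ?permK ?permKV.
- move=> [k l a b p] y z [s [t ->]] [s' [t' ->]].
  exists (s * s')%g, (t' * t)%g.
  rewrite /lab_act /= (lractA PP) (lactM PP) (ractM PP) /=.
  by congr Labelled; apply/funext => i; rewrite /= ?invMg permM.
Qed.

(** The disjoint union over k and l of the products of U^k, P(k, l) and W^l,
    modulo the symmetric groups. Labels may be repeated. This type is not
    indexed by k and l, and concatenation makes it a commutative monoid:
    products over the vertices of a graph need no choice of an order, and the
    theory of iterated operators applies to them. *)
Definition labclass : Type := quot lab_eq.

Definition qlab k l (a : 'I_k -> U) (b : 'I_l -> W) (p : P k l) : labclass :=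
  cls lab_eq (Labelled a b p).

Lemma qlab_ind (R : labclass -> Prop) :
  (forall k l a b p, R (@qlab k l a b p)) -> forall q, R q.
Proof.
by move=> h q; rewrite -[q]repK; case: (rep q) => k l a b p; apply: h.
Qed.

Lemma qlab_act k l (a : 'I_k -> U) (b : 'I_l -> W) (p : P k l)
    (s : 'S_l) (t : 'S_k) :
  qlab (a \o t) (b \o (s^-1)%g) (ract (lact s p) t) = qlab a b p.
Proof. by apply/esym/(cls_eq _ _ lab_equiv); exists s, t. Qed.

Lemma qlab_cast k l k' l' (ek : k = k') (el : l = l') a b (p : P k l)
    (a' : 'I_k' -> U) (b' : 'I_l' -> W) :
  (forall i, a i = a' (cast_ord ek i)) ->
  (forall j, b j = b' (cast_ord el j)) ->
  qlab a b p = qlab a' b' (acast ek el p).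
Proof.
case: _ / ek a' => a'; case: _ / el b' => b' ea eb /=.
by congr qlab; apply/funext => i; rewrite ?ea ?eb cast_ord_id.
Qed.

Lemma labelled_inj (x y : labelled) : x = y ->
  exists (ek : lk x = lk y) (el : ll x = ll y),
    [/\ forall i, la i = la (cast_ord ek i),
        forall j, lb j = lb (cast_ord el j) &
        acast ek el (lp x) = lp y].
Proof.
by move=> ->; exists erefl, erefl; split=> // i; rewrite cast_ord_id.
Qed.

Lemma qlab_arity k l a b (p : P k l) k' l' a' b' (p' : P k' l') :
  qlab a b p = qlab a' b' p' -> k = k' /\ l = l'.
Proof.
by move=> /(cls_eq _ _ lab_equiv) [s [t /labelled_inj [/= ek [el _]]]].
Qed.

Lemma qlab_inj k l a b (p : P k l) a' b' (p' : P k l) :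
  qlab a b p = qlab a' b' p' ->
  exists (s : 'S_l) (t : 'S_k),
    [/\ a' = a \o t, b' = b \o (s^-1)%g & p' = ract (lact s p) t].
Proof.
move=> /(cls_eq _ _ lab_equiv) [s [t /= /labelled_inj [/= ek [el]]]] /=.
rewrite (eq_irrelevance ek erefl) (eq_irrelevance el erefl) => -[ea eb ep].
exists s, t; split; last exact: ep.
  by apply/funext => i; rewrite ea cast_ord_id.
by apply/funext => i; rewrite eb cast_ord_id.
Qed.

Definition sumlab (T : Type) k k' (a : 'I_k -> T) (a' : 'I_k' -> T)
    (i : 'I_(k + k')) : T :=
  match split i with inl i => a i | inr i => a' i end.

Lemma sumlab_l T k k' (a : 'I_k -> T) (a' : 'I_k' -> T) i :
  sumlab a a' (lshift k' i) = a i.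
Proof. by rewrite /sumlab (unsplitK (inl i)). Qed.

Lemma sumlab_r T k k' (a : 'I_k -> T) (a' : 'I_k' -> T) i :
  sumlab a a' (rshift k i) = a' i.
Proof. by rewrite /sumlab (unsplitK (inr i)). Qed.

Lemma sumlab_eq T k k' (a : 'I_k -> T) (a' : 'I_k' -> T) c :
  (forall i, c (lshift k' i) = a i) -> (forall i, c (rshift k i) = a' i) ->
  sumlab a a' = c.
Proof.
move=> cl cr; apply/funext => i.
by case: (split_ordP i) => j ->; rewrite ?sumlab_l ?sumlab_r.
Qed.

Definition qcat (q r : labclass) : labclass :=
  qlab (sumlab (@la (rep q)) (@la (rep r))) (sumlab (@lb (rep q)) (@lb (rep r)))
    (hcat (lp (rep q)) (lp (rep r))).

Lemma qcatE k l k' l' a b (p : P k l) a' b' (p' : P k' l') :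
  qcat (qlab a b p) (qlab a' b' p') =
  qlab (sumlab a a') (sumlab b b') (hcat p p').
Proof.
have PP := trapP P; rewrite /qcat.
have : lab_eq (Labelled a b p) (rep (qlab a b p)).
  by apply/(cls_eq _ _ lab_equiv); rewrite repK.
have : lab_eq (Labelled a' b' p') (rep (qlab a' b' p')).
  by apply/(cls_eq _ _ lab_equiv); rewrite repK.
move: (rep _) => y' [s' [t' ->]]; move: (rep _) => y [s [t ->]] /=.
rewrite (hcat_act PP) -[RHS](qlab_act _ _ _ (tens_perm s s') (tens_perm t t')).
have tens_l m n (u : 'S_m) (v : 'S_n) i :
    tens_perm u v (lshift n i) = lshift n (u i).
  by rewrite permE /tens_perm_fun (unsplitK (inl i)).
have tens_r m n (u : 'S_m) (v : 'S_n) i :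
    tens_perm u v (rshift m i) = rshift m (v i).
  by rewrite permE /tens_perm_fun (unsplitK (inr i)).
congr qlab; apply: sumlab_eq => i /=.
- by rewrite tens_l sumlab_l.
- by rewrite tens_r sumlab_r.
- by rewrite -{1}[i](permKV s) -(tens_l _ _ s s') permK sumlab_l.
- by rewrite -{1}[i](permKV s') -(tens_r _ _ s s') permK sumlab_r.
Qed.

Definition of_ord0 (T : Type) (i : 'I_0) : T := False_rect T (notF (ltn_ord i)).

Lemma ord0_eq (T : Type) (a b : 'I_0 -> T) : a = b.
Proof. by apply/funext => -[]. Qed.

Definition qone : labclass := qlab (@of_ord0 U) (@of_ord0 W) hone.

Lemma sumlabA T k k' k'' (a : 'I_k -> T) (a' : 'I_k' -> T)
    (a'' : 'I_k'' -> T) i :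
  sumlab a (sumlab a' a'') i =
  sumlab (sumlab a a') a'' (cast_ord (addnA k k' k'') i).
Proof.
case: (split_ordP i) => j ->; first rewrite sumlab_l.
  have -> : cast_ord (addnA k k' k'') (lshift (k' + k'') j) =
      lshift k'' (lshift k' j).
    exact: val_inj.
  by rewrite !sumlab_l.
rewrite sumlab_r; case: (split_ordP j) => j' ->.
  have -> : cast_ord (addnA k k' k'') (rshift k (lshift k'' j')) =
      lshift k'' (rshift k j').
    exact: val_inj.
  by rewrite !sumlab_l sumlab_r.
have -> : cast_ord (addnA k k' k'') (rshift k (rshift k' j')) =
    rshift (k + k') j'.
  by apply: val_inj; rewrite /= addnA.
by rewrite !sumlab_r.
Qed.

Lemma sumlabC T k k' (a : 'I_k -> T) (a' : 'I_k' -> T) i :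
  sumlab a' a (cast_ord (addnC k k') (block_perm k k' i)) = sumlab a a' i.
Proof.
rewrite permE /block_perm_fun cast_ord_comp cast_ord_id.
by rewrite {2}/sumlab; case: (split i) => j; rewrite ?sumlab_l ?sumlab_r.
Qed.

Lemma qcatA : associative qcat.
Proof.
elim/qlab_ind => k l a b p; elim/qlab_ind => k' l' a' b' p'.
elim/qlab_ind => k'' l'' a'' b'' p''; rewrite !qcatE -(hcatA (trapP P)).
by apply: qlab_cast => i; apply: sumlabA.
Qed.

Lemma qcatC : commutative qcat.
Proof.
elim/qlab_ind => k l a b p; elim/qlab_ind => k' l' a' b' p'; rewrite !qcatE.
rewrite -[LHS](qlab_act _ _ _ (block_perm l l') 1%g) (ract1 (trapP P)).
rewrite (hcatC (trapP P)).
rewrite (@qlab_cast _ _ _ _ (addnC k' k) (addnC l' l)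
  (sumlab a' a) (sumlab b' b) (hcat p' p)
  (sumlab a' a \o cast_ord (addnC k k'))
  (sumlab b' b \o cast_ord (addnC l l'))).
- rewrite -[RHS](qlab_act _ _ _ 1%g (block_perm k k')) (lact1 (trapP P)).
  congr qlab; apply/funext => i /=; first by rewrite perm1 sumlabC.
  by rewrite invg1 perm1 -sumlabC permKV.
- by move=> i /=; rewrite cast_ord_comp cast_ord_id.
- by move=> i /=; rewrite cast_ord_comp cast_ord_id.
Qed.

Lemma qcat1q : left_id qone qcat.
Proof.
elim/qlab_ind => k l a b p; rewrite qcatE (hcat1p (trapP P)).
by congr qlab; apply: sumlab_eq => i; [case: (i)|congr a; exact: val_inj
                                      |case: (i)|congr b; exact: val_inj].
Qed.

End Labelled.

HB.instance Definition _ (P : trap) (U W : Type) :=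
  Monoid.isComLaw.Build (labclass P U W) (qone P U W) (@qcat P U W)
    (@qcatA P U W) (@qcatC P U W) (@qcat1q P U W).

(** ** Change of labels *)

Section Qmap.
Variable P : trap.

Definition qmap U W U' W' (h : U -> U') (g : W -> W') (q : labclass P U W) :
    labclass P U' W' :=
  qlab (h \o @la _ _ _ (rep q)) (g \o @lb _ _ _ (rep q)) (lp (rep q)).

Lemma qmapE U W U' W' (h : U -> U') (g : W -> W') k l a b (p : P k l) :
  qmap h g (qlab a b p) = qlab (h \o a) (g \o b) p.
Proof.
rewrite /qmap; have : lab_eq (Labelled a b p) (rep (qlab a b p)).
  by apply/(cls_eq _ _ (lab_equiv P U W)); rewrite repK.
by move: (rep _) => y [s [t ->]] /=; rewrite -[RHS](qlab_act _ _ _ s t).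
Qed.

Lemma qmap_comp U W U' W' U'' W'' (h : U -> U') (g : W -> W')
    (h' : U' -> U'') (g' : W' -> W'') (q : labclass P U W) :
  qmap h' g' (qmap h g q) = qmap (h' \o h) (g' \o g) q.
Proof. by elim/qlab_ind: q => k l a b p; rewrite !qmapE. Qed.

Lemma eq_qmap U W U' W' (h h' : U -> U') (g g' : W -> W') (q : labclass P U W) :
  h =1 h' -> g =1 g' -> qmap h g q = qmap h' g' q.
Proof. by move=> /funext -> /funext ->. Qed.

Lemma comp_sumlab U U' (h : U -> U') k k' (a : 'I_k -> U) (a' : 'I_k' -> U) :
  h \o sumlab a a' = sumlab (h \o a) (h \o a').
Proof. by apply/esym/sumlab_eq => i; rewrite /= ?sumlab_l ?sumlab_r. Qed.

Lemma qmap_cat U W U' W' (h : U -> U') (g : W -> W') :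
  {morph qmap h g : q r / qcat q r >-> qcat q r}.
Proof.
elim/qlab_ind => k l a b p; elim/qlab_ind => k' l' a' b' p'.
by rewrite !(qmapE, qcatE) !comp_sumlab.
Qed.

Lemma qmap_one U W U' W' (h : U -> U') (g : W -> W') :
  qmap h g (qone P U W) = qone P U' W'.
Proof. by rewrite qmapE; congr qlab; apply: ord0_eq. Qed.

End Qmap.

(** ** Partial traces *)

Definition uniq_at (T : Type) n (a : 'I_n -> T) (u : T) : Prop :=
  exists i, forall i', a i' = u <-> i' = i.

Section Qtrace.
Variables (P : trap) (U W : Type).
Implicit Types (u : U) (w : W) (q r : labclass P U W).

(** Tracing the input labelled u with the output labelled w. It is made total in
    qtr below: where one of the labels occurs several times or not at all,
    nothing is traced. With this convention traces at distinct labels always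
    commute (qtrC). *)
Definition qtraces u w q r : Prop :=
  exists k l (a : 'I_k.+1 -> U) (b : 'I_l.+1 -> W) (p : P k.+1 l.+1) i j,
  [/\ q = qlab a b p, forall i', a i' = u <-> i' = i,
      forall j', b j' = w <-> j' = j &
      r = qlab (a \o lift i) (b \o lift j) (ptr i j p)].

Lemma qtraces_fun u w q r r' : qtraces u w q r -> qtraces u w q r' -> r = r'.
Proof.
move=> [k [l [a [b [p [i [j [-> ai bj ->]]]]]]]].
move=> [k' [l' [a' [b' [p' [i' [j' [e ai' bj' ->]]]]]]]].
have [[ek] [el]] := qlab_arity e; subst k' l'.
have [s [t [ea eb ->]]] := qlab_inj e; subst a' b'.
have <- : t i' = i by apply/ai/ai'.
have <- : (s^-1)%g j' = j by apply/bj/bj'.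
rewrite (ptr_act (trapP P)).
rewrite -[LHS](qlab_act _ _ _ (perm_del s j') (perm_del t (t i'))).
congr qlab; apply/funext => x /=; [congr a|congr b].
  by rewrite permE lift_lower permK.
rewrite -{2}[x](permKV (perm_del s j')) [perm_del s j' _]permE lift_lower.
by rewrite permK.
Qed.

Lemma qtraces_ex u w k l a b (p : P k l) :
  (exists r, qtraces u w (qlab a b p) r) <-> uniq_at a u /\ uniq_at b w.
Proof.
split=> [[r [k' [l' [a' [b' [p' [i [j [e ai bj _]]]]]]]]]|].
  have [ek el] := qlab_arity e; subst k l.
  have [s [t [ea eb _]]] := qlab_inj (esym e); subst a b.
  split; [exists ((t^-1)%g i)|exists (s j)] => x.
    split=> [/ai <-|->]; first by rewrite permK.
    by apply/ai; rewrite permKV.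
  split=> [/bj <-|->]; first by rewrite permKV.
  by apply/bj; rewrite permK.
move=> [[i ai] [j bj]]; case: k l a b p i j ai bj => [|k] [|l] a b p i j ai bj;
  try by [case: (i)|case: (j)].
by exists (qlab (a \o lift i) (b \o lift j) (ptr i j p)), k, l, a, b, p, i, j.
Qed.

Definition qtr u w q : labclass P U W :=
  match pselect (exists r, qtraces u w q r) with
  | left h => sval (cid h)
  | right _ => q
  end.

Lemma qtrE u w k l a b (p : P k.+1 l.+1) i j :
  (forall i', a i' = u <-> i' = i) -> (forall j', b j' = w <-> j' = j) ->
  qtr u w (qlab a b p) = qlab (a \o lift i) (b \o lift j) (ptr i j p).
Proof.
move=> ai bj; have h : qtraces u w (qlab a b p)
    (qlab (a \o lift i) (b \o lift j) (ptr i j p)).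
  by exists k, l, a, b, p, i, j.
rewrite /qtr; case: pselect => [h'|[]]; last by eexists; exact: h.
by case: cid => r /= hr; exact: qtraces_fun hr h.
Qed.

Lemma qtr_id u w k l a b (p : P k l) :
  ~ (uniq_at a u /\ uniq_at b w) -> qtr u w (qlab a b p) = qlab a b p.
Proof. by rewrite -(qtraces_ex _ _ a b p) /qtr; case: pselect. Qed.

Lemma uniq_lift (T : Type) n (a : 'I_n.+1 -> T) i v :
  a i <> v -> uniq_at (a \o lift i) v -> uniq_at a v.
Proof.
move=> aiv [i0 hi0]; exists (lift i i0) => x.
case: (unliftP i x) => [y ->|->].
  by rewrite [a _ = v](hi0 y); split=> [->|/lift_inj].
by split=> // /eqP; rewrite (negbTE (neq_lift _ _)).
Qed.

Lemma uniq_lower (T : Type) n (a : 'I_n.+1 -> T) i i' v :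
  (forall x, a x = v <-> x = lift i i') ->
  forall y, (a \o lift i) y = v <-> y = i'.
Proof. by move=> av y; rewrite /= av; split=> [/lift_inj|->]. Qed.

(** When both traces take place this is the law ptrA. Otherwise at most one
    does, and removing the labels it traces does not change whether u' and w'
    occur exactly once. *)
Lemma qtrC u u' w w' q : u <> u' -> w <> w' ->
  qtr u w (qtr u' w' q) = qtr u' w' (qtr u w q).
Proof.
move=> uu' ww'; elim/qlab_ind: q => k l a b p.
(* Only the trace at v and x takes place. *)
have half v v' x x' : v <> v' -> x <> x' ->
    uniq_at a v /\ uniq_at b x -> ~ (uniq_at a v' /\ uniq_at b x') ->
    qtr v x (qtr v' x' (qlab a b p)) = qtr v' x' (qtr v x (qlab a b p)).
  move=> vv' xx' [[i ai] [j bj]] h; rewrite (qtr_id _ h).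
  case: k l a b p i j ai bj h => [|k] [|l] a b p i j ai bj h;
    try by [case: (i)|case: (j)].
  rewrite (qtrE _ ai bj) qtr_id // => -[h1 h2]; apply: h; split.
    by apply: uniq_lift h1; rewrite (ai i).2.
  by apply: uniq_lift h2; rewrite (bj j).2.
have [good|bad] := pselect (uniq_at a u /\ uniq_at b w); last first.
  have [good'|bad'] := pselect (uniq_at a u' /\ uniq_at b w').
    by apply/esym/half => // /esym.
  by rewrite !qtr_id.
have [good'|bad'] := pselect (uniq_at a u' /\ uniq_at b w'); last exact: half.
have [[i ai] [j bj]] := good; have [[i' ai'] [j' bj']] := good'.
have ii' : i != i'.
  by apply/eqP => ii'; apply: uu';
    rewrite -[u](ai i).2 // -[u'](ai' i').2 // ii'.
have jj' : j != j'.
  by apply/eqP => jj'; apply: ww';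
    rewrite -[w](bj j).2 // -[w'](bj' j').2 // jj'.
clear good good' half.
case: k a p i i' ai ai' ii' => [|[|k]] a p i i' ai ai' ii';
  [by case: (i)|by rewrite (ord1 i) (ord1 i') in ii'|].
case: l b p j j' bj bj' jj' => [|[|l]] b p j j' bj bj' jj';
  [by case: (j)|by rewrite (ord1 j) (ord1 j') in jj'|].
case/unlift_some: ii' ai' => i0 -> _ ai'.
case/unlift_some: jj' bj' => j0 -> _ bj'.
have [ei li] := lift_swap i i0; have [ej lj] := lift_swap j j0.
rewrite (qtrE _ ai bj) (qtrE _ (uniq_lower ai') (uniq_lower bj')).
have ai2 := ai; have bj2 := bj; rewrite -ei in ai2; rewrite -ej in bj2.
rewrite (qtrE _ ai' bj') (qtrE _ (uniq_lower ai2) (uniq_lower bj2)).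
rewrite -(ptrA (trapP P)); congr qlab; apply/funext => x /=.
  by rewrite li.
by rewrite lj.
Qed.

Lemma uniq_sumlab (T : Type) m n (a : 'I_m -> T) (a' : 'I_n -> T) v :
  (forall i, a' i <> v) -> uniq_at (sumlab a a') v -> uniq_at a v.
Proof.
move=> nv [i hi]; case: (split_ordP i) hi => x -> hi; last first.
  by case: (nv x); rewrite -(sumlab_r a) (hi _).2.
exists x => y; rewrite -(sumlab_l a a') hi.
by split=> [/eqP|->//]; rewrite eq_lshift => /eqP.
Qed.

Lemma sumlab_uniq (T : Type) m n (a : 'I_m -> T) (a' : 'I_n -> T) v i :
  (forall i, a' i <> v) -> (forall x, a x = v <-> x = i) ->
  forall x, sumlab a a' x = v <-> x = lshift n i.
Proof.
move=> nv ai x; case: (split_ordP x) => y ->.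
  rewrite sumlab_l ai; split=> [->//|/eqP]; by rewrite eq_lshift => /eqP.
rewrite sumlab_r; split=> [/nv //|/eqP]; by rewrite eq_rlshift.
Qed.

Lemma sumlab_lift (T : Type) m n (a : 'I_m.+1 -> T) (a' : 'I_n -> T)
    (i : 'I_m.+1) :
  (sumlab a a' : 'I_(m + n).+1 -> T) \o lift (lshift n i : 'I_(m + n).+1) =
  sumlab (a \o lift i) a'.
Proof.
apply/esym/sumlab_eq => x /=.
  rewrite (_ : lift _ _ = lshift n (lift i x)); last exact: val_inj.
  by rewrite sumlab_l.
rewrite (_ : lift _ _ = rshift m.+1 x) ?sumlab_r //; apply: val_inj => /=.
by rewrite /bump (leq_trans _ (leq_addr _ _)) // -ltnS.
Qed.

End Qtrace.

Lemma qtr_map P U W U' W' (h : U -> U') (g : W -> W') u w (q : labclass P U W) :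
  (forall v, h v = h u -> v = u) -> (forall v, g v = g w -> v = w) ->
  qtr (h u) (g w) (qmap h g q) = qmap h g (qtr u w q).
Proof.
move=> hu gw; elim/qlab_ind: q => k l a b p; rewrite qmapE.
have eqh x : h x = h u <-> x = u by split=> [/hu|->].
have eqg x : g x = g w <-> x = w by split=> [/gw|->].
have [[[i ai] [j bj]]|bad] := pselect (uniq_at a u /\ uniq_at b w).
  case: k l a b p i j ai bj => [|k] [|l] a b p i j ai bj;
    try by [case: (i)|case: (j)].
  rewrite (qtrE _ ai bj) qmapE (@qtrE _ _ _ _ _ _ _ _ _ _ i j) //.
    by move=> x /=; rewrite eqh.
  by move=> x /=; rewrite eqg.
rewrite (qtr_id _ bad) qmapE qtr_id // => -[[i hi] [j hj]]; apply: bad; split.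
  by exists i => x; rewrite -hi /= eqh.
by exists j => x; rewrite -hj /= eqg.
Qed.

(** By the law ptr_hcatl: as u and w do not occur in the right factor, their
    positions in the product are positions in the left factor. *)
Lemma qtr_cat P U W U' W' (h : U' -> U) (g : W' -> W) u w
    (q : labclass P U W) (r : labclass P U' W') :
  (forall v, h v <> u) -> (forall v, g v <> w) ->
  qtr u w (qcat q (qmap h g r)) = qcat (qtr u w q) (qmap h g r).
Proof.
move=> hu gw; elim/qlab_ind: q => k l a b p; elim/qlab_ind: r => k' l' a' b' p'.
rewrite qmapE qcatE.
have nu i : (h \o a') i <> u by exact: hu.
have nw i : (g \o b') i <> w by exact: gw.
have [[[i ai] [j bj]]|bad] := pselect (uniq_at a u /\ uniq_at b w).
  case: k l a b p i j ai bj => [|k] [|l] a b p i j ai bj;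
    try by [case: (i)|case: (j)].
  rewrite (qtrE _ ai bj) qcatE -(ptr_hcatl (trapP P)).
  have := @qtrE P U W u w (k + k') (l + l')
    (sumlab a (h \o a')) (sumlab b (g \o b')) (hcat p p')
    (lshift k' i) (lshift l' j) (sumlab_uniq nu ai) (sumlab_uniq nw bj).
  by rewrite !sumlab_lift.
rewrite (qtr_id _ bad) qcatE qtr_id // => -[h1 h2]; apply: bad; split.
  exact: uniq_sumlab h1.
exact: uniq_sumlab h2.
Qed.

(** ** Elements of P as labelled elements *)

Section Emb.
Variable P : trap.

Definition somev n (i : 'I_n) : option nat := Some (val i).

Lemma somev_inj n : injective (@somev n).
Proof. by move=> i j [/val_inj]. Qed.

(** An element of P(k, l) with its inputs and outputs labelled by their own
    positions. Since these labels are distinct, nothing is lost (emb_inj), and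
    the operations of P become operations on labels, concatenations and traces
    of labelled elements: this is how equations in P(k, l) are proved below. The
    label None is reserved for the internal edges of graphs. *)
Definition emb k l (p : P k l) : labclass P (option nat) (option nat) :=
  qlab (@somev k) (@somev l) p.

Lemma emb_inj k l : injective (@emb k l).
Proof.
have fixes n (s : 'S_n) : @somev n = @somev n \o s -> s = 1%g.
  move=> e; apply/permP => i; rewrite perm1; apply: somev_inj.
  by rewrite -[LHS]/((@somev n \o s) i) -e.
move=> p p' /qlab_inj [s [t [/fixes -> /fixes /(congr1 invg)]]].
by rewrite invgK invg1 => -> ->; rewrite (lact1 (trapP P)) (ract1 (trapP P)).
Qed.

Definition oshift k : option nat -> option nat := omap (addn k).

Definition oact n (s : 'S_n) : option nat -> option nat := omap (pact s).

Definition odel (i : nat) (x : option nat) : option nat :=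
  if x is Some m then if m == i then None else Some (unbump i m) else None.

Lemma emb_lact k l (s : 'S_l) (p : P k l) :
  emb (lact s p) = qmap id (oact s) (emb p).
Proof.
rewrite /emb qmapE -[RHS](qlab_act _ _ _ s 1%g) (ract1 (trapP P)).
congr qlab; apply/funext => i /=; first by rewrite perm1.
by rewrite pactE permKV.
Qed.

Lemma emb_ract k l (t : 'S_k) (p : P k l) :
  emb (ract p t) = qmap (oact t^-1%g) id (emb p).
Proof.
rewrite /emb qmapE -[RHS](qlab_act _ _ _ 1%g t) (lact1 (trapP P)).
congr qlab; apply/funext => i /=; last by rewrite invg1 perm1.
by rewrite pactE permK.
Qed.

Lemma emb_hone : emb hone = qone P _ _.
Proof. by congr qlab; apply: ord0_eq. Qed.

Lemma emb_hcat k l k' l' (p : P k l) (p' : P k' l') :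
  emb (hcat p p') = qcat (emb p) (qmap (oshift k) (oshift l) (emb p')).
Proof.
rewrite /emb qmapE qcatE; congr qlab; symmetry; exact: sumlab_eq.
Qed.

Lemma emb_ptr k l i j (p : P k.+1 l.+1) :
  emb (ptr i j p) =
  qmap (odel i) (odel j) (qtr (Some (val i)) (Some (val j)) (emb p)).
Proof.
have uq n (a : 'I_n) x : somev x = Some (val a) <-> x = a.
  by split=> [/(@somev_inj _ x a)|->].
rewrite /emb (qtrE _ (uq _ i) (uq _ j)) qmapE; congr qlab; apply/funext => x /=.
  by rewrite eq_sym (negbTE (neq_bump _ _)) bumpK.
by rewrite eq_sym (negbTE (neq_bump _ _)) bumpK.
Qed.

End Emb.

(** * The contraction of a graph *)

Lemma bij_inv_ex (A B : Type) (f : A -> B) :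
  bijective f -> exists g, cancel f g /\ cancel g f.
Proof. by move=> [g fK gK]; exists g. Qed.

Definition binv (A B : Type) (f : A -> B) (bf : bijective f) : B -> A :=
  sval (cid (bij_inv_ex bf)).

Lemma binvK A B (f : A -> B) (bf : bijective f) : cancel f (binv bf).
Proof. by rewrite /binv; case: cid => g []. Qed.

Lemma binvVK A B (f : A -> B) (bf : bijective f) : cancel (binv bf) f.
Proof. by rewrite /binv; case: cid => g []. Qed.

Section Traces.
Variables (P : trap) (A : eqType) (U W : Type) (f : A -> U) (g : A -> W).
Hypotheses (inj_f : injective f) (inj_g : injective g).
Implicit Types (s : seq A) (q : labclass P U W).

Definition qtrs s q : labclass P U W := foldr (fun e => qtr (f e) (g e)) q s.

Lemma qtrs_cat_seq s s' q : qtrs (s ++ s') q = qtrs s (qtrs s' q).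
Proof. exact: foldr_cat. Qed.

Lemma qtrs_qtr x s q : x \notin s ->
  qtrs s (qtr (f x) (g x) q) = qtr (f x) (g x) (qtrs s q).
Proof.
elim: s => //= y s IH; rewrite inE negb_or => /andP[xy /IH ->].
by rewrite qtrC // => [/inj_f|/inj_g] /esym/eqP; apply/negP.
Qed.

(** Distinct edges carry distinct labels, and such traces commute. *)
Lemma qtrs_perm s s' q : perm_eq s s' -> uniq s -> qtrs s q = qtrs s' q.
Proof.
elim: s s' => [|x s IH] s' /=; first by move=> /perm_size/esym/size0nil->.
move=> ss' /andP[xs us].
have xs' : x \in s' by rewrite -(perm_mem ss') mem_head.
case/splitPr: xs' ss' => l r; rewrite perm_sym perm_catC /= perm_cons perm_catC.
rewrite perm_sym => lr; rewrite (IH _ lr us) !qtrs_cat_seq /= qtrs_qtr //.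
by apply: contra xs => xl; rewrite (perm_mem lr) mem_cat xl.
Qed.

End Traces.

Lemma qtrs_map P (A A' : eqType) U W (f : A -> U) (g : A -> W) (h : A' -> A)
    (s : seq A') (q : labclass P U W) :
  qtrs f g (map h s) q = qtrs (f \o h) (g \o h) s q.
Proof. by elim: s => //= x s ->. Qed.

Lemma qtrs_qmap P (A : eqType) U W U' W' (f : A -> U) (g : A -> W)
    (h : U -> U') (h' : W -> W') (s : seq A) (q : labclass P U W) :
  (forall a v, h v = h (f a) -> v = f a) ->
  (forall a v, h' v = h' (g a) -> v = g a) ->
  qtrs (h \o f) (h' \o g) s (qmap h h' q) = qmap h h' (qtrs f g s q).
Proof.
by move=> hf hg; elim: s => //= x s ->; rewrite qtr_map // => v;
  [apply: hf|apply: hg].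
Qed.

Lemma qtrs_cat P (A : eqType) U W U' W' (f : A -> U) (g : A -> W)
    (h : U' -> U) (h' : W' -> W) (s : seq A)
    (q : labclass P U W) (r : labclass P U' W') :
  (forall a v, h v <> f a) -> (forall a v, h' v <> g a) ->
  qtrs f g s (qcat q (qmap h h' r)) = qcat (qtrs f g s q) (qmap h h' r).
Proof. by move=> hf hg; elim: s => //= x s ->; rewrite qtr_cat. Qed.

Section Eval.
Variable P : trap.

(** The decoration of v, its inputs and outputs labelled by the edges attached
    to them. Both ends of an internal edge e carry the label inl e, so that
    tracing at these labels glues the two ends. *)
Definition vertex k l (G : graph P k l) (v : gV G) :
    labclass P (gE G + gI G) (gE G + gO G) :=
  qlab (fun i => binv (gtgt_bij G) (existT _ v i))
    (fun j => binv (gsrc_bij G) (existT _ v j)) (gdec v).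

Definition vprod k l (G : graph P k l) :
    labclass P (gE G + gI G) (gE G + gO G) :=
  \big[@qcat _ _ _/qone P _ _]_(v : gV G) vertex v.

Definition ev k l (G : graph P k l) : labclass P (gE G + gI G) (gE G + gO G) :=
  qtrs inl inl (enum (gE G)) (vprod G).

Definition inlab k l (G : graph P k l) (x : gE G + gI G) : option nat :=
  if x is inr i then Some (val (galpha (inl i))) else None.

Definition outlab k l (G : graph P k l) (x : gE G + gO G) : option nat :=
  if x is inr o then Some (val (gbeta (inl o))) else None.

(** The contraction of G: the product of the decorations, traced along all
    internal edges, with the remaining inputs and outputs labelled as in G. The
    input-output edges and the loops are ignored. *)
Definition evl k l (G : graph P k l) : labclass P (option nat) (option nat) :=
  qmap (@inlab _ _ G) (@outlab _ _ G) (ev G).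

Lemma binv_eq A B (f : A -> B) (bf : bijective f) x y :
  f x = y -> binv bf y = x.
Proof. by move=> <-; rewrite binvK. Qed.

Lemma eq_end (V : Type) (n : V -> nat) (x : {v : V & 'I_(n v)}) v
    (i : 'I_(n v)) :
  tag x = v -> tagged x = i :> nat -> x = existT _ v i.
Proof. by move=> e1 e2; apply: flat_inj; exact: (f_equal2 pair e1 e2). Qed.

(** Neither the product over the vertices nor the traces along the internal
    edges depend on an order, so that an isomorphism only renames labels. *)
Lemma evl_iso k l (G H : graph P k l) : isomorphic G H -> evl G = evl H.
Proof.
move=> [f]; set u := sum_map (isoE f) (isoI f);
  set w := sum_map (isoE f) (isoO f).
have vE v : vertex (isoV f v) = qmap u w (vertex v).
  have [ei [eo ed]] := iso_dec f v.
  rewrite /vertex -ed qmapE; apply/esym/qlab_cast => i; apply/esym/binv_eq.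
    have [t p] := iso_tgt f (binv (gtgt_bij G) (existT _ v i)).
    by apply: eq_end; rewrite ?t ?p binvVK.
  have [t p] := iso_src f (binv (gsrc_bij G) (existT _ v i)).
  by apply: eq_end; rewrite ?t ?p binvVK.
have prodE : vprod H = qmap u w (vprod G).
  rewrite /vprod (big_morph (qmap u w) (@qmap_cat _ _ _ _ _ u w)
    (qmap_one _ u w)).
  rewrite (reindex (isoV f)) /=; last exact/onW_bij/isoV_bij.
  by apply: eq_bigr => v _.
have uI : injective u.
  by apply/bij_inj/sum_map_bij; [apply: isoE_bij|apply: isoI_bij].
have wI : injective w.
  by apply/bij_inj/sum_map_bij; [apply: isoE_bij|apply: isoO_bij].
have evE : ev H = qmap u w (ev G).
  rewrite /ev prodE -qtrs_qmap => [|a v /uI //|a v /wI //].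
  rewrite -[RHS](qtrs_map inl inl (isoE f)).
  apply: qtrs_perm => [a b []|a b []||] //; last exact: enum_uniq.
  apply: uniq_perm; [exact: enum_uniq| |].
    by rewrite map_inj_uniq ?enum_uniq //; apply/bij_inj/isoE_bij.
  move=> x; rewrite mem_enum inE; apply/esym/mapP.
  have [g fK gK] := isoE_bij f.
  by exists (g x); rewrite ?mem_enum ?gK.
rewrite /evl evE qmap_comp; apply: eq_qmap => -[x|x] //=.
  by rewrite -(iso_alpha f (inl x)).
by rewrite -(iso_beta f (inl x)).
Qed.

Lemma evl_lact k l (s : 'S_l) (G : graph P k l) :
  evl (graph_lact s G) = qmap id (oact s) (evl G).
Proof.
rewrite /evl qmap_comp; apply: eq_qmap => // -[x|x] //=.
by rewrite pactE.
Qed.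

Lemma evl_ract k l (t : 'S_k) (G : graph P k l) :
  evl (graph_ract G t) = qmap (oact t^-1%g) id (evl G).
Proof.
rewrite /evl qmap_comp; apply: eq_qmap => // -[x|x] //=.
by rewrite pactE.
Qed.

Lemma evl_novertex k l (G : graph P k l) :
  (gV G -> False) -> evl G = qone P _ _.
Proof.
move=> noV; have noE : gE G -> False.
  by move=> e; apply: noV (tag (gsrc (inl e))).
rewrite /evl /ev /vprod big1 => [|v]; last by case: (noV v).
by case: (enum (gE G)) => [|e]; [exact: qmap_one|case: (noE e)].
Qed.

Lemma evl_one : evl (graph_one P) = qone P _ _.
Proof. by apply: evl_novertex => -[]. Qed.

Lemma evl_corolla k l (p : P k l) : evl (graph_corolla p) = emb p.
Proof.
rewrite /evl /ev /vprod (big_pred1 tt) => [|[]] //.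
rewrite (_ : enum _ = [::]); last first.
  by rewrite enumT; apply: size0nil; rewrite -enumT -cardT card_void.
rewrite /= qmapE; congr qlab; apply/funext => i /=.
  by rewrite (@binv_eq _ _ _ _ (inr i) _ erefl).
by rewrite (@binv_eq _ _ _ _ (inr i) _ erefl).
Qed.

Lemma evl_hcat k l k' l' (G : graph P k l) (H : graph P k' l') :
  evl (graph_hcat G H) = qcat (evl G) (qmap (oshift k) (oshift l) (evl H)).
Proof.
set K := graph_hcat G H.
pose u : gE G + gI G -> gE K + gI K := sum_map inl inl.
pose w : gE G + gO G -> gE K + gO K := sum_map inl inl.
pose u' : gE H + gI H -> gE K + gI K := sum_map inr inr.
pose w' : gE H + gO H -> gE K + gO K := sum_map inr inr.
have endl (x : gE G + gI G) : gtgt (u x) =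
    existT (fun v : gV K => 'I_(gin v)) (inl (tag (gtgt x))) (tagged (gtgt x)).
  by case: x.
have endl' (x : gE G + gO G) : gsrc (w x) =
    existT (fun v : gV K => 'I_(gout v)) (inl (tag (gsrc x))) (tagged (gsrc x)).
  by case: x.
have endr (x : gE H + gI H) : gtgt (u' x) =
    existT (fun v : gV K => 'I_(gin v)) (inr (tag (gtgt x))) (tagged (gtgt x)).
  by case: x.
have endr' (x : gE H + gO H) : gsrc (w' x) =
    existT (fun v : gV K => 'I_(gout v)) (inr (tag (gsrc x))) (tagged (gsrc x)).
  by case: x.
have vl (v : gV G) : vertex (inl v : gV K) = qmap u w (vertex v).
  rewrite /vertex qmapE; congr qlab; apply/funext => i; apply: binv_eq.
    by apply: (etrans (endl _)); rewrite binvVK.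
  by apply: (etrans (endl' _)); rewrite binvVK.
have vr (v : gV H) : vertex (inr v : gV K) = qmap u' w' (vertex v).
  rewrite /vertex qmapE; congr qlab; apply/funext => i; apply: binv_eq.
    by apply: (etrans (endr _)); rewrite binvVK.
  by apply: (etrans (endr' _)); rewrite binvVK.
have prodE : vprod K = qcat (qmap u w (vprod G)) (qmap u' w' (vprod H)).
  rewrite /vprod (big_morph (qmap u w) (@qmap_cat _ _ _ _ _ u w)
    (qmap_one _ u w)).
  rewrite (big_morph (qmap u' w') (@qmap_cat _ _ _ _ _ u' w')
    (qmap_one _ u' w')).
  rewrite big_sumType /=.
  by congr qcat; apply: eq_bigr => v _.
have inj_l (A B : Type) : injective (@inl A B) by move=> a b [].
have inj_r (A B : Type) : injective (@inr A B) by move=> a b [].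
have evE : ev K = qcat (qmap u w (ev G)) (qmap u' w' (ev H)).
  rewrite /ev prodE.
  rewrite (@qtrs_perm _ _ _ _ _ _ _ _ _
    (map inl (enum (gE G)) ++ map inr (enum (gE H)))) ?enum_uniq //; last first.
    apply: uniq_perm; first exact: enum_uniq.
      rewrite cat_uniq (map_inj_uniq (@inj_l _ _)) (map_inj_uniq (@inj_r _ _)).
      rewrite !enum_uniq andbT /=.
      by apply/hasPn => x /mapP[y _ ->]; apply/mapP => -[].
    move=> x; rewrite mem_enum mem_cat; apply/esym/orP.
    by case: x => x; [left|right]; apply: map_f; rewrite mem_enum.
  rewrite qtrs_cat_seq (qtrs_map _ _ inl) (qtrs_map _ _ inr).
  rewrite [qcat _ _]qcatC qtrs_cat; [|by move=> a [v|v]|by move=> a [v|v]].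
  rewrite (qtrs_qmap (f := inl) (g := inl) (h := u') (h' := w')); last first.
  - by move=> a [v|v] // [->].
  - by move=> a [v|v] // [->].
  rewrite [qcat _ _]qcatC qtrs_cat; [|by move=> a [v|v]|by move=> a [v|v]].
  rewrite (qtrs_qmap (f := inl) (g := inl) (h := u) (h' := w)) //.
  - by move=> a [v|v] // [->].
  - by move=> a [v|v] // [->].
rewrite /evl evE qmap_cat !qmap_comp; congr qcat.
  by apply: eq_qmap => -[x|x].
by apply: eq_qmap => -[x|x].
Qed.

(** A trace does not touch the vertices: the products of decorations of G and of
    its trace G' only differ by the renaming of half-edges ht, hs. *)
Section Rewire.
Variables (k l : nat) (G : graph P k.+1 l.+1).
Variables (e : gI G + gIO G) (f : gO G + gIO G).
Variables (E' I' O' IO' L' : finType).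
Variables (hs : E' + O' -> gE G + gO G) (ht : E' + I' -> gE G + gI G).
Variables (hi : I' + IO' -> gI G + gIO G) (ho : O' + IO' -> gO G + gIO G).
Variables (bs : bijective hs) (bt : bijective ht).
Variables (hiP : onto_compl e hi) (hoP : onto_compl f ho).
Let G' := @rewire _ k l G e f E' I' O' IO' L' hs ht hi ho bs bt hiP hoP.

Lemma vprod_rewire : qmap ht hs (vprod G') = vprod G.
Proof.
rewrite /vprod (big_morph (qmap ht hs) (@qmap_cat _ _ _ _ _ ht hs)
  (qmap_one _ ht hs)).
apply: eq_bigr => v _; rewrite /vertex qmapE; congr qlab; apply/funext => i /=.
  by apply/esym/binv_eq; rewrite -[RHS](binvVK (gtgt_bij G')).
by apply/esym/binv_eq; rewrite -[RHS](binvVK (gsrc_bij G')).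
Qed.

Lemma qtrs_rewire s : qmap ht hs (qtrs inl inl s (vprod G')) =
  qtrs (ht \o inl) (hs \o inl) s (vprod G).
Proof.
rewrite -vprod_rewire qtrs_qmap // => a v.
  by move/(bij_inj bt).
by move/(bij_inj bs).
Qed.

Lemma evl_rewire (c d : option nat -> option nat) :
  (forall x, inlab (x : gE G' + gI G') = c (inlab (ht x))) ->
  (forall x, outlab (x : gE G' + gO G') = d (outlab (hs x))) ->
  evl G' = qmap c d (qmap (@inlab _ _ G) (@outlab _ _ G) (qmap ht hs (ev G'))).
Proof. by move=> hc hd; rewrite /evl !qmap_comp; apply: eq_qmap. Qed.

End Rewire.

Lemma odel_relabel (A B : Type) n (f : A -> 'I_n.+1) (e : A) (h : B -> A)
    (bij_f : bijective f) (hP : onto_compl e h) b :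
  odel (f e) (Some (val (f (h b)))) = Some (val (relabel bij_f hP b)).
Proof. by rewrite /= ifN //; exact: (relabel_neq bij_f hP b). Qed.

(** For an output j traced with an input on an input-output edge: it takes over
    the output label j1 of that edge. Likewise with inputs and outputs
    exchanged. *)
Definition osub (j j1 : nat) (x : option nat) : option nat :=
  if x == Some j then Some j1 else x.

Lemma osub_ne (A B : Type) n (f : A -> 'I_n.+1) (e : A) (h : B -> A) j1
    (bij_f : bijective f) (hP : onto_compl e h) b :
  osub (f e) j1 (Some (val (f (h b)))) = Some (val (f (h b))).
Proof.
rewrite /osub ifN //; apply/eqP => -[] /val_inj /(bij_inj bij_f).
exact: onto_neq.
Qed.

Section Trace.
Variables (k l : nat) (G : graph P k.+1 l.+1).

(** The new internal edge None is the only additional trace to perform, and it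
    joins the output j to the input i. *)
Lemma evl_trace_internal (e : gI G) (f : gO G)
    (i := galpha (inl e)) (j := gbeta (inl f)) :
  evl (trace_internal e f) =
  qmap (odel i) (odel j) (qtr (Some (val i)) (Some (val j)) (evl G)).
Proof.
rewrite (@evl_rewire _ _ _ _ _ _ _ _ _ _ _ _ _ _ _ _ _ _ (odel i) (odel j)).
- congr qmap; rewrite /ev.
  rewrite (@qtrs_perm _ _ _ _ _ _ _ _ _ (None :: map Some (enum (gE G))))
    ?enum_uniq //.
  + rewrite qtrs_rewire /= qtrs_map -/(ev G).
    rewrite -qtr_map // => -[v|v] // [] /val_inj.
      by move/(bij_inj (galpha_bij G)) => [->].
    by move/(bij_inj (gbeta_bij G)) => [->].
  + by move=> a b [].
  + by move=> a b [].
  + apply: uniq_perm; first exact: enum_uniq.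
      rewrite /= map_inj_uniq ?enum_uniq ?andbT; last by move=> a b [].
      by apply/mapP => -[].
    move=> [x|]; rewrite mem_enum inE //=; apply/esym/map_f.
    by rewrite mem_enum.
- move=> [[x|]|x] //=; first by rewrite eqxx.
  exact/esym/(odel_relabel (galpha_bij G) (del_lP _ e) (inl x)).
- move=> [[x|]|x] //=; first by rewrite eqxx.
  exact/esym/(odel_relabel (gbeta_bij G) (del_lP _ f) (inl x)).
Qed.

Lemma evl_trace_output (e : gIO G) (f : gO G)
    (i := galpha (inr e)) (j := gbeta (inl f)) :
  evl (trace_output e f) =
  qmap (odel i) (odel j \o osub j (gbeta (inr e))) (evl G).
Proof.
rewrite (@evl_rewire _ _ _ _ _ _ _ _ _ _ _ _ _ _ _ _ _ _
  (odel i) (odel j \o osub j (gbeta (inr e)))).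
- by congr qmap; rewrite [X in qmap _ _ X]qtrs_rewire.
- move=> [x|x] //=.
  exact/esym/(odel_relabel (galpha_bij G) (del_rP _ e) (inl x)).
- pose P' := del_l_none_to_rP f e.
  move=> [x|[x|]] //.
    apply: etrans (congr1 (odel j)
      (esym (osub_ne _ (gbeta_bij G) P' (inl (Some x))))).
    exact/esym/(odel_relabel (gbeta_bij G) P' (inl (Some x))).
  rewrite /= /osub eqxx.
  exact/esym/(odel_relabel (gbeta_bij G) P' (inl None)).
Qed.

Lemma evl_trace_input (e : gI G) (f : gIO G)
    (i := galpha (inl e)) (j := gbeta (inr f)) :
  evl (trace_input e f) =
  qmap (odel i \o osub i (galpha (inr f))) (odel j) (evl G).
Proof.
rewrite (@evl_rewire _ _ _ _ _ _ _ _ _ _ _ _ _ _ _ _ _ _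
  (odel i \o osub i (galpha (inr f))) (odel j)).
- by congr qmap; rewrite [X in qmap _ _ X]qtrs_rewire.
- pose P' := del_l_none_to_rP e f.
  move=> [x|[x|]] //.
    apply: etrans (congr1 (odel i)
      (esym (osub_ne _ (galpha_bij G) P' (inl (Some x))))).
    exact/esym/(odel_relabel (galpha_bij G) P' (inl (Some x))).
  rewrite /= /osub eqxx.
  exact/esym/(odel_relabel (galpha_bij G) P' (inl None)).
- move=> [x|x] //=.
  exact/esym/(odel_relabel (gbeta_bij G) (del_rP _ f) (inl x)).
Qed.

Lemma evl_trace_input_output (e f : gIO G) (ef : e != f)
    (i := galpha (inr e)) (j := gbeta (inr f)) :
  evl (trace_input_output ef) = qmap (odel i) (odel j) (evl G).
Proof.
rewrite (@evl_rewire _ _ _ _ _ _ _ _ _ _ _ _ _ _ _ _ _ _ (odel i) (odel j)).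
- by congr qmap; rewrite [X in qmap _ _ X]qtrs_rewire.
- move=> [x|x] //.
  exact/esym/(odel_relabel (galpha_bij G) (del_r_none_in_rPl _ ef) (inl x)).
- move=> [x|x] //.
  exact/esym/(odel_relabel (gbeta_bij G) (del_r_none_in_rPr _ ef) (inl x)).
Qed.

Lemma evl_trace_loop (e : gIO G) (i := galpha (inr e)) (j := gbeta (inr e)) :
  evl (trace_loop e) = qmap (odel i) (odel j) (evl G).
Proof.
rewrite (@evl_rewire _ _ _ _ _ _ _ _ _ _ _ _ _ _ _ _ _ _ (odel i) (odel j)).
- by congr qmap; rewrite [X in qmap _ _ X]qtrs_rewire.
- move=> [x|x] //.
  exact/esym/(odel_relabel (galpha_bij G) (del_rP _ e) (inl x)).
- move=> [x|x] //.
  exact/esym/(odel_relabel (gbeta_bij G) (del_rP _ e) (inl x)).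
Qed.

Lemma flow_input_edge (e : gI G + gIO G) n :
  flow G (inr (val (galpha e))) (inr n) ->
  exists2 x, e = inr x & n = val (gbeta (inr x)).
Proof.
move=> [d]; rewrite -[inr (val _)]/(esrc (inr e : gedge G)) => /esrc_inj ->.
by case: e => [x|x] //= [<-]; exists x.
Qed.

Lemma flow_output_edge (f : gO G + gIO G) m :
  flow G (inr m) (inr (val (gbeta f))) ->
  exists2 x, f = inr x & m = val (galpha (inr x)).
Proof.
move=> [d ed]; rewrite -etgt_out => /etgt_inj dE; move: ed; rewrite {}dE.
by case: f => [x|x] //= [<-]; exists x.
Qed.

(** The next four lemmas compute the contraction of a trace from the contraction
    of G and from the pairs of labels joined by input-output edges, without any
    other knowledge of G. *)
Lemma evl_ptr_internal (i : 'I_k.+1) (j : 'I_l.+1) :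
  (forall n, ~ flow G (inr (val i)) (inr n)) ->
  (forall m, ~ flow G (inr m) (inr (val j))) ->
  evl (graph_ptr i j G) =
  qmap (odel i) (odel j) (qtr (Some (val i)) (Some (val j)) (evl G)).
Proof.
rewrite /graph_ptr; move: (input_edgeK G i) (output_edgeK G j).
move: (input_edge G i) (output_edge G j) => [e|e] f <- <- noi noj; last first.
  by case: (noi (val (gbeta (inr e)))); exists (inr (inr e)).
case: f noj => [f|f] noj; first exact: evl_trace_internal.
by case: (noj (val (galpha (inr f)))); exists (inr (inr f)).
Qed.

Lemma evl_ptr_output (i : 'I_k.+1) (j : 'I_l.+1) j1 :
  flow G (inr (val i)) (inr j1) ->
  (forall m, ~ flow G (inr m) (inr (val j))) ->
  evl (graph_ptr i j G) = qmap (odel i) (odel j \o osub j j1) (evl G).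
Proof.
rewrite /graph_ptr; move: (input_edgeK G i) (output_edgeK G j).
move: (input_edge G i) (output_edge G j) =>
  e f <- <- /flow_input_edge[x -> ->] noj.
case: f noj => [f|f] noj; first exact: evl_trace_output.
by case: (noj (val (galpha (inr f)))); exists (inr (inr f)).
Qed.

Lemma evl_ptr_input (i : 'I_k.+1) (j : 'I_l.+1) i1 :
  (forall n, ~ flow G (inr (val i)) (inr n)) ->
  flow G (inr i1) (inr (val j)) ->
  evl (graph_ptr i j G) = qmap (odel i \o osub i i1) (odel j) (evl G).
Proof.
rewrite /graph_ptr; move: (input_edgeK G i) (output_edgeK G j).
move: (input_edge G i) (output_edge G j) =>
  e f <- <- noi /flow_output_edge[x -> ->].
case: e noi => [e|e] noi; first exact: evl_trace_input.
by case: (noi (val (gbeta (inr e)))); exists (inr (inr e)).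
Qed.

Lemma evl_ptr_io (i : 'I_k.+1) (j : 'I_l.+1) i1 j1 :
  flow G (inr (val i)) (inr j1) -> flow G (inr i1) (inr (val j)) ->
  evl (graph_ptr i j G) = qmap (odel i) (odel j) (evl G).
Proof.
rewrite /graph_ptr; move: (input_edgeK G i) (output_edgeK G j).
move: (input_edge G i) (output_edge G j) => e f <- <-.
move=> /flow_input_edge[x -> _] /flow_output_edge[y -> _] /=.
case: eq_comparable => [xy|xy]; last exact: evl_trace_input_output.
by subst y; exact: evl_trace_loop.
Qed.

End Trace.
End Eval.

(** * The invariants of a graph *)

Section Invariant.
Variable P : trap.

Definition nio X (N : net X) (m n : nat) : Prop :=
  nflow (n := N) (inr m) (inr n).

(** The pairs of labels joined by input-output edges. *)
Definition io k l (G : graph P k l) : nat -> nat -> Prop := nio (den G).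

(** The relation that turns out to be the relation of the theorem (simP), stated
    without decompositions: visibly an equivalence, it is a congruence because
    each invariant of a composite only depends on the invariants of the
    components. *)
Definition same k l (G H : graph P k l) : Prop :=
  [/\ evl G = evl H, io G = io H & #|gL G| = #|gL H|].

Lemma same_sym k l (G H : graph P k l) : same G H -> same H G.
Proof. by case. Qed.

Lemma same_trans k l (G H K : graph P k l) : same G H -> same H K -> same G K.
Proof.
by move=> [e1 e2 e3] [e1' e2' e3']; split; [rewrite e1|rewrite e2|rewrite e3].
Qed.

Lemma ioP k l (G : graph P k l) m n :
  io G m n <-> exists x : gIO G, m = galpha (inr x) /\ n = gbeta (inr x).
Proof.
split=> [[[[e|e]|[e|e]] // [<-] [<-]]|[x [-> ->]]]; first by exists e.
by exists (inr (inr x)).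
Qed.

Lemma same_iso k l (G H : graph P k l) : isomorphic G H -> same G H.
Proof.
move=> GH; split; first exact: evl_iso.
  case: GH => f; apply/funext => m; apply/funext => n; apply/propext.
  rewrite !ioP; split=> -[x [-> ->]].
    by exists (isoIO f x); rewrite -(iso_alpha f (inr x)) -(iso_beta f (inr x)).
  have [g fK gK] := isoIO_bij f; exists (g x).
  by rewrite -(iso_alpha f (inr _)) -(iso_beta f (inr _)) /= gK.
by case: GH => f; exact: bij_eq_card (isoL_bij f).
Qed.

Lemma io_lact k l s (G : graph P k l) m n :
  io (graph_lact s G) m n = io G m (pact s^-1%g n).
Proof. by rewrite /io den_lact. Qed.

Lemma io_ract k l t (G : graph P k l) m n :
  io (graph_ract G t) m n = io G (pact t m) n.
Proof. by rewrite /io den_ract. Qed.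

Lemma io_hcat k l k' l' (G : graph P k l) (H : graph P k' l') m n :
  io (graph_hcat G H) m n =
  if m < k then (if n < l then io G m n else False)
  else if n < l then False else io H (m - k) (n - l).
Proof. by rewrite /io den_hcat /nio /=; do 2?case: ifP. Qed.

Lemma io_ptr k l i j (G : graph P k.+1 l.+1) m n :
  io (graph_ptr i j G) m n =
  (io G (bump i m) (bump j n) \/ io G (bump i m) j /\ io G i (bump j n)).
Proof. by rewrite /io den_ptr. Qed.

Lemma loops_ptr k l i j (G : graph P k.+1 l.+1) :
  #|gL (graph_ptr i j G)| = #|gL G| + `[< io G i j >].
Proof. by have /(congr1 (@nloops _)) := den_ptr i j G. Qed.

Lemma same_lact k l s (G G' : graph P k l) :
  same G G' -> same (graph_lact s G) (graph_lact s G').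
Proof.
move=> [eE eio eL]; split=> //; first by rewrite !evl_lact eE.
by apply/funext => m; apply/funext => n; rewrite !io_lact eio.
Qed.

Lemma same_ract k l t (G G' : graph P k l) :
  same G G' -> same (graph_ract G t) (graph_ract G' t).
Proof.
move=> [eE eio eL]; split=> //; first by rewrite !evl_ract eE.
by apply/funext => m; apply/funext => n; rewrite !io_ract eio.
Qed.

Lemma same_hcat k l k' l' (G G' : graph P k l) (H H' : graph P k' l') :
  same G G' -> same H H' -> same (graph_hcat G H) (graph_hcat G' H').
Proof.
move=> [eE eio eL] [eE' eio' eL']; split; first by rewrite !evl_hcat eE eE'.
  by apply/funext => m; apply/funext => n; rewrite !io_hcat eio eio'.
by rewrite !card_sum eL eL'.
Qed.

Lemma same_ptr k l i j (G G' : graph P k.+1 l.+1) :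
  same G G' -> same (graph_ptr i j G) (graph_ptr i j G').
Proof.
move=> [eE eio eL]; split; last by rewrite !loops_ptr eio eL.
  have [[j1 ij1]|noi] := pselect (exists n, io G i n);
  have [[i1 i1j]|noj] := pselect (exists m, io G m j).
  - rewrite (evl_ptr_io ij1 i1j).
    by rewrite [in RHS](@evl_ptr_io _ _ _ _ i j i1 j1) ?eE //
      -[flow _ _ _]/(io _ _ _) -eio.
  - rewrite (evl_ptr_output ij1) => [|m im]; last by apply: noj; exists m.
    rewrite [in RHS](@evl_ptr_output _ _ _ _ i j j1) ?eE //.
      by rewrite -[flow _ _ _]/(io _ _ _) -eio.
    by move=> m im; apply: noj; exists m; rewrite eio.
  - rewrite (evl_ptr_input _ i1j) => [|n nj]; last by apply: noi; exists n.
    rewrite [in RHS](@evl_ptr_input _ _ _ _ i j i1) ?eE //.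
      by move=> n nj; apply: noi; exists n; rewrite eio.
    by rewrite -[flow _ _ _]/(io _ _ _) -eio.
  - rewrite evl_ptr_internal => [|n nj|m im]; last 2 first.
    + by apply: noi; exists n.
    + by apply: noj; exists m.
    rewrite [in RHS]evl_ptr_internal ?eE //.
      by move=> n nj; apply: noi; exists n; rewrite eio.
    by move=> m im; apply: noj; exists m; rewrite eio.
by apply/funext => m; apply/funext => n; rewrite !io_ptr eio.
Qed.

Lemma io_solar k l (G : graph P k l) m n : solar G -> io G m n -> False.
Proof.
by move=> [noIO _] /ioP[x _]; have := card0_eq noIO x; rewrite inE.
Qed.

Lemma same_solar k l (G H : graph P k l) :
  solar G -> solar H -> evl G = evl H -> same G H.
Proof.
move=> sG sH eE; split=> //; last by rewrite (proj2 sG) (proj2 sH).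
apply/funext => m; apply/funext => n; apply/propext.
by split=> h; [case: (io_solar sG h)|case: (io_solar sH h)].
Qed.

End Invariant.

(** * Solar graphs are generated by corollas *)

Section Cut.
Variables (X : nat -> nat -> Type) (k l : nat) (G : graph X k l) (e : gE G).

Definition cut_ends (A : finType) (x : {x : gE G | x != e} + option A) :
    gE G + A :=
  match x with
  | inl x => inl (val x)
  | inr (Some a) => inr a
  | inr None => inl e
  end.

Lemma cut_ends_bij A : bijective (@cut_ends A).
Proof.
apply: inj_surj_bij => [|[x|a]].
- move=> [[x hx]|[a|]] [[y hy]|[b|]] //= [] exy; subst=> //.
  + by congr inl; apply: val_inj.
  + by exfalso; rewrite eqxx in hx.
  + by exfalso; rewrite eqxx in hy.
- have [->|ne] := eqVneq x e; first by exists (inr None).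
  by exists (inl (exist _ x ne)).
- by exists (inr (Some a)).
Qed.

Definition cut_labels (A B : Type) n (f : A + B -> 'I_n) (x : option A + B) :
    'I_n.+1 :=
  match x with
  | inl (Some a) => lift ord0 (f (inl a))
  | inl None => ord0
  | inr b => lift ord0 (f (inr b))
  end.

Lemma cut_labels_bij A B n (f : A + B -> 'I_n) :
  bijective f -> bijective (cut_labels f).
Proof.
move=> bf; have inj_f := bij_inj bf; apply: inj_surj_bij.
  by move=> [[a|]|b] [[a'|]|b'] //= /lift_inj/inj_f // [->].
move=> i; case: (unliftP ord0 i) => [j ->|->]; last by exists (inl None).
have [g _ gK] := bf; case eg: (g j) => [a|b].
  by exists (inl (Some a)); rewrite /= -eg gK.
by exists (inr b); rewrite /= -eg gK.
Qed.

(** G with the internal edge e cut into an input and an output edge, both with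
    the label 0. *)
Definition cut : graph X k.+1 l.+1 :=
  @Graph X k.+1 l.+1 (gV G) {x : gE G | x != e} (option (gI G)) (option (gO G))
    (gIO G) (gL G) _ _ (gsrc \o @cut_ends _) (gtgt \o @cut_ends _)
    (cut_labels galpha) (cut_labels gbeta) gdec
    (bij_comp (gsrc_bij G) (@cut_ends_bij _))
    (bij_comp (gtgt_bij G) (@cut_ends_bij _))
    (cut_labels_bij (galpha_bij G)) (cut_labels_bij (gbeta_bij G)).

Lemma card_cut : #|gE G| = #|gE cut|.+1.
Proof.
rewrite card_sig (cardD1 e) inE; congr _.+1.
by apply: eq_card => x; rewrite !inE andbT.
Qed.

Lemma ptr_cut : isomorphic (graph_ptr ord0 ord0 cut) G.
Proof.
apply: isomorphic_den; rewrite den_ptr.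
apply: net_ext => [x y|] /=; last first.
  rewrite asboolF ?addn0 // => -[[[d|[d|]]|[[d|]|d]]] //=.
have inj_b V : injective (@hmap V V id (bump 0)).
  by apply: hmap_inj => //; exact: can_inj (bumpK 0).
have no0 V (z : hend V) : hmap id (bump 0) z <> inr 0 by case: z.
have eE (d : gedge cut) : d = inl (inr None) \/ d = inr (inl None) \/
    exists o : gedge G, esrc d = hmap id (bump 0) (esrc o) /\
                        etgt d = hmap id (bump 0) (etgt o).
  case: d => [[d|[d|]]|[[d|]|d]]; [| |by left| |by right; left|]; right; right.
  - by exists (inl (inl (val d))).
  - by exists (inl (inr d)).
  - by exists (inr (inl d)).
  - by exists (inr (inr d)).
split=> [[[d]|[[d] + + [d']]]|[o <- <-]].
- case: (eE d) => [->|[->|[o [-> ->]]]] => [_ /esym/no0 //|/esym/no0 //|].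
  by move=> /inj_b <- /inj_b <-; exists o.
- case: (eE d) => [->|[->|[o [-> ->]]]] => [dx _|/esym/no0 //|_ /no0 //].
  case: (eE d') => [->|[->|[o [-> ->]]]] => [//|_ dy|/no0 //].
  by exists (inl (inl e)); apply: inj_b; [rewrite -dx|rewrite -dy].
case: o => [[o|o]|[o|o]].
- have [->|ne] := eqVneq o e; last by left; exists (inl (inl (exist _ o ne))).
  by right; split; [exists (inl (inr None))|exists (inr (inl None))].
- by left; exists (inl (inr (Some o))).
- by left; exists (inr (inl (Some o))).
- by left; exists (inr (inr o)).
Qed.

End Cut.

Lemma match_ends (V V' E E' A A' : finType) (n : V -> nat) (n' : V' -> nat)
    (g : E + A -> {v : V & 'I_(n v)}) (g' : E' + A' -> {v : V' & 'I_(n' v)})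
    (f : V -> V') :
  bijective g -> bijective g' -> (E -> False) -> (E' -> False) ->
  bijective f -> (forall v, n v = n' (f v)) ->
  exists2 h : A -> A', bijective h & forall a,
    tag (g' (inr (h a))) = f (tag (g (inr a))) /\
    tagged (g' (inr (h a))) = tagged (g (inr a)) :> nat.
Proof.
move=> bg bg' noE noE' bf en.
have [|||h bh hP] := @matching A A' (V' * nat)%type
  (fun a => (f (flat (g (inr a))).1, (flat (g (inr a))).2))
  (fun a => flat (g' (inr a))).
- move=> a b [] /(bij_inj bf) e1 e2.
  have /flat_inj/(bij_inj bg) : flat (g (inr a)) = flat (g (inr b)).
    exact: (f_equal2 pair e1 e2).
  by case.
- by move=> a b /flat_inj/(bij_inj bg') [].
- move=> [v m]; have [f' fK f'K] := bf.
  have inr_g (x : {v : V & 'I_(n v)}) : exists a, g (inr a) = x.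
    have [i _ iK] := bg; case ex: (i x) => [e|a]; first by case: (noE e).
    by exists a; rewrite -ex iK.
  have inr_g' (x : {v : V' & 'I_(n' v)}) : exists a, g' (inr a) = x.
    have [i _ iK] := bg'; case ex: (i x) => [e|a]; first by case: (noE' e).
    by exists a; rewrite -ex iK.
  split=> [[a [<- <-]]|[a [<- <-]]] /=.
    have [b eb] := inr_g' (existT _ (f (tag (g (inr a))))
      (cast_ord (en _) (tagged (g (inr a))))).
    by exists b; rewrite eb.
  have e : n' (tag (g' (inr a))) = n (f' (tag (g' (inr a)))) by rewrite en f'K.
  have [b eb] := inr_g (existT _ (f' (tag (g' (inr a))))
    (cast_ord e (tagged (g' (inr a))))).
  by exists b; rewrite eb /= f'K.
- exists h => // a; have := hP a; rewrite /flat => -[] *; by split.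
Qed.

Section Generation.
Variables (X : nat -> nat -> Type) (S : forall k l, graph X k l -> Prop).
Hypothesis S_iso : forall k l (G H : graph X k l),
  isomorphic G H -> solar G -> S G -> S H.
Hypothesis S_lact : forall k l s (G : graph X k l),
  solar G -> S G -> S (graph_lact s G).
Hypothesis S_ract : forall k l t (G : graph X k l),
  solar G -> S G -> S (graph_ract G t).
Hypothesis S_one : S (graph_one X).
Hypothesis S_hcat : forall k l k' l' (G : graph X k l) (H : graph X k' l'),
  solar G -> solar H -> S G -> S H -> S (graph_hcat G H).
Hypothesis S_ptr : forall k l i j (G : graph X k.+1 l.+1),
  solar G -> S G -> S (graph_ptr i j G).
Hypothesis S_corolla : forall k l (x : X k l), S (graph_corolla x).

Lemma graph_corolla_solar k l (x : X k l) : solar (graph_corolla x).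
Proof. by split; rewrite card_void. Qed.

(** By concatenating one corolla for each element of V. *)
Lemma corollas_ex (V : finType) (i o : V -> nat) (d : forall v, X (i v) (o v)) :
  exists k l (K : graph X k l), [/\ S K, solar K, gE K -> False &
    exists2 f : gV K -> V, bijective f &
      forall v, exists (ei : gin v = i (f v)) (eo : gout v = o (f v)),
        acast ei eo (gdec v) = d (f v)].
Proof.
have [n] := ubnP #|V|; elim: n V i o d => // n IH V i o d.
have [[v]|noV] := pselect (inhabited V); last first.
  move=> _; exists 0, 0, (graph_one X); split=> //;
    first exact: graph_one_solar.
  exists (fun v : void => of_void V v); last by case.
  by apply: no_elt_bij => [[]|v]; apply: noV.
rewrite (cardD1 v) inE add1n ltnS => ltV.
have [|k [l [K [SK solK noE [f bf fP]]]]] :=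
  IH {w : V | w != v} (fun w => i (val w)) (fun w => o (val w))
    (fun w => d (val w)).
  rewrite card_sig; apply: leq_trans ltV; rewrite ltnS;
    apply/eq_leq/eq_card => x.
  by rewrite !inE andbT.
exists (i v + k), (o v + l), (graph_hcat (graph_corolla (d v)) K).
have solc := graph_corolla_solar (d v).
split; [by apply: S_hcat|exact: graph_hcat_solar|by move=> [[]|/noE]|].
exists (fun x : unit + gV K =>
  match x with inl _ => v | inr w => val (f w) end).
  have inj_f := bij_inj bf; apply: inj_surj_bij.
    move=> [[]|x] [[]|y] //=.
    - by move=> e; have := valP (f y); rewrite /= -e eqxx.
    - by move=> e; have := valP (f x); rewrite /= e eqxx.
    - by move=> /val_inj/inj_f->.
  move=> w; have [->|ne] := eqVneq w v; first by exists (inl tt).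
  by have [g _ gK] := bf; exists (inr (g (exist _ w ne))); rewrite gK.
by move=> [[]|w]; [exists erefl, erefl|exact: fP].
Qed.

(** Cut all internal edges; what remains is a concatenation of corollas up to a
    renumbering of the inputs and outputs. *)
Lemma solar_generated k l (G : graph X k l) : solar G -> S G.
Proof.
have [n] := ubnP #|gE G|; elim: n k l G => // n IH k l G ltn solG.
have [[e]|noE] := pselect (inhabited (gE G)).
  apply: S_iso (ptr_cut e) _ _; first by apply: graph_ptr_solar.
  by apply: S_ptr => //; apply: IH => //; rewrite -ltnS -card_cut.
have {}noE (e : gE G) : False by apply: noE.
have noIO k0 l0 (H : graph X k0 l0) : solar H -> gIO H -> False.
  by move=> [h _] x; have := card0_eq h x; rewrite inE.
have [k' [l' [K [SK solK noEK [f bf fP]]]]] := corollas_ex (@gdec _ _ _ G).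
have ei v : gin v = gin (f v) by case: (fP v).
have eo v : gout v = gout (f v) by case: (fP v) => ? [].
have [fI bI hI] := match_ends (gtgt_bij K) (gtgt_bij G) noEK noE bf ei.
have [fO bO hO] := match_ends (gsrc_bij K) (gsrc_bij G) noEK noE bf eo.
have [fIO bIO] : exists h : gIO K -> gIO G, bijective h.
  by exists (fun x => False_rect _ (noIO _ _ _ solK x));
    apply: no_elt_bij => x; [exact: noIO solK x|exact: noIO solG x].
have ek : k' = k.
  have := bij_eq_card (galpha_bij K); rewrite card_ord => <-.
  have := bij_eq_card (galpha_bij G); rewrite card_ord => <-.
  by rewrite !card_sum (bij_eq_card bI) (bij_eq_card bIO).
have el : l' = l.
  have := bij_eq_card (gbeta_bij K); rewrite card_ord => <-.
  have := bij_eq_card (gbeta_bij G); rewrite card_ord => <-.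
  by rewrite !card_sum (bij_eq_card bO) (bij_eq_card bIO).
subst k' l'.
have bt : bijective (galpha \o sum_map fI fIO \o binv (galpha_bij K)).
  apply: bij_comp; last by exists galpha; [exact: binvVK|exact: binvK].
  by apply: bij_comp; [exact: galpha_bij|exact: sum_map_bij].
have bs : bijective (gbeta \o sum_map fO fIO \o binv (gbeta_bij K)).
  apply: bij_comp; last by exists gbeta; [exact: binvVK|exact: binvK].
  by apply: bij_comp; [exact: gbeta_bij|exact: sum_map_bij].
pose t := perm (bij_inj bt); pose s := perm (bij_inj bs).
apply: (@S_iso _ _ (graph_lact s (graph_ract K t^-1%g))) => //; last first.
  by apply: S_lact => //; apply: S_ract.
have [fL bL] := eq_card_bij (etrans (proj2 solK) (esym (proj2 solG))).
split; apply: (@Giso _ _ _ (graph_lact s (graph_ract K t^-1%g)) G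
  f (fun x => False_rect _ (noEK x)) fI fO fIO fL) => //.
- by apply: no_elt_bij.
- by move=> [x|x] //=; case: (noEK x).
- by move=> [x|x] //=; case: (noEK x).
- by move=> x /=; rewrite invgK permE /= binvK.
- by move=> x /=; rewrite permE /= binvK.
Qed.

End Generation.

(** * The morphism extending the identity *)

Section Extension.
Variable P : trap.

Lemma CGr_class_eq X k l (G H : graph X k l) :
  CGr_class G = CGr_class H <-> isomorphic G H.
Proof. exact: (cls_eq G H (isomorphic_equiv X k l)). Qed.

Lemma evl_rep k l (G : graph P k l) : evl (rep (CGr_class G)) = evl G.
Proof. exact/evl_iso/rep_class. Qed.

(** The labels of the contraction of a solar graph are its input and output
    labels, each occurring once; by generation from the corollas. *)
Lemma solar_emb k l (G : graph P k l) : solar G ->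
  exists x : P k l, evl G = emb x.
Proof.
elim/solar_generated: G /.
- by move=> k0 l0 G H /evl_iso ->.
- by move=> k0 l0 s G _ [x eG]; exists (lact s x); rewrite evl_lact eG emb_lact.
- by move=> k0 l0 t G _ [x eG]; exists (ract x t); rewrite evl_ract eG emb_ract.
- by exists hone; rewrite evl_one emb_hone.
- move=> k0 l0 k' l' G H _ _ [x eG] [y eH]; exists (hcat x y).
  by rewrite evl_hcat eG eH emb_hcat.
- move=> k0 l0 i j G solG [x eG]; exists (ptr i j x).
  by rewrite evl_ptr_internal ?eG ?emb_ptr // => m /(io_solar solG).
- by move=> k0 l0 x; exists x; rewrite evl_corolla.
Qed.

Lemma evl_solar_ex k l (c : solCGr P k l) :
  exists x : P k l, evl (rep (sval c)) = emb x.
Proof. exact/solar_emb/solar_rep/svalP. Qed.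

(** Contracting a solar graph; through emb this is evl (PhiP), so that the
    morphism laws for Phi are the formulas for evl. *)
Definition Phi k l (c : solCGr P k l) : P k l := sval (cid (evl_solar_ex c)).

Lemma PhiP k l (c : solCGr P k l) : emb (Phi c) = evl (rep (sval c)).
Proof. by rewrite /Phi; case: cid. Qed.

Lemma Phi_extends_id : @extends_id P Phi.
Proof.
split; last by move=> k l x; apply: emb_inj; rewrite PhiP evl_rep evl_corolla.
split.
- by move=> k l s p; apply: emb_inj; rewrite emb_lact !PhiP evl_rep evl_lact.
- by move=> k l t p; apply: emb_inj; rewrite emb_ract !PhiP evl_rep evl_ract.
- by apply: emb_inj; rewrite emb_hone PhiP evl_rep evl_one.
- by move=> k l k' l' p q; apply: emb_inj;
    rewrite emb_hcat !PhiP evl_rep evl_hcat.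
- move=> k l i j p; apply: emb_inj;
    rewrite emb_ptr !PhiP evl_rep evl_ptr_internal //.
    by move=> n /(io_solar (solar_rep (svalP p))).
  by move=> m /(io_solar (solar_rep (svalP p))).
Qed.

Lemma solar_class k l (G : graph P k l) : solar G -> CGr_solar (CGr_class G).
Proof. by exists G. Qed.

(** A morphism out of solCGr P is determined by its values on the corollas,
    which generate. *)
Lemma extends_id_eq (F : forall k l, solCGr P k l -> P k l) :
  extends_id F -> F = Phi.
Proof.
move=> [Fm Fid]; have [Pm Pid] := Phi_extends_id.
have CM := CGr_class_morphism P.
suff main k l (G : graph P k l) : solar G ->
    forall h : CGr_solar (CGr_class G), F k l (exist _ _ h) = Phi (exist _ _ h).
  apply/functional_extensionality_dep => k;
    apply/functional_extensionality_dep => l.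
  apply/funext => -[c h]; have := h => -[G solG eG]; subst c; exact: main.
elim/solar_generated: G /.
- move=> k0 l0 G H /CGr_class_eq e _ IH h.
  have h' : CGr_solar (CGr_class G) by rewrite e.
  have -> : exist _ _ h = exist _ _ h' :> solCGr P k0 l0 by apply: eq_exist.
  exact: IH.
- move=> k0 l0 s G /solar_class h0 IH h.
  have -> : exist _ _ h = lact s (exist _ _ h0 : solCGr P k0 l0).
    by apply: eq_exist; exact: (morph_lact CM).
  by rewrite (morph_lact Fm) (morph_lact Pm) IH.
- move=> k0 l0 t G /solar_class h0 IH h.
  have -> : exist _ _ h = ract (exist _ _ h0 : solCGr P k0 l0) t.
    by apply: eq_exist; exact: (morph_ract CM).
  by rewrite (morph_ract Fm) (morph_ract Pm) IH.
- move=> h; have -> : exist _ _ h = hone :> solCGr P 0 0 by apply: eq_exist.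
  by rewrite (morph_hone Fm) (morph_hone Pm).
- move=> k0 l0 k' l' G H /solar_class h0 /solar_class h1 IH IH' h.
  have -> : exist _ _ h =
      hcat (exist _ _ h0 : solCGr P k0 l0) (exist _ _ h1 : solCGr P k' l').
    by apply: eq_exist; exact: (morph_hcat CM).
  by rewrite (morph_hcat Fm) (morph_hcat Pm) IH IH'.
- move=> k0 l0 i j G /solar_class h0 IH h.
  have -> : exist _ _ h = ptr i j (exist _ _ h0 : solCGr P k0.+1 l0.+1).
    by apply: eq_exist; exact: (morph_ptr CM).
  by rewrite (morph_ptr Fm) (morph_ptr Pm) IH.
- move=> k0 l0 x h.
  have -> : exist _ _ h = solCGr_corolla x by apply: eq_exist.
  by rewrite Fid Pid.
Qed.

Lemma Phi_unique : unique (@extends_id P) Phi.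
Proof. by split; [exact: Phi_extends_id|move=> F /extends_id_eq]. Qed.

End Extension.

(** * Existence of the decomposition *)

Lemma perm_of_word n (w : seq 'I_n) : uniq w -> size w = n ->
  exists s : 'S_n, forall i, s i = nth i w i.
Proof.
move=> uw sw.
have inj : injective (fun i : 'I_n => nth i w i).
  move=> i j; rewrite (set_nth_default i j) ?sw // => /eqP.
  by rewrite nth_uniq ?sw // => /eqP/val_inj.
by exists (perm inj) => i; rewrite permE.
Qed.

Lemma enum_incr n (A : {set 'I_n}) (x : 'I_n) i j :
  i < j -> j < #|A| -> nth x (enum A) i < nth x (enum A) j.
Proof.
move=> ij jA.
have sA : sorted (fun a b : 'I_n => a < b) (enum A).
  rewrite /enum_mem; apply: sorted_filter.
    by move=> a b c; apply: ltn_trans.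
  by rewrite -(@sorted_map _ _ val ltn) -enumT val_enum_ord iota_ltn_sorted.
apply: (sorted_ltn_nth _ x sA) => //.
  by move=> a b c; apply: ltn_trans.
  by rewrite inE -cardE (ltn_trans ij).
by rewrite inE -cardE.
Qed.

(** The permutations s and t of a decomposition can be built from the pairs R of
    labels joined by input-output edges alone: s lists in increasing order the
    inputs that are not in such a pair, then the others; t lists the outputs
    that are not in such a pair, then the partners of the last inputs. *)
Lemma matching_perms k l (R : 'I_k -> 'I_l -> Prop) :
  (forall a b b', R a b -> R a b' -> b = b') ->
  (forall a a' b, R a b -> R a' b -> a = a') ->
  exists k' l' n (ek : k' + n = k) (el : l' + n = l) (s : 'S_k) (t : 'S_l),
    [/\ shuffle k' s, incr_first l' t &
      forall a b, R a b <->
        exists2 m, m < n & val a = pact s (k' + m) /\ val b = pact t (l' + m)].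
Proof.
(* The partner function phi below needs a default value. *)
case: l R => [|l] R Rfun Rinj.
  exists k, 0, 0, (addn0 k), erefl, 1%g, 1%g; split.
  - by split=> a b; rewrite !perm1.
  - by move=> [].
  - by move=> a [].
pose A := [set a | `[< ~ exists b, R a b >]].
pose B := [set b | `[< ~ exists a, R a b >]].
pose phi a :=
  if pselect (exists b, R a b) is left h then sval (cid h) else ord0.
have phiP a b : R a b -> phi a = b.
  move=> Rab; rewrite /phi; case: pselect => [h|[]]; last by exists b.
  by case: cid => b' /= Rab'; apply: Rfun Rab.
have inCA a : reflect (exists b, R a b) (a \in ~: A).
  by rewrite !inE -asbool_neg; apply: (iffP (asboolP _)) => [/contrapT|h []].
have inCB b : reflect (exists a, R a b) (b \in ~: B).
  by rewrite !inE -asbool_neg; apply: (iffP (asboolP _)) => [/contrapT|h []].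
have inj_phi : {in ~: A &, injective phi}.
  move=> a a' /inCA[b Rab] /inCA[b' Rab'];
    rewrite (phiP _ _ Rab) (phiP _ _ Rab') => bb'.
  by subst b'; apply: Rinj Rab Rab'.
have imphi : phi @: (~: A) = ~: B.
  apply/setP => b; apply/imsetP/inCB => [[a /inCA[b' Rab'] ->]|[a Rab]].
    by exists a; rewrite (phiP _ _ Rab').
  by exists a; [apply/inCA; exists b|rewrite (phiP _ _ Rab)].
have cA : #|A| + #|~: A| = k by rewrite cardsC card_ord.
have cB : #|B| + #|~: A| = l.+1.
  by rewrite -(card_in_imset inj_phi) imphi cardsC card_ord.
have [||s sE] := @perm_of_word _ (enum A ++ enum (~: A)).
- rewrite cat_uniq !enum_uniq andbT /=; apply/hasPn => x.
  by rewrite !mem_enum inE.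
- by rewrite size_cat -!cardE.
have [||t tE] := @perm_of_word _ (enum B ++ map phi (enum (~: A))).
- rewrite cat_uniq enum_uniq map_inj_in_uniq; last first.
    by move=> x y; rewrite !mem_enum; apply: inj_phi.
  rewrite enum_uniq andbT /=; apply/hasPn => x /mapP[a];
    rewrite !mem_enum => aA ->.
  by rewrite -in_setC -imphi imset_f.
- by rewrite size_cat size_map -!cardE.
exists #|A|, #|B|, #|~: A|, cA, cB, s, t; split.
- split=> a b; rewrite !sE (set_nth_default a b) ?size_cat -?cardE ?cA //
    !nth_cat -!cardE.
    move=> ab bA; rewrite bA (ltn_trans ab bA); exact: enum_incr.
  move=> aA ab; have bA := leq_trans aA (ltnW ab).
  rewrite [a < #|A|]ltnNge aA [b < #|A|]ltnNge bA /=.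
  apply: enum_incr; first by rewrite ltn_sub2r // (leq_ltn_trans aA).
  by rewrite ltn_subLR // cA.
- move=> a b ab bB; rewrite !tE (set_nth_default a b) ?size_cat ?size_map
    -?cardE ?cB //.
  by rewrite !nth_cat -!cardE bB (ltn_trans ab bB); exact: enum_incr.
have spos m (a0 : 'I_k) : m < #|~: A| ->
    pact s (#|A| + m) = nth a0 (enum (~: A)) m.
  move=> ltm; have lt : #|A| + m < k.
    by apply: leq_trans (eq_leq cA); rewrite ltn_add2l.
  rewrite -[_ + m]/(val (Ordinal lt)) pactE sE nth_cat -cardE /= ltnNge
    leq_addr /=.
  by rewrite addKn; congr val; apply: set_nth_default; rewrite -cardE.
have tpos m (a0 : 'I_k) : m < #|~: A| ->
    pact t (#|B| + m) = phi (nth a0 (enum (~: A)) m).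
  move=> ltm; have lt : #|B| + m < l.+1.
    by apply: leq_trans (eq_leq cB); rewrite ltn_add2l.
  rewrite -[_ + m]/(val (Ordinal lt)) pactE tE nth_cat -cardE /= ltnNge
    leq_addr /=.
  by rewrite addKn; congr val; rewrite (nth_map a0) // -cardE.
move=> a b; split=> [Rab|[m ltm [ea eb]]].
  have aA : a \in enum (~: A) by rewrite mem_enum; apply/inCA; exists b.
  exists (index a (enum (~: A))); first by rewrite cardE index_mem.
  rewrite (spos _ a) ?(tpos _ a) ?nth_index ?(phiP _ _ Rab) //;
    by rewrite cardE index_mem.
rewrite (spos _ a) // in ea; rewrite (tpos _ a) // in eb.
have /inCA[b' Rab'] : a \in ~: A.
  by rewrite -mem_enum (val_inj ea) mem_nth // -cardE.
by rewrite (val_inj eb) -(val_inj ea) (phiP _ _ Rab').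
Qed.

Lemma side0 (U V W : Type) (f : U -> W) (x : hend U) :
  side 0 (hmap (fun u => inr (f u) : V + W) id x) = inr (hmap f id x).
Proof. by case: x => [[]|m] //=; rewrite subn0. Qed.

Lemma hmapC V W (f : V -> W) g (x : hend V) :
  hmap id g (hmap f id x) = hmap f id (hmap id g x).
Proof. by case: x. Qed.

Section Powers.
Variable P : trap.
Let GD := graphData P.

Definition graph_loop : graph P 0 0 := graph_ptr ord0 ord0 (graph_edge P).

Lemma edges_powP n (G := hpow1 (graph_edge P : GD 1 1) n : graph P n n) :
  [/\ gV G -> False, #|gL G| = 0 &
      forall a b, io G a b <-> a = b /\ a < n].
Proof.
rewrite {}/G; elim: n => [|n [noV noL ioE]].
  split; [by case|exact: card_void|move=> x y; split=> [|[]//]].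
  by case=> [[[[]|[]]|[[]|[]]]].
split.
- by case=> [[]|/noV].
- by rewrite /= card_sum card_void noL.
- move=> a b; rewrite [io _ a b]io_hcat.
  have edgeE x y : io (graph_edge P) x y <-> x = 0 /\ y = 0.
    by rewrite /io /nio /= flow_edge; split=> [[[->] [->]]|[-> ->]].
  case: a b => [|a] [|b] /=; rewrite ?subSS ?subn0; try by split=> [|[]].
    by rewrite edgeE.
  by rewrite ioE ltnS; split=> [[->]|[[->]]].
Qed.

Lemma loops_powP n (G := hpow0 (graph_loop : GD 0 0) n : graph P 0 0) :
  (gV G -> False) /\ #|gL G| = n.
Proof.
have loopL : #|gL graph_loop| = 1.
  rewrite /graph_loop loops_ptr card_void asboolT //.
  by rewrite /io /nio /= flow_edge.
have loopV : gV graph_loop -> False.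
  have : gV graph_loop = void :> Type.
    by have /(congr1 (fun N : net P => (nV N : Type))) :=
      den_ptr ord0 ord0 (graph_edge P).
  by move=> ->.
rewrite {}/G; elim: n => [|n [noV Ln]]; first by split; [case|exact: card_void].
by split; [case=> [/loopV|/noV]|rewrite /= card_sum loopL Ln].
Qed.

Lemma class_hpow0 n :
  CGr_class (hpow0 (graph_loop : GD 0 0) n) = hpow0 (CGr_loop P) n.
Proof.
have CM := CGr_class_morphism P.
elim: n => [|n IH] /=; first exact: (morph_hone CM).
rewrite -IH (_ : CGr_loop P = CGr_class graph_loop).
  exact: (morph_hcat CM (graph_loop : GD 0 0) (hpow0 (graph_loop : GD 0 0) n)).
exact/esym/(morph_ptr CM ord0 ord0 (graph_edge P)).
Qed.

Lemma class_hpow1 n :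
  CGr_class (hpow1 (graph_edge P : GD 1 1) n) = hpow1 (CGr_edge P) n.
Proof.
have CM := CGr_class_morphism P.
elim: n => [|n IH] /=; first exact: (morph_hone CM).
rewrite -IH.
exact: (morph_hcat CM (graph_edge P : GD 1 1)
  (hpow1 (graph_edge P : GD 1 1) n)).
Qed.

Section SolarPart.
Variables (k l n : nat) (G : graph P (k + n) (l + n)).
Variables (s : 'S_(k + n)) (t : 'S_(l + n)).
Hypothesis ioE : forall a b, io G a b <->
  exists2 m, m < n & a = pact s (k + m) /\ b = pact t (l + m).

Lemma io_in a : (exists b, io G a b) <-> a < k + n /\ k <= pact s^-1%g a.
Proof.
split=> [[b /ioE[m ltm [-> _]]]|[lta ge]].
  by rewrite pactK pact_lt ltn_add2l leq_addr.
have ltm : pact s^-1%g a - k < n by rewrite ltn_subLR // pact_lt.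
exists (pact t (l + (pact s^-1%g a - k))); apply/ioE.
by exists (pact s^-1%g a - k); rewrite // subnKC // pactVK.
Qed.

Lemma io_out b : (exists a, io G a b) <-> b < l + n /\ l <= pact t^-1%g b.
Proof.
split=> [[a /ioE[m ltm [_ ->]]]|[ltb ge]].
  by rewrite pactK pact_lt ltn_add2l leq_addr.
have ltm : pact t^-1%g b - l < n by rewrite ltn_subLR // pact_lt.
exists (pact s (k + (pact t^-1%g b - l))); apply/ioE.
by exists (pact t^-1%g b - l); rewrite // subnKC // pactVK.
Qed.

Lemma solar_in_lt (x : gI G) : (s^-1)%g (galpha (inl x)) < k.
Proof.
rewrite ltnNge; apply/negP => ge.
have [|b /ioP[y [e _]]] := (io_in (galpha (inl x))).2.
  by rewrite pactE.
by have /(bij_inj (galpha_bij G)) := val_inj e.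
Qed.

Lemma solar_out_lt (x : gO G) : (t^-1)%g (gbeta (inl x)) < l.
Proof.
rewrite ltnNge; apply/negP => ge.
have [|a /ioP[y [_ e]]] := (io_out (gbeta (inl x))).2.
  by rewrite pactE.
by have /(bij_inj (gbeta_bij G)) := val_inj e.
Qed.

Definition sol_in (x : gI G + void) : 'I_k :=
  match x with inl x => Ordinal (solar_in_lt x) | inr x => of_void _ x end.

Definition sol_out (x : gO G + void) : 'I_l :=
  match x with inl x => Ordinal (solar_out_lt x) | inr x => of_void _ x end.

Lemma sol_in_bij : bijective sol_in.
Proof.
apply: inj_surj_bij => [[x|[]] [y|[]] [] /val_inj/perm_inj|i].
  by move=> /(bij_inj (galpha_bij G))[->].
have := input_edgeK G (s (lshift n i)); case: (input_edge _ _) => x ex.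
  by exists (inl x); apply: val_inj; rewrite /= ex permK.
have /io_in[_] : exists b, io G (galpha (inr x)) b.
  by exists (gbeta (inr x)); apply/ioP; exists x.
by rewrite ex pactE permK /= leqNgt ltn_ord.
Qed.

Lemma sol_out_bij : bijective sol_out.
Proof.
apply: inj_surj_bij => [[x|[]] [y|[]] [] /val_inj/perm_inj|i].
  by move=> /(bij_inj (gbeta_bij G))[->].
have := output_edgeK G (t (lshift n i)); case: (output_edge _ _) => x ex.
  by exists (inl x); apply: val_inj; rewrite /= ex permK.
have /io_out[_] : exists a, io G a (gbeta (inr x)).
  by exists (galpha (inr x)); apply/ioP; exists x.
by rewrite ex pactE permK /= leqNgt ltn_ord.
Qed.

(** G without its input-output edges and loops, the remaining labels being
    renumbered by s and t. *)
Definition solar_part : graph P k l :=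
  @Graph P k l (gV G) (gE G) (gI G) (gO G) void void _ _ gsrc gtgt
    sol_in sol_out gdec (gsrc_bij G) (gtgt_bij G) sol_in_bij sol_out_bij.

Lemma solar_part_solar : solar solar_part.
Proof. by split; rewrite card_void. Qed.

Lemma flow_solar_part x y :
  flow solar_part x y <->
  flow G (hmap id (pact s) x) (hmap id (pact t) y) /\ (is_inl x || is_inl y).
Proof.
have es (a : gI G) : pact s ((s^-1)%g (galpha (inl a))) = galpha (inl a).
  by rewrite pactE permKV.
have et (a : gO G) : pact t ((t^-1)%g (gbeta (inl a))) = gbeta (inl a).
  by rewrite pactE permKV.
split=> [[[[e|e]|[e|[]]] <- <-]|[[[[e|e]|[e|e]] /=]]] //=.
- by split=> //; exists (inl (inl e)).
- by split=> //; exists (inl (inr e)); rewrite //= et.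
- by split=> //; exists (inr (inl e)); rewrite //= es.
- case: x => [[v p]|//] /= [<- <-]; case: y => [[w q]|//] /= [<- <-] _.
  by exists (inl (inl e)).
- case: x => [[v p]|//] /= [<- <-]; case: y => [//|q] /= [eq] _.
  exists (inl (inr e)) => //=; congr inr; apply: (can_inj (pactK t)).
  by rewrite et.
- case: x => [//|q] /= [eq]; case: y => [[w r]|//] /= [<- <-] _.
  exists (inr (inl e)) => //=; congr inr; apply: (can_inj (pactK s)).
  by rewrite es.
- by case: x => [//|q] /= _; case: y.
Qed.

(** The vertices and the ends of internal edges are unchanged; a label of G is
    sent by s or t either to a label of the solar part or to one of the strands
    of I^n, and ioE says that these strands are the input-output edges of G. *)
Lemma solar_decomposition :
  isomorphic G (graph_hcat (hpow0 (graph_loop : GD 0 0) #|gL G|)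
    (graph_lact t (graph_ract
       (graph_hcat solar_part (hpow1 (graph_edge P : GD 1 1) n)) s^-1%g))).
Proof.
have [noV0 L0] := loops_powP #|gL G|; have [noV1 L1 io1] := edges_powP n.
set O := hpow0 _ _ in noV0 L0 *; set I := hpow1 _ _ in noV1 L1 io1 *.
apply: isomorphicP.
rewrite (_ : den (graph_hcat O _) =
  net_cat 0 0 (den O) (net_relabel id (pact t^-1%g)
  (net_relabel (pact s^-1%g) id (net_cat k l (den solar_part) (den I)))));
    last first.
  by rewrite -den_hcat -den_ract -den_lact; exact: den_hcat.
exists (fun v => inr (inl v)); split.
- apply: inj_surj_bij => [v w [] //|[v|[v|v]]]; first by case: (noV0 v).
    by exists v.
  by case: (noV1 v).
- by rewrite /= L0 L1 card_void !addn0.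
- move=> x y; rewrite /= !side0 !hmap_id.
  have [x' ->] : exists x', x = hmap id (pact s) x'.
    by exists (hmap id (pact s^-1%g) x); rewrite hmapK //; exact: pactVK.
  have [y' ->] : exists y', y = hmap id (pact t) y'.
    by exists (hmap id (pact t^-1%g) y); rewrite hmapK //; exact: pactVK.
  rewrite !hmapC !(hmapK (pactK _)) => {x y}.
  have side_inl (V W : Type) p (z : hend V) :
      side p (hmap (@inl V W) id z) =
      if z is inr m then if m < p then inl z else inr (inr (m - p))
      else inl z.
    by case: z => [[]|].
  have no_in m v : flow G (inr (pact s m)) (inl v) -> m < k.
    case=> -[[e|e]|[e|e]] //= [em] _.
    by rewrite -(pactK s m) -em pactE solar_in_lt.
  have no_out q v : flow G (inl v) (inr (pact t q)) -> q < l.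
    case=> -[[e|e]|[e|e]] //= _ [eq].
    by rewrite -(pactK t q) -eq pactE solar_out_lt.
  have io_lt m q : flow G (inr (pact s m)) (inr (pact t q)) <->
      [/\ k <= m, l <= q & m - k = q - l /\ m - k < n].
    rewrite -[flow _ _ _]/(io G _ _) ioE; split=> [[r ltr []]|[km lq [e lt]]].
      move=> /(can_inj (pactK s)) -> /(can_inj (pactK t)) ->.
      by rewrite !leq_addr !addKn.
    by exists (m - k) => //; rewrite {2}e !subnKC.
  rewrite !side_inl; case: x' => [v|m]; case: y' => [w|q].
  + by rewrite flow_solar_part /=; split=> [|[]].
  + case: ltnP => [lt|ge]; first by rewrite flow_solar_part /=; split=> [|[]].
    by split=> // /no_out; rewrite ltnNge ge.
  + case: ltnP => [lt|ge]; first by rewrite flow_solar_part /=; split=> [|[]].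
    by split=> // /no_in; rewrite ltnNge ge.
  case: (ltnP m k) => [ltm|gem]; case: (ltnP q l) => [ltq|geq].
  + rewrite flow_solar_part /=; split=> [/io_lt[]|[]//].
    by rewrite leqNgt ltm.
  + by split=> // /io_lt[]; rewrite leqNgt ltm.
  + by split=> // /io_lt[_]; rewrite leqNgt ltq.
  rewrite -[flow I _ _]/(io I _ _) io1 io_lt.
  by split=> [[]|].
- by move=> v; exists erefl, erefl.
Qed.

End SolarPart.
End Powers.

(** * The relation is the equality of invariants *)

Section Sim.
Variable P : trap.

(** The same k', l', s and t serve for all graphs with the same input-output
    pairs, and the contraction of the solar part is determined by that of G. *)
Lemma decomposition_ex k l (G0 : graph P k l) : exists k' l' s t,
  forall G : graph P k l, io G = io G0 ->
  exists2 H : solCGr P k' l', decomposition (CGr_class G) #|gL G| H s t &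
    evl (rep (sval H)) = qmap (oact s^-1%g) (oact t^-1%g) (evl G).
Proof.
have [||k' [l' [n [ek [el [s [t [shs sht ioE]]]]]]]] :=
    @matching_perms k l (fun a b => io G0 a b).
- by move=> a b b' ab ab'; apply: val_inj; have [] := flow_fun ab ab'.
- by move=> a a' b ab ab'; apply: val_inj; have [] := flow_inj ab ab'.
subst k l; exists k', l', s, t => G eio.
have {}ioE a b : io G a b <->
    exists2 m, m < n & a = pact s (k' + m) /\ b = pact t (l' + m).
  rewrite eio; split=> [ab|[m ltm [-> ->]]].
    have lta := flow_ltl ab; have ltb := flow_ltr ab.
    exact/(ioE (Ordinal lta) (Ordinal ltb)).
  have lts : pact s (k' + m) < k' + n by rewrite pact_lt ltn_add2l.
  have ltt : pact t (l' + m) < l' + n by rewrite pact_lt ltn_add2l.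
  by apply/(ioE (Ordinal lts) (Ordinal ltt)); exists m.
exists (exist _ _ (solar_class (solar_part_solar ioE))); last first.
  rewrite evl_rep [RHS]qmap_comp; apply: eq_qmap => -[x|x] //=.
    by rewrite pactE.
  by rewrite pactE.
split=> //; exists n, erefl, erefl.
have CM := CGr_class_morphism P.
pose GD := graphData P; pose I : GD 1 1 := graph_edge P;
  pose O : GD 0 0 := graph_loop P.
pose K : GD (k' + n) (l' + n) := graph_hcat (solar_part ioE) (hpow1 I n).
have KE : CGr_class K = hcat (CGr_class (solar_part ioE))
  (hpow1 (CGr_edge P) n).
  by rewrite -class_hpow1; exact: (morph_hcat CM (solar_part ioE : GD _ _)).
have ZE : CGr_class (graph_lact t (graph_ract K s^-1%g)) =
    lact t (ract (CGr_class K) s^-1%g).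
  apply: etrans (morph_lact CM t (graph_ract K s^-1%g : GD _ _)) _.
  by congr lact; exact: (morph_ract CM s^-1%g K).
transitivity (hcat (hpow0 (CGr_loop P) #|gL G|)
  (lact t (ract (CGr_class K) s^-1%g)));
  last by rewrite KE.
rewrite -ZE -class_hpow0.
apply: etrans (morph_hcat CM (hpow0 O #|gL G|)
  (graph_lact t (graph_ract K s^-1%g) : GD _ _)).
apply/CGr_class_eq; exact: (solar_decomposition ioE).
Qed.

Definition samec k l (c d : CGr P k l) : Prop := same (rep c) (rep d).

Lemma same_rep k l (G : graph P k l) : same (rep (CGr_class G)) G.
Proof. exact/same_iso/rep_class. Qed.

Lemma samec_class k l (G H : graph P k l) :
  samec (CGr_class G) (CGr_class H) <-> same G H.
Proof.
have rG := same_rep G; have rH := same_rep H; split=> h.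
  exact: same_trans (same_sym rG) (same_trans h rH).
exact: same_trans rG (same_trans h (same_sym rH)).
Qed.

Lemma samec_refl k l (c : CGr P k l) : samec c c.
Proof. by []. Qed.

Lemma samec_lact k l s (c d : CGr P k l) : samec c d ->
  samec (lact s c) (lact s d).
Proof. by move=> h; apply/samec_class/same_lact. Qed.

Lemma samec_ract k l t (c d : CGr P k l) : samec c d ->
  samec (ract c t) (ract d t).
Proof. by move=> h; apply/samec_class/same_ract. Qed.

Lemma samec_hcat k l k' l' (c d : CGr P k l) (c' d' : CGr P k' l') :
  samec c d -> samec c' d' -> samec (hcat c c') (hcat d d').
Proof. by move=> h h'; apply/samec_class/same_hcat. Qed.

Lemma samec_ptr k l i j (c d : CGr P k.+1 l.+1) :
  samec c d -> samec (ptr i j c) (ptr i j d).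
Proof. by move=> h; apply/samec_class/same_ptr. Qed.

Lemma samec_acast k l k' l' (ek : k = k') (el : l = l') (c d : CGr P k l) :
  samec c d -> samec (acast ek el c) (acast ek el d).
Proof. by case: _ / ek; case: _ / el. Qed.

Lemma samec_solar k l (c d : solCGr P k l) :
  samec (sval c) (sval d) <-> Phi c = Phi d.
Proof.
split=> [[h _ _]|h]; first by apply: emb_inj; rewrite !PhiP.
apply: same_solar; [exact/solar_rep/svalP|exact/solar_rep/svalP|].
by rewrite -!PhiP h.
Qed.

(** The components of a decomposition determine the invariants; the solar parts
    only matter through their contractions. *)
Lemma samec_decomposition k l (c d : CGr P k l) p k' l'
  (H H' : solCGr P k' l') s t :
  decomposition c p H s t -> decomposition d p H' s t -> Phi H = Phi H' ->
  samec c d.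
Proof.
move=> [_ _ [n [ek [el ->]]]] [_ _ [n' [ek' [el' ->]]]] /samec_solar h.
have nn' : n = n' by apply/(@addnI k'); rewrite ek ek'.
subst n'; rewrite (eq_irrelevance ek' ek) (eq_irrelevance el' el).
apply: (@samec_hcat 0 0 k l _ _ _ _ (samec_refl _)).
apply/samec_lact/samec_ract/samec_acast.
exact: samec_hcat h (samec_refl _).
Qed.

(** From left to right, Phi is the only candidate for the morphism in the
    definition of sim; from right to left, graphs with the same invariants are
    decomposed with the same shuffles. *)
Lemma simP k l (c d : CGr P k l) : sim c d <-> samec c d.
Proof.
split=> [[F [_ F1] [p [k' [l' [H [H' [s [t [dc dd eF]]]]]]]]]|[eE eio eL]].
  by apply: samec_decomposition dc dd _;
    rewrite (F1 _ (Phi_extends_id P)) in eF.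
exists (@Phi P); first exact: Phi_unique.
have [k' [l' [s [t dec]]]] := decomposition_ex (rep c).
have [H dH eH] := dec _ erefl; have [H' dH' eH'] := dec _ (esym eio).
exists #|gL (rep c)|, k', l', H, H', s, t; split.
- by move: dH; rewrite /CGr_class repK.
- by move: dH'; rewrite /CGr_class repK eL.
- by apply: emb_inj; rewrite !PhiP eH eH' eE.
Qed.

End Sim.

(** * The quotient *)

(** Laws that hold for graphs up to isomorphism hold in any image of the graphs
    that identifies isomorphic ones. *)
Section Image.
Variables (X : nat -> nat -> Type) (Q : trapData).
Variable phi : forall k l, graph X k l -> Q k l.
Hypothesis phiM : @trap_morphism (graphData X) Q phi.
Hypothesis phi_surj : forall k l (q : Q k l), exists G, q = phi G.
Hypothesis phi_iso : forall k l (G H : graph X k l),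
  isomorphic G H -> phi G = phi H.
Let GD := graphData X.

Lemma phi_acast k l k' l' (ek : k = k') (el : l = l') (G : graph X k l) :
  acast ek el (phi G) = phi (acast ek el G).
Proof. by case: _ / ek; case: _ / el. Qed.

Lemma image_trap : is_trap Q.
Proof.
have [Ml Mr M1 Mh Mt] := phiM.
have sur := phi_surj.
split.
- move=> k l p; have [G ->] := sur _ _ p; rewrite -Ml.
  exact/phi_iso/iso_lact1.
- move=> k l s s' p; have [G ->] := sur _ _ p; rewrite -!Ml.
  exact/phi_iso/iso_lactM.
- move=> k l p; have [G ->] := sur _ _ p; rewrite -Mr.
  exact/phi_iso/iso_ract1.
- move=> k l s s' p; have [G ->] := sur _ _ p; rewrite -!Mr.
  exact/phi_iso/iso_ractM.
- move=> k l s t p; have [G ->] := sur _ _ p; rewrite -Mr -!Ml -Mr.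
  exact/phi_iso/iso_lractA.
- move=> k l k' l' k'' l'' p q r.
  have [G ->] := sur _ _ p; have [H ->] := sur _ _ q; have [K ->] := sur _ _ r.
  rewrite -!Mh phi_acast; exact/phi_iso/iso_hcatA.
- move=> k l p; have [G ->] := sur _ _ p; rewrite -M1.
  exact: etrans (esym (Mh 0 0 k l hone G)) (phi_iso (iso_hcat1p G)).
- move=> k l p; have [G ->] := sur _ _ p; rewrite -M1 -Mh phi_acast.
  exact/phi_iso/iso_hcatp1.
- move=> k l k' l' s t s' t' p p'.
  have [G ->] := sur _ _ p; have [H ->] := sur _ _ p'.
  rewrite -!Ml -!Mr -!Mh -Ml -Mr; exact/phi_iso/iso_hcat_act.
- move=> k l k' l' p p'; have [G ->] := sur _ _ p; have [H ->] := sur _ _ p'.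
  rewrite -!Mh -Ml phi_acast -Mr; exact/phi_iso/iso_hcatC.
- move=> k l i j i' j' p; have [G ->] := sur _ _ p; rewrite -!Mt.
  exact/phi_iso/iso_ptrA.
- move=> k l i j s t p; have [G ->] := sur _ _ p; rewrite -Ml -Mr -!Mt -Ml -Mr.
  exact/phi_iso/iso_ptr_act.
- move=> k l k' l' p p' i j; have [G ->] := sur _ _ p;
    have [H ->] := sur _ _ p'.
  rewrite -Mt -!Mh.
  apply: etrans (esym (Mt (k + k') (l + l') (lshift k' i : 'I_(k + k').+1)
    (lshift l' j : 'I_(l + l').+1) (hcat (G : GD _ _) (H : GD _ _)))) _.
  exact/phi_iso/iso_ptr_hcatl.
- move=> k l k' l' p p' i j; have [G ->] := sur _ _ p;
    have [H ->] := sur _ _ p'.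
  rewrite -!Mh phi_acast -!Mt -Mh; exact/phi_iso/iso_ptr_hcatr.
Qed.

Lemma image_unit : is_unit Q (phi (graph_edge X)).
Proof.
have [Ml Mr M1 Mh Mt] := phiM.
have sur := phi_surj.
split.
- move=> k l j p; have [G ->] := sur _ _ p; rewrite -Ml.
  rewrite -(Mh 1 1 k.+1 l.+1 (graph_edge X) G).
  apply: etrans (esym (Mt k.+1 l.+1 ord0 (lift ord0 j)
    (hcat (graph_edge X : GD 1 1) (G : GD _ _)))) _.
  exact/phi_iso/iso_unit_out.
- move=> k l j p; have [G ->] := sur _ _ p; rewrite -Mr.
  rewrite -(Mh 1 1 k.+1 l.+1 (graph_edge X) G).
  apply: etrans (esym (Mt k.+1 l.+1 (lift ord0 j) ord0
    (hcat (graph_edge X : GD 1 1) (G : GD _ _)))) _.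
  exact/phi_iso/iso_unit_in.
- move=> k l j p; have [G ->] := sur _ _ p; rewrite -Ml.
  rewrite -(Mh k.+1 l.+1 1 1 G (graph_edge X)).
  apply: etrans (congr1 (acast _ _) (esym (Mt (k + 1) (l + 1) ord_max
    (lshift 1 j : 'I_(l + 1).+1) (hcat (G : GD _ _) (graph_edge X : GD 1 1)))))
      _.
  rewrite phi_acast; exact/phi_iso/iso_out_unit.
- move=> k l j p; have [G ->] := sur _ _ p; rewrite -Mr.
  rewrite -(Mh k.+1 l.+1 1 1 G (graph_edge X)).
  apply: etrans (congr1 (acast _ _) (esym (Mt (k + 1) (l + 1)
    (lshift 1 j : 'I_(k + 1).+1) ord_max
      (hcat (G : GD _ _) (graph_edge X : GD 1 1))))) _.
  rewrite phi_acast; exact/phi_iso/iso_in_unit.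
Qed.

End Image.

Section Quotient.
Variable P : trap.

Lemma sim_equiv k l : Equivalence (@sim P k l).
Proof.
split=> [c|c d|c d e]; rewrite ?simP; first exact: samec_refl.
  exact: same_sym.
exact: same_trans.
Qed.

Lemma proj_eq k l (c d : CGr P k l) : uPGr_proj c = uPGr_proj d <-> samec c d.
Proof. by rewrite -simP; exact: cls_eq (sim_equiv k l). Qed.

Lemma samec_proj k l (c : CGr P k l) : samec c (rep (uPGr_proj c)).
Proof. by apply/proj_eq; rewrite /uPGr_proj repK. Qed.

Lemma proj_morphism : trap_morphism (@uPGr_proj P).
Proof.
split=> //.
- by move=> k l s p; apply/proj_eq/samec_lact/samec_proj.
- by move=> k l t p; apply/proj_eq/samec_ract/samec_proj.
- by move=> k l k' l' p q; apply/proj_eq/samec_hcat; exact: samec_proj.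
- by move=> k l i j p; apply/proj_eq/samec_ptr/samec_proj.
Qed.

Definition uPGr_class k l (G : graph P k l) : uPGr P k l :=
  uPGr_proj (CGr_class G).

Lemma class_morphism : @trap_morphism (graphData P) (uPGr P) uPGr_class.
Proof.
have CM := CGr_class_morphism P; have PM := proj_morphism.
split=> //; rewrite /uPGr_class.
- by move=> k l s p; rewrite (morph_lact CM) (morph_lact PM).
- by move=> k l t p; rewrite (morph_ract CM) (morph_ract PM).
- by move=> k l k' l' p q; rewrite (morph_hcat CM) (morph_hcat PM).
- by move=> k l i j p; rewrite (morph_ptr CM) (morph_ptr PM).
Qed.

Lemma class_eq k l (G H : graph P k l) :
  isomorphic G H -> uPGr_class G = uPGr_class H.
Proof. by move/CGr_class_eq => e; rewrite /uPGr_class e. Qed.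

Lemma class_surj k l (p : uPGr P k l) : exists G, p = uPGr_class G.
Proof.
exists (rep (rep p)); rewrite /uPGr_class /CGr_class repK /uPGr_proj repK //.
Qed.

Lemma uPGr_trap : is_trap (uPGr P).
Proof. exact: image_trap class_morphism class_surj class_eq. Qed.

Lemma uPGr_unit : is_unit (uPGr P) (uPGr_proj (CGr_edge P)).
Proof. exact: image_unit class_morphism class_surj class_eq. Qed.

Definition solar_image k l (q : uPGr P k l) : Prop :=
  exists c : solCGr P k l, q = uPGr_proj (sval c).

Lemma solar_image_closed : is_subtrap solar_image.
Proof.
have PM := proj_morphism.
split.
- by move=> k l s q [c ->]; exists (lact s c); rewrite -(morph_lact PM).
- by move=> k l t q [c ->]; exists (ract c t); rewrite -(morph_ract PM).
- by exists hone.
- by move=> k l k' l' q r [c ->] [d ->]; exists (hcat c d);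
    rewrite -(morph_hcat PM).
- by move=> k l i j q [c ->]; exists (ptr i j c); rewrite -(morph_ptr PM).
Qed.

(** Solar graphs have no input-output edges and no loops: their contractions are
    their only invariants. *)
Lemma proj_solar k l (c d : solCGr P k l) :
  uPGr_proj (sval c) = uPGr_proj (sval d) <-> Phi c = Phi d.
Proof. by rewrite proj_eq samec_solar. Qed.

Definition corolla_class k l (x : P k l) : subTrap solar_image_closed k l :=
  exist _ (uPGr_proj (CGr_corolla x))
    (ex_intro _ (solCGr_corolla x) erefl).

(** Corollas are not stable under the operations, but Phi, being a morphism that
    is the identity on corollas, does not distinguish an operation on corollas
    from the corolla of the result. *)
Lemma corolla_class_morphism : trap_morphism corolla_class.
Proof.
have PM := proj_morphism; have [[Fl Fr F1 Fh Ft] Fid] := Phi_extends_id P.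
split.
- move=> k l s x; apply/eq_exist/(etrans _ (morph_lact PM s (CGr_corolla x))).
  apply/(proj_solar (solCGr_corolla (lact s x)) (lact s (solCGr_corolla x))).
  by rewrite Fl !Fid.
- move=> k l t x; apply/eq_exist/(etrans _ (morph_ract PM t (CGr_corolla x))).
  apply/(proj_solar (solCGr_corolla (ract x t)) (ract (solCGr_corolla x) t)).
  by rewrite Fr !Fid.
- apply/eq_exist/(etrans _ (morph_hone PM)).
  apply/(proj_solar (solCGr_corolla hone) hone).
  by rewrite F1 Fid.
- move=> k l k' l' x y.
  apply/eq_exist/(etrans _ (morph_hcat PM (CGr_corolla x) (CGr_corolla y))).
  apply/(proj_solar (solCGr_corolla (hcat x y))
    (hcat (solCGr_corolla x) (solCGr_corolla y))).
  by rewrite Fh !Fid.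
- move=> k l i j x; apply/eq_exist/(etrans _
    (morph_ptr PM i j (CGr_corolla x))).
  apply/(proj_solar (solCGr_corolla (ptr i j x)) (ptr i j (solCGr_corolla x))).
  by rewrite Ft !Fid.
Qed.

Lemma corolla_class_bij k l : bijective (@corolla_class k l).
Proof.
have [_ Fid] := Phi_extends_id P.
apply: inj_surj_bij => [x y /(congr1 sval)|[q [c qE]]].
  by move/(proj_solar (solCGr_corolla x) (solCGr_corolla y)); rewrite !Fid.
exists (Phi c); apply: eq_exist; rewrite qE.
by apply/(proj_solar (solCGr_corolla (Phi c)) c); rewrite Fid.
Qed.

End Quotient.

Theorem theorem3p4p1 (P : trap) :
  (forall k l, Equivalence (@sim P k l)) /\
  trap_morphism (@uPGr_proj P) /\
  is_trap (uPGr P) /\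
  is_unit (uPGr P) (uPGr_proj (CGr_edge P)) /\
  exists (S : forall k l, uPGr P k l -> Prop) (closedS : is_subtrap S),
    trap_isomorphic P (subTrap closedS).
Proof.
split; first exact: sim_equiv.
split; first exact: proj_morphism.
split; first exact: uPGr_trap.
split; first exact: uPGr_unit.
exists (@solar_image P), (solar_image_closed P), (@corolla_class P).
by split=> [|k l]; [exact: corolla_class_morphism|exact: corolla_class_bij].
Qed.
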